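(* Let $(S_t)_{t\ge0}$ be the semigroup of the symmetric exclusion process on $\Omega=\{0,1\}^{\mathbb{Z}^d}$ with kernel $p(\cdot,\cdot)$. Then, for any probability measure $\mu$ on $\Omega$ satisfying GEMB($c$), for all $t\geq0$, all $p\geq1$, all $a\ge 0$ and all bounded measurable $f:\Omega\to\mathbb{R}$, $$\|S_tf-\mathbb{E}_\mu(S_tf)\|_{L^p(\mu)}\leq 2\sqrt{c}\,\Big(p\,\Gamma\big(\tfrac p2\big)\Big)^{1/p}\sqrt{p_{2t}(0,0)}\;\|\delta f\|_1$$ and $$\mu\big(|S_tf-\mathbb{E}_\mu(S_tf)|\geq a\big)\leq 2\exp\left(-\frac{a^2}{4c\,p_{2t}(0,0)\,\|\delta f\|_1^2}\right).$$ In particular, if $\nu_\rho$ denotes the Bernoulli product measure with density $\rho$, then $\nu_\rho$ satisfies GEMB($c$) with $c=1/8$, and hence $$\|S_tf-\mathbb{E}_{\nu_\rho}(f)\|_{L^p(\nu_\rho)}\leq C(p)\,\|\delta f\|_1\sqrt{p_{2t}(0,0)},\qquad C(p)=2^{-1/2}\Big(p\,\Gamma\big(\tfrac p2\big)\Big)^{1/p}.$$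
   Context: $\Omega=\{0,1\}^{\mathbb{Z}^d}$ with product topology and Borel $\sigma$-field. For $\eta\in\Omega$, $\eta^i$ is $\eta$ flipped at site $i$, and $\eta^{xy}$ is obtained from $\eta$ by exchanging the values at $x$ and $y$. For $f:\Omega\to\mathbb{R}$, $\delta_if=\sup_\eta(f(\eta^i)-f(\eta))$ and $\|\delta f\|_p=(\sum_{i\in\mathbb{Z}^d}(\delta_if)^p)^{1/p}$ (possibly $+\infty$, in which case a bound containing it on the right is vacuous; $\exp(-a^2/0)$ is read as $0$ for $a>0$ and $1$ for $a=0$). GEMB($c$): a probability measure $\mu$ on $\Omega$ satisfies GEMB($c$), $c>0$, if $\mathbb{E}_\mu(e^{f-\mathbb{E}_\mu f})\leq e^{c\|\delta f\|_2^2}$ for all bounded measurable $f:\Omega\to\mathbb{R}$. Symmetric exclusion process: the Markov process on $\Omega$ with generator, on local functions (functions depending on finitely many sites), $Lf(\eta)=\sum_{x,y}p(x,y)(f(\eta^{xy})-f(\eta))$, where $p(x,y)=p(0,y-x)$ is an irreducible, symmetric, translation-invariant random walk transition probability on $\mathbb{Z}^d$ with finite second moment. $S_tf(\eta)=\mathbb{E}_\eta f(\eta_t)$. $p_t(x,y)$ denotes the transition probability at time $t$ of the continuous-time random walk jumping at rate one according to $p(\cdot,\cdot)$. $\Gamma$ is Euler's Gamma function. (The letter $p$ without arguments is the integrability exponent.) *)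

(* Defs.v *)
From HB Require Import structures.
From mathcomp Require Import all_boot all_order all_algebra finmap.
From mathcomp Require Import all_classical all_reals all_analysis.

Set Implicit Arguments.
Unset Strict Implicit.
Unset Printing Implicit Defensive.

Import Order.TTheory GRing.Theory Num.Theory.
Import numFieldNormedType.Exports.

Local Open Scope classical_set_scope.
Local Open Scope ring_scope.

Notation site d := 'rV[int]_d.

(* Product of discrete topologies, with its Borel sigma-algebra; [true]
   stands for an occupied site. *)
Definition config (d : nat) : Type := prod_topology (fun _ : site d => bool).

HB.instance Definition _ d := Pointed.on (config d).
HB.instance Definition _ d := Topological.on (config d).
HB.instance Definition _ d :=
  Measurable.copy (config d) (g_sigma_algebraType (@open (config d))).

Definition flip (d : nat) (i : site d) (eta : config d) : config d :=
  fun z => if z == i then ~~ eta i else eta z.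

Definition exchange (d : nat) (x y : site d) (eta : config d) : config d :=
  fun z => if z == x then eta y else if z == y then eta x else eta z.

(* The sum of an absolutely summable real family; [esum] is only meant for
   nonnegative families. *)
Definition rsum (R : realType) (I : choiceType) (a : I -> R) : R :=
  fine (\esum_(i in [set: I]) (Num.max (a i) 0)%:E) -
  fine (\esum_(i in [set: I]) (Num.max (- a i) 0)%:E).

Definition oscillation (R : realType) (d : nat) (f : config d -> R)
    (i : site d) : R :=
  sup [set f (flip i eta) - f eta | eta in [set: config d]].

Definition oscillation_norm (R : realType) (d : nat) (q : R)
    (f : config d -> R) : \bar R :=
  ((\esum_(i in [set: site d]) (oscillation f i `^ q)%:E) `^ q^-1)%E.

Definition GEMB (R : realType) (d : nat) (c : R)
    (mu : probability (config d) R) : Prop :=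
  0 < c /\
  forall f : config d -> R,
    measurable_fun [set: config d] f -> bounded_fun f ->
    ('E_mu[fun eta => expR (f eta - fine 'E_mu[f])] <=
     expeR (c%:E * oscillation_norm 2 f ^+ 2))%E.

Fixpoint nstep (R : realType) (d : nat) (p : site d -> site d -> R) (n : nat)
    (x y : site d) : R :=
  if n is m.+1 then
    fine (\esum_(z in [set: site d]) (p x z * nstep p m z y)%:E)
  else (x == y)%:R.

(* The rate-one continuous-time walk is the discrete walk observed after a
   Poisson(t) number of steps. *)
Definition heat_kernel (R : realType) (d : nat) (p : site d -> site d -> R)
    (t : R) (x y : site d) : R :=
  fine (\esum_(n in [set: nat])
          (expR (- t) * t ^+ n / n`!%:R * nstep p n x y)%:E).

Record exclusion_kernel (R : realType) (d : nat)
    (p : site d -> site d -> R) : Prop := ExclusionKernel {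
  exclusion_kernel_ge0 : forall x y, 0 <= p x y;
  exclusion_kernel_sum1 :
    forall x, (\esum_(y in [set: site d]) (p x y)%:E = 1)%E;
  exclusion_kernel_sym : forall x y, p x y = p y x;
  exclusion_kernel_translation : forall x y, p x y = p 0 (y - x);
  exclusion_kernel_irreducible : forall x y, exists n, 0 < nstep p n x y;
  exclusion_kernel_moment2 :
    (\esum_(x in [set: site d])
       ((\sum_(k < d) (x 0 k)%:~R ^+ 2) * p 0 x)%:E < +oo)%E }.

Definition local_fun (R : realType) (d : nat) (f : config d -> R) : Prop :=
  exists A : {fset site d}, forall eta xi : config d,
    (forall x, x \in A -> eta x = xi x) -> f eta = f xi.

(* The sum runs over ordered pairs (x, y). *)
Definition exclusion_gen (R : realType) (d : nat) (p : site d -> site d -> R)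
    (f : config d -> R) (eta : config d) : R :=
  rsum (fun xy : site d * site d =>
    p xy.1 xy.2 * (f (exchange xy.1 xy.2 eta) - f eta)).

(* A transition function is a family of probability kernels, [P t eta] being
   the law at time t >= 0 of the process started from eta; the values at
   negative times are irrelevant. *)
Definition semigroup (R : realType) (d : nat)
    (P : R -> R.-pker config d ~> config d) (t : R) (f : config d -> R)
    (eta : config d) : R :=
  fine (\int[P t eta]_xi (f xi)%:E).

Record feller (R : realType) (d : nat)
    (P : R -> R.-pker config d ~> config d) : Prop := Feller {
  feller0 : forall eta (A : set (config d)), measurable A ->
    P 0 eta A = \d_eta A;
  fellerD : forall s t : R, 0 <= s -> 0 <= t ->
    forall eta (A : set (config d)), measurable A ->
    (P (s + t)%R eta A = \int[P s eta]_xi P t xi A)%E;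
  feller_continuous : forall t : R, 0 <= t -> forall f : config d -> R,
    continuous f -> continuous (semigroup P t f);
  feller_strong : forall f : config d -> R, continuous f ->
    forall e : R, 0 < e -> \forall t \near (0 : R)^'+,
    forall eta, `|semigroup P t f eta - f eta| <= e }.

(* [f] is in the domain of the infinitesimal generator, which maps it to
   [g]; the limit is in the supremum norm. *)
Definition generates (R : realType) (d : nat)
    (P : R -> R.-pker config d ~> config d) (f g : config d -> R) : Prop :=
  forall e : R, 0 < e -> \forall t \near (0 : R)^'+,
    forall eta, `|(semigroup P t f eta - f eta) / t - g eta| <= e.

(* Local functions form a core of the generator, so these conditions
   determine [P t] for every t >= 0. *)
Definition symmetric_exclusion (R : realType) (d : nat)
    (p : site d -> site d -> R) (P : R -> R.-pker config d ~> config d) :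
    Prop :=
  feller P /\
  forall f : config d -> R, local_fun f -> generates P f (exclusion_gen p f).

(* Cylinder probabilities determine a probability measure on [config d]. *)
Definition bernoulli_product (R : realType) (d : nat) (rho : R)
    (nu : probability (config d) R) : Prop :=
  forall (A : {fset site d}) (zeta : config d),
    nu [set eta | forall x, x \in A -> eta x = zeta x] =
    (\prod_(x <- A) (if zeta x then rho else 1 - rho))%:E.

Definition Gamma (R : realType) (s : R) : R :=
  fine (\int[@lebesgue_measure R]_(x in `]0, +oo[)
          (x `^ (s - 1) * expR (- x))%:E).

(* Main.v *)
(* Write [h t x y] for the heat kernel.  Everything rests on the decay of
   oscillations [osc_i (S_t f) <= sum_j h (2 t) i j * osc_j f].  Since
   [h (2 t) i j <= h (2 t) 0 0] and the kernel is symmetric and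
   sub-stochastic, Young's inequality turns it into
   [||delta (S_t f)||_2^2 <= h (2 t) 0 0 * ||delta f||_1^2]; applying GEMB to
   multiples of [S_t f], Chernoff's bound gives the Gaussian tail, and
   integrating the tail gives the moments.

   For local [f] the decay is proved for an explicit Euler scheme: freeze the
   dynamics outside a large finite box, let particles that try to leave the box
   disappear, and iterate small time steps.  Each step acts on the vector of
   oscillations through the kernel [p] restricted to the box, whence the heat
   kernel at time [2 t] after summing binomial weights.  The scheme converges
   to [S_t f] because the semigroup is a contraction differentiable at 0,
   uniformly on bounded functions of finitely many given sites.  It extends to
   bounded measurable [f] by approximating [f] in L1 of the laws of the process
   by local functions whose oscillations on a given finite set do not exceed
   those of [f].

   For Bernoulli measures, averaging over one site at a time and Hoeffding's
   lemma give GEMB(1/8), and invariance under exchanges passes through the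
   Euler scheme to give invariance under [S_t]. *)
Require Import Defs.
From HB Require Import structures.
From mathcomp Require Import all_boot all_order all_algebra finmap.
From mathcomp Require Import all_classical all_reals all_analysis.
From mathcomp Require Import measurable_realfun ring lra.

Set Implicit Arguments.
Unset Strict Implicit.
Unset Printing Implicit Defensive.

Import Order.TTheory GRing.Theory Num.Theory.
Import numFieldNormedType.Exports.

Local Open Scope classical_set_scope.
Local Open Scope ring_scope.

(** * Bounded measurable functions *)

Section bounded_measurable_functions.
Context {disp : measure_display} {T : measurableType disp} {R : realType}.
Implicit Types (f g : T -> R) (m : probability T R).

(** The process is known only through the Feller property and its generator on local functions, and
    S_t g need not be local even for local [g]. The scheme therefore applies the generator only to
    its own iterates, which live on one box, and passes old errors through S_h. The obstacle is the
    order of choices: the time step must be small against the inverse of the total jump rate of the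
    box, while the leakage through its boundary must be small for every iterate. It is resolved by a
    bound on the oscillations of the iterates that involves neither the box nor the step: the box is
    chosen from this bound, then the step. The time is 2t because the generator sums over ordered
    pairs, so that a discrepancy at [i] jumps to [y] at rate [p i y + p y i]. A bounded measurable
    function is in general no uniform limit of local ones, but at given [i] and [eta] only the laws
    started from [eta] and [flip i eta] matter, and L1 closeness for these is enough. The same
    scheme shows invariance of Bernoulli measures: exchange terms integrate to zero, and the killing
    terms are already small. *)

Definition bmeas f :=
  measurable_fun [set: T] f /\ exists C, forall x, `|f x| <= C.

Lemma bmeas_cst (r : R) : bmeas (fun=> r).
Proof. by split; [exact: measurable_cst | exists `|r|]. Qed.

Lemma bmeas_bounded_fun f : measurable_fun setT f -> bounded_fun f -> bmeas f.
Proof.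
move=> mf [C [_ fC]]; split=> //; exists (C + 1) => x.
by apply: fC => //; rewrite ltrDl.
Qed.

Lemma bmeasD f g : bmeas f -> bmeas g -> bmeas (fun x => f x + g x).
Proof.
move=> [mf [C fC]] [mg [D gD]]; split; first exact: measurable_funD.
by exists (C + D) => x; rewrite (le_trans (ler_normD _ _))// lerD.
Qed.

Lemma bmeasM f g : bmeas f -> bmeas g -> bmeas (fun x => f x * g x).
Proof.
move=> [mf [C fC]] [mg [D gD]]; split; first exact: measurable_funM.
by exists (C * D) => x; rewrite normrM ler_pM.
Qed.

Lemma bmeasZ (r : R) f : bmeas f -> bmeas (fun x => r * f x).
Proof. exact/bmeasM/bmeas_cst. Qed.

Lemma bmeasN f : bmeas f -> bmeas (fun x => - f x).
Proof.
move=> [mf [C fC]]; split; first exact: measurable_funN.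
by exists C => x; rewrite normrN.
Qed.

Lemma bmeasB f g : bmeas f -> bmeas g -> bmeas (fun x => f x - g x).
Proof. by move=> bf /bmeasN; exact: bmeasD. Qed.

Lemma bmeas_norm f : bmeas f -> bmeas (fun x => `|f x|).
Proof.
move=> [mf [C fC]]; split; last by exists C => x; rewrite normr_id.
exact: measurableT_comp (@normr_measurable R setT) mf.
Qed.

Lemma bmeas_expR f : bmeas f -> bmeas (fun x => expR (f x)).
Proof.
move=> [mf [C fC]]; split; first exact: measurableT_comp (@measurable_expR R) mf.
exists (expR C) => x; rewrite ger0_norm ?expR_ge0// ler_expR.
exact: le_trans (ler_norm _) (fC x).
Qed.

Lemma bmeas_sum (I : Type) (s : seq I) (P : pred I) (F : I -> T -> R) :
  (forall i, bmeas (F i)) -> bmeas (fun x => \sum_(i <- s | P i) F i x).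
Proof.
move=> bF; elim: s => [|i s IH].
  by under eq_fun do rewrite big_nil; exact: bmeas_cst.
under eq_fun do rewrite big_cons.
by case: (P i) => //; exact: bmeasD.
Qed.

Lemma bmeas_integrable m f : bmeas f -> m.-integrable setT (EFin \o f).
Proof.
move=> [mf [C fC]]; apply: measurable_bounded_integrable => //.
  by rewrite (le_lt_trans (probability_le1 _ _)) ?ltry.
exists C; split; first exact: num_real.
by move=> D CD x _; exact: le_trans (fC x) (ltW CD).
Qed.

Lemma bmeas_intD m f g : bmeas f -> bmeas g ->
  \int[m]_x (f x + g x) = \int[m]_x f x + \int[m]_x g x.
Proof. by move=> bf bg; rewrite RintegralD//; exact: bmeas_integrable. Qed.

Lemma bmeas_intB m f g : bmeas f -> bmeas g ->
  \int[m]_x (f x - g x) = \int[m]_x f x - \int[m]_x g x.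
Proof. by move=> bf bg; rewrite RintegralB//; exact: bmeas_integrable. Qed.

Lemma bmeas_intZ m (r : R) f : bmeas f ->
  \int[m]_x (r * f x) = r * \int[m]_x f x.
Proof. by move=> bf; rewrite RintegralZl//; exact: bmeas_integrable. Qed.

Lemma int_cst m (r : R) : \int[m]_x r = r.
Proof.
rewrite Rintegral_cst// -[RHS]mulr1 -[X in _ = _ * X]/(fine 1%E).
congr (_ * fine _); exact: probability_setT.
Qed.

Lemma bmeas_le_int m f g : bmeas f -> bmeas g -> (forall x, f x <= g x) ->
  \int[m]_x f x <= \int[m]_x g x.
Proof. by move=> bf bg fg; apply: le_Rintegral => //; exact: bmeas_integrable. Qed.

Lemma bmeas_int_le m f (r : R) : bmeas f -> (forall x, f x <= r) ->
  \int[m]_x f x <= r.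
Proof.
move=> bf fr; rewrite -[leRHS](int_cst m).
exact: bmeas_le_int bf (bmeas_cst _) fr.
Qed.

Lemma bmeas_norm_int_le m f (r : R) : bmeas f -> (forall x, `|f x| <= r) ->
  `|\int[m]_x f x| <= r.
Proof.
move=> bf fr; rewrite (le_trans (le_normr_Rintegral _ _))//.
  exact: bmeas_integrable.
exact: bmeas_int_le (bmeas_norm bf) fr.
Qed.

Lemma bmeas_int_dist m f g : bmeas f -> bmeas g ->
  `|\int[m]_x f x - \int[m]_x g x| <= \int[m]_x `|f x - g x|.
Proof.
move=> bf bg; rewrite -bmeas_intB//; apply: le_normr_Rintegral => //.
exact/bmeas_integrable/bmeasB.
Qed.

Lemma bmeas_int_sum m (I : Type) (s : seq I) (F : I -> T -> R) :
  (forall i, bmeas (F i)) ->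
  \int[m]_x (\sum_(i <- s) F i x) = \sum_(i <- s) \int[m]_x F i x.
Proof.
move=> bF; elim: s => [|i s IH].
  rewrite big_nil -[RHS](int_cst m).
  by apply: eq_Rintegral => x _; rewrite big_nil.
rewrite big_cons -IH -bmeas_intD//; last exact: bmeas_sum.
by apply: eq_Rintegral => x _; rewrite big_cons.
Qed.

Lemma EFin_bmeas_int m f : bmeas f -> (\int[m]_x f x)%:E = (\int[m]_x (f x)%:E)%E.
Proof.
by move=> bf; rewrite fineK//; apply: integrable_fin_num => //; exact: bmeas_integrable.
Qed.

Lemma expectationE m f : fine ('E_m[f])%E = \int[m]_x f x.
Proof. by rewrite unlock. Qed.

End bounded_measurable_functions.

Lemma bmeas_comp {d1 d2 : measure_display} {T1 : measurableType d1}
    {T2 : measurableType d2} {R : realType} (phi : T1 -> T2) (f : T2 -> R) :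
  measurable_fun [set: T1] phi -> bmeas f -> bmeas (f \o phi).
Proof.
move=> mphi [mf [C fC]]; split; first exact: measurableT_comp.
by exists C => x; exact: fC.
Qed.

Lemma int_distribution {d1 d2 : measure_display} {T1 : measurableType d1}
    {T2 : measurableType d2} {R : realType} (m : probability T1 R)
    (phi : {mfun T1 >-> T2}) (f : T2 -> R) : bmeas f ->
  \int[distribution m phi]_x f x = \int[m]_x f (phi x).
Proof.
move=> bf; congr fine; rewrite integral_distribution//.
  by apply/measurable_EFinP; case: bf.
by apply: (@bmeas_integrable _ _ _ m (f \o phi)); exact: bmeas_comp.
Qed.

(** * Configurations and local functions *)

Section configurations.
Context {d : nat}.
Implicit Types (A B : {fset site d}) (eta xi : config d).

Definition agree A eta xi := forall x, x \in A -> eta x = xi x.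

Definition depends_on (U : Type) A (f : config d -> U) :=
  forall eta xi, agree A eta xi -> f eta = f xi.

Lemma agree_sym A eta xi : agree A eta xi -> agree A xi eta.
Proof. by move=> h x xA; rewrite h. Qed.

Lemma agree_trans A eta xi zeta :
  agree A eta xi -> agree A xi zeta -> agree A eta zeta.
Proof. by move=> h k x xA; rewrite h// k. Qed.

Lemma depends_onW (U : Type) A B (f : config d -> U) :
  {subset A <= B} -> depends_on A f -> depends_on B f.
Proof. by move=> AB fA eta xi h; apply: fA => x /AB; exact: h. Qed.

(** Sites outside [A] are left empty, an arbitrary choice: [extend a] serves only through its values
    on [A]. *)
Definition extend A (a : {ffun A -> bool}) : config d :=
  fun z => if insub z is Some u then a u else false.

Definition restr A eta : {ffun A -> bool} := [ffun u => eta (val u)].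

Lemma extend_restr A eta : agree A (extend (restr A eta)) eta.
Proof. by move=> x xA; rewrite /extend insubT ffunE. Qed.

Lemma restr_agree A eta xi : restr A eta = restr A xi <-> agree A eta xi.
Proof.
split=> [h x xA|h].
  by have /ffunP/(_ [` xA]%fset) := h; rewrite !ffunE.
by apply/ffunP => u; rewrite !ffunE h//; exact: valP.
Qed.

Lemma depends_onE (U : Type) A (f : config d -> U) eta : depends_on A f ->
  f (extend (restr A eta)) = f eta.
Proof. by apply; exact: extend_restr. Qed.

(** Coordinates in the finite basis of cylinder indicators: linear statements on functions of [A]
    reduce to these finitely many functions. *)
Lemma local_expansion (R : realType) A (f : config d -> R) eta :
  depends_on A f ->
  f eta = \sum_(a : {ffun A -> bool}) f (extend a) * (restr A eta == a)%:R.
Proof.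
move=> fA; rewrite (bigD1 (restr A eta))//= eqxx mulr1 depends_onE// big1 ?addr0//.
by move=> a; rewrite eq_sym => /negbTE ->; rewrite mulr0.
Qed.

Lemma cylinder_nbhs A eta : nbhs eta [set xi | agree A xi eta].
Proof.
have -> : [set xi | agree A xi eta] =
    \bigcap_(x in [set` A]) [set xi : config d | xi x = eta x].
  by apply/seteqP; split=> xi /= h x xA; exact: h.
apply: filter_bigI => x xA.
have := @proj_continuous (site d) (fun=> bool) x eta [set eta x].
by apply; exact: discrete_set1.
Qed.

(** A basic neighbourhood is a finite intersection of sets constraining one site each; induction on
    this finite family collects the sites. *)
Lemma nbhs_cylinder eta (U : set (config d)) : nbhs eta U ->
  exists A, [set xi | agree A xi eta] `<=` U.
Proof.
case=> P [[Q Qfin <-] [V JV Veta]] /(subset_trans _) QU.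
suff [A AV] : exists A, [set xi | agree A xi eta] `<=` V.
  by exists A; apply: QU => xi /AV Vxi; exists V.
have [L Lsub VL] := Qfin _ JV; move: Veta; rewrite -VL => {QU JV VL}.
have {Lsub} : forall S, S \in L -> exists x (D : set bool),
    S = [set xi | D (xi x)].
  by move=> S /Lsub /set_mem [x _ [D _ <-]]; exists x, D.
move: L; elim/finSet_rect => L IH Lx Leta.
have [->|[S SL]] := fset_0Vmem L; first by exists fset0 => xi _ S.
have [A AL] : exists A, [set xi | agree A xi eta] `<=`
    \bigcap_(i in [set` (L `\ S)%fset]) i.
  apply: IH; first exact: fproperD1.
  - by move=> S'; rewrite !inE => /andP[_ /Lx].
  - by move=> S' /=; rewrite !inE => /andP[_ /Leta].
have [x [D SE]] := Lx S SL.
exists (x |` A)%fset => xi h S' /= S'L.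
have [->|S'S] := eqVneq S' S.
  have : S eta by exact: Leta.
  by rewrite SE/= h// !inE eqxx.
apply: (AL xi); last by rewrite /= !inE S'S.
by move=> y yA; apply: h; rewrite !inE yA orbT.
Qed.

Lemma config_openP (U : set (config d)) :
  open U <-> forall eta, U eta -> exists A, [set xi | agree A xi eta] `<=` U.
Proof.
rewrite openE; split=> [oU eta /oU /nbhs_cylinder//|h eta /h[A AU]].
exact: filterS AU (cylinder_nbhs A eta).
Qed.

Lemma open_config_measurable (U : set (config d)) : open U -> measurable U.
Proof. by move=> oU; exact: sub_sigma_algebra. Qed.

Lemma local_set_open A (U : set (config d)) : depends_on A U -> open U.
Proof.
move=> UA; apply/config_openP => eta Ueta; exists A => xi h.
by rewrite (UA _ _ h).
Qed.

Lemma local_set_measurable A (U : set (config d)) :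
  depends_on A U -> measurable U.
Proof. by move=> /local_set_open; exact: open_config_measurable. Qed.

Lemma local_measurable (disp : measure_display) (T : measurableType disp) A
  (f : config d -> T) : depends_on A f -> measurable_fun [set: config d] f.
Proof.
move=> fA _ Y mY; rewrite setTI; apply: (@local_set_measurable A).
by move=> eta xi h; rewrite /preimage/= (fA _ _ h).
Qed.

Lemma local_bmeas (R : realType) A (f : config d -> R) :
  depends_on A f -> bmeas f.
Proof.
move=> fA; split; first exact: local_measurable fA.
exists (\sum_(a : {ffun A -> bool}) `|f (extend a)|) => eta.
rewrite -(depends_onE _ fA) (bigD1 (restr A eta))//= lerDl.
by rewrite sumr_ge0.
Qed.

(** Such maps are continuous: a constraint on the sites of [A] pulls back to one on the image of [A]
    under [s]. Flips, exchanges and resettings of a site are instances. *)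
Lemma sitewise_measurable (s : site d -> site d) (u : site d -> bool -> bool) :
  measurable_fun [set: config d] (fun eta : config d => (fun z => u z (eta (s z))) : config d).
Proof.
apply: (@measurability _ _ _ _ _ _ (@open (config d))) => // _ [U oU <-].
rewrite setTI; apply: open_config_measurable.
apply/config_openP => eta /= Ueta.
have /config_openP/(_ _ Ueta)[A AU] := oU.
exists (s @` A)%fset => xi h; apply: AU => x xA.
by rewrite h//; apply: in_imfset.
Qed.

Lemma flip_measurable (i : site d) : measurable_fun [set: config d] (@flip d i).
Proof.
rewrite (_ : flip i = fun eta : config d => (fun z => (z == i) (+) eta z) : config d).
  exact: (sitewise_measurable id (fun z b => (z == i) (+) b)).
apply/funext => eta; apply/funext => z; rewrite /flip.
by case: eqP => [->|] //.
Qed.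

Lemma exchange_measurable (x y : site d) :
  measurable_fun [set: config d] (@exchange d x y).
Proof.
rewrite (_ : exchange x y = fun eta : config d => (fun z =>
  eta (if z == x then y else if z == y then x else z)) : config d).
  exact: (sitewise_measurable _ (fun z b => b)).
by apply/funext => eta; apply/funext => z; rewrite /exchange; case: (z == x) => //; case: (z == y).
Qed.

Definition set_at (x : site d) (b : bool) eta : config d :=
  fun z => if z == x then b else eta z.

Lemma set_at_measurable (x : site d) (b : bool) :
  measurable_fun [set: config d] (set_at x b).
Proof.
exact: (sitewise_measurable id (fun z c => if z == x then b else c)).
Qed.

End configurations.

Arguments extend {d A}.

HB.instance Definition _ d (i : site d) :=
  isMeasurableFun.Build _ _ _ _ (@flip d i) (flip_measurable i).
HB.instance Definition _ d (x y : site d) :=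
  isMeasurableFun.Build _ _ _ _ (@exchange d x y) (exchange_measurable x y).
HB.instance Definition _ d (x : site d) (b : bool) :=
  isMeasurableFun.Build _ _ _ _ (@set_at d x b) (set_at_measurable x b).

(** * Density of local functions in L1 of finitely many laws *)

Section density_of_local_functions.
Context {R : realType} {d : nat} {I : finType}.
Variable m : I -> probability (config d) R.
Implicit Types (f g h : config d -> R) (U V : set (config d)).

(** A single local [h] has to serve all measures of the finite family [m]: later arguments compare
    several laws through one approximant. *)
Definition L1_local f := forall e : R, 0 < e ->
  exists (A : {fset site d}) h, depends_on A h /\
    forall i, \int[m i]_x `|f x - h x| <= e.

Lemma L1_local_depends (A : {fset site d}) h : depends_on A h -> L1_local h.
Proof.
move=> hA e e0; exists A, h; split=> // i.
under eq_Rintegral => x _ do rewrite subrr normr0.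
by rewrite int_cst ltW.
Qed.

Lemma L1_local_lim f : bmeas f ->
  (forall e : R, 0 < e -> exists g, [/\ bmeas g, L1_local g &
     forall i, \int[m i]_x `|f x - g x| <= e]) -> L1_local f.
Proof.
move=> bf fg e e0.
have e20 : 0 < e / 2 by rewrite divr_gt0.
have [g [bg /(_ _ e20)[A [h [hA gh]]] fge]] := fg _ e20.
exists A, h; split=> // i; have bh := local_bmeas hA.
rewrite [leRHS]splitr; apply: le_trans (lerD (fge i) (gh i)).
rewrite -bmeas_intD; [|exact/bmeas_norm/bmeasB|exact/bmeas_norm/bmeasB].
apply: bmeas_le_int => [||x]; [exact/bmeas_norm/bmeasB| |exact: ler_distD].
by apply: bmeasD; exact/bmeas_norm/bmeasB.
Qed.

Lemma L1_local2 (op : R -> R -> R) f g : bmeas f -> bmeas g ->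
  (forall f' g', bmeas f' -> bmeas g' -> bmeas (fun x => op (f' x) (g' x))) ->
  (forall a b a' b', `|op a b - op a' b'| <= `|a - a'| + `|b - b'|) ->
  L1_local f -> L1_local g -> L1_local (fun x => op (f x) (g x)).
Proof.
move=> bf bg bop opD Lf Lg e e0.
have e20 : 0 < e / 2 by rewrite divr_gt0.
have [A [h [hA fh]]] := Lf _ e20; have [B [k [kB gk]]] := Lg _ e20.
exists (A `|` B)%fset, (fun x => op (h x) (k x)); split=> [eta xi ab|i].
  by rewrite (hA eta xi) ?(kB eta xi)// => x xA; apply: ab; rewrite inE xA ?orbT.
have bh := local_bmeas hA; have bk := local_bmeas kB.
rewrite [leRHS]splitr; apply: le_trans (lerD (fh i) (gk i)).
rewrite -bmeas_intD; [|exact/bmeas_norm/bmeasB|exact/bmeas_norm/bmeasB].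
apply: bmeas_le_int => [||x]; last exact: opD.
  by apply/bmeas_norm/bmeasB; exact: bop.
by apply: bmeasD; exact/bmeas_norm/bmeasB.
Qed.

Lemma L1_localD f g : bmeas f -> bmeas g -> L1_local f -> L1_local g ->
  L1_local (fun x => f x + g x).
Proof.
move=> bf bg; apply: (L1_local2 bf bg) => [f' g'|a b a' b'].
  exact: bmeasD.
by rewrite (_ : a + b - _ = (a - a') + (b - b')) ?ler_normD//; ring.
Qed.

Lemma L1_local_max f g : bmeas f -> bmeas g -> L1_local f -> L1_local g ->
  L1_local (fun x => Num.max (f x) (g x)).
Proof.
move=> bf bg; apply: (L1_local2 bf bg) => [f' g' bf' bg'|a b a' b'].
  under eq_fun do rewrite maxr_absE.
  under eq_fun do rewrite mulrC.
  by apply: bmeasZ; apply: bmeasD; [exact: bmeasD|exact/bmeas_norm/bmeasB].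
rewrite /Num.max; have [ab|ab] := ltP a b; have [ab'|ab'] := ltP a' b';
  rewrite ler_norml; have := ler_norm (a - a'); have := ler_norm (b - b');
  have := ler_norm (a' - a); have := ler_norm (b' - b);
  rewrite (distrC a') (distrC b'); move: (normr_ge0 (a - a')) (normr_ge0 (b - b'));
  by lra.
Qed.

Lemma L1_localZ (r : R) f : bmeas f -> L1_local f -> L1_local (fun x => r * f x).
Proof.
move=> bf Lf e e0.
have r0 : 0 < `|r| + 1 by rewrite ltr_wpDl.
have [|A [h [hA fh]]] := Lf (e / (`|r| + 1)); first by rewrite divr_gt0.
exists A, (fun x => r * h x); split=> [eta xi ab|i]; first by rewrite (hA eta xi).
have bh := local_bmeas hA.
under eq_Rintegral => x _ do rewrite -mulrBr normrM.
rewrite bmeas_intZ; last exact/bmeas_norm/bmeasB.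
apply: (@le_trans _ _ (`|r| * (e / (`|r| + 1)))); first by rewrite ler_wpM2l.
by rewrite mulrCA ler_piMr ?(ltW e0)// ler_pdivrMr// mul1r lerDl.
Qed.

Lemma bmeas_indic U : measurable U -> bmeas (\1_U : config d -> R).
Proof.
move=> mU; split; first exact: measurable_indic.
by exists 1 => x; rewrite indicE ger0_norm// lern1 leq_b1.
Qed.

Lemma int_indicB (i : I) U V : measurable U -> measurable V -> U `<=` V ->
  \int[m i]_x `|\1_V x - \1_U x| = fine (m i V) - fine (m i U).
Proof.
move=> mU mV UV.
have E W : measurable W -> fine (m i W) = \int[m i]_x \1_W x.
  by move=> mW; rewrite /Rintegral integral_indic// setIT.
rewrite !E// -bmeas_intB; [|exact: bmeas_indic|exact: bmeas_indic].
apply: eq_Rintegral => x _; rewrite ger0_norm// subr_ge0 !indicE ler_nat.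
have [xU|] := boolP (x \in U) => //.
by have -> : x \in V by rewrite inE; apply: UV; rewrite inE in xU.
Qed.

Lemma L1_local_bigcup (V : nat -> set (config d)) :
  {homo V : n k / (n <= k)%N >-> n `<=` k} ->
  (forall n, measurable (V n)) -> (forall n, L1_local (\1_(V n) : config d -> R)) ->
  L1_local (\1_(\bigcup_n V n) : config d -> R).
Proof.
move=> ndV mV LV.
have mUV : measurable (\bigcup_n V n) by exact: bigcup_measurable.
apply: L1_local_lim; first exact: bmeas_indic.
move=> e e0.
have : \forall n \near \oo, forall i, fine (m i (\bigcup_k V k)) - fine (m i (V n)) <= e.
  apply: filter_forall => i.
  have : m i \o V @ \oo --> (fine (m i (\bigcup_n V n)))%:E.
    rewrite fineK ?fin_num_measure//.
    by apply: nondecreasing_cvg_mu => // n k nk; apply/subsetPset; exact: ndV.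
  move=> /fine_cvg/cvgrPdist_le => /(_ _ e0); apply: filterS => n /=.
  exact: le_trans (ler_norm _).
move=> [n _ /(_ _ (leqnn n)) hn].
exists (\1_(V n)); split=> //; first exact: bmeas_indic.
have VU : V n `<=` \bigcup_k V k by move=> x Vx; exists n.
by move=> i; rewrite int_indicB//; exact: hn.
Qed.

(** Sites decoded from the integers below [n]: increasing finite sets that exhaust the countable set
    of sites. *)
Definition exhaustion (n : nat) : {fset site d} :=
  seq_fset tt (pmap (@choice.unpickle (site d)) (iota 0 n)).

Lemma mem_exhaustion n (x : site d) : (choice.pickle x < n)%N -> x \in exhaustion n.
Proof.
move=> xn; rewrite seq_fsetE mem_pmap; apply/mapP; exists (choice.pickle x).
  by rewrite mem_iota.
by rewrite choice.pickleK.
Qed.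

Lemma exhaustion_le n k : (n <= k)%N -> {subset exhaustion n <= exhaustion k}.
Proof.
move=> nk x; rewrite !seq_fsetE !mem_pmap => /mapP[j jn ->]; apply: map_f.
by move: jn; rewrite !mem_iota => /andP[-> /leq_trans]; exact.
Qed.

Lemma finite_sub_exhaustion (A : {fset site d}) :
  exists n, {subset A <= exhaustion n}.
Proof.
exists (\max_(x <- A) choice.pickle x).+1 => x xA.
by apply: mem_exhaustion; rewrite ltnS; apply: leq_bigmax_seq.
Qed.

Lemma L1_local_open U : open U -> L1_local (\1_U : config d -> R).
Proof.
move=> oU.
(* [V n] is the part of [U] decided by the sites of [exhaustion n]. *)
pose V n := [set eta | forall xi, agree (exhaustion n) xi eta -> U xi].
have -> : U = \bigcup_n V n.
  apply/seteqP; split=> [eta Ueta|eta [n _]]; last exact.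
  have /config_openP/(_ _ Ueta)[A AU] := oU.
  have [n An] := finite_sub_exhaustion A.
  by exists n => // xi h; apply: AU => x /An; exact: h.
have VD n : depends_on (exhaustion n) (V n).
  move=> eta xi h; apply/propext; split=> Vx zeta hz; apply: Vx.
    exact: agree_trans hz (agree_sym h).
  exact: agree_trans hz h.
apply: L1_local_bigcup => [n k nk eta Vn xi h|n|n].
- by apply: Vn => x /(exhaustion_le nk); exact: h.
- exact: local_set_measurable (VD n).
- apply: (@L1_local_depends (exhaustion n)) => eta xi h.
  by rewrite !indicE; congr (nat_of_bool _)%:R; apply/idP/idP; rewrite !in_setE (VD n _ _ h).
Qed.

(** The sets with approximable indicator form a sigma-algebra containing the open sets; a countable
    union is first made increasing, and the indicators of its finite stages are maxima. *)
Lemma L1_local_indic U : measurable U -> L1_local (\1_U : config d -> R).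
Proof.
suff : measurable `<=` [set U | measurable U /\ L1_local (\1_U : config d -> R)].
  by move=> h /h[].
apply: smallest_sub; last first.
  by move=> V oV; split; [exact: open_config_measurable|exact: L1_local_open].
split=> [|V [mV LV]|V mLV].
- split; first exact: measurable0.
  by apply: (@L1_local_depends fset0) => eta xi _; rewrite !indicE !in_set0.
- split; first exact: measurableD.
  rewrite setTD (_ : \1_(~` V) = fun x => 1 + -1 * \1_V x); last first.
    apply/funext => x; rewrite !indicE in_setC mulN1r.
    by case: (x \in V); rewrite /= ?subrr ?subr0.
  have bV : bmeas (\1_V : config d -> R) by exact: bmeas_indic.
  apply: L1_localD; [exact: bmeas_cst|exact: bmeasZ| |exact: L1_localZ].
  by apply: (@L1_local_depends fset0) => eta xi _.
- split; first by apply: bigcup_measurable => k _; case: (mLV k).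
  rewrite -bigcup_bigsetU_bigcup.
  have mW n : measurable (\big[setU/set0]_(k < n) V k).
    by apply: bigsetU_measurable => k _; case: (mLV k).
  apply: L1_local_bigcup => [n k nk|//|n]; first exact: subset_bigsetU.
  elim: n.+1 => {n} [|n IH].
    rewrite big_ord0; apply: (@L1_local_depends fset0) => eta xi _.
    by rewrite !indicE !in_set0.
  rewrite big_ord_recr/=.
  rewrite (_ : \1_(_ `|` _) = fun x => Num.max (\1_(\big[setU/set0]_(k < n) V k) x) (\1_(V n) x)).
    have [mV LV] := mLV n.
    by apply: L1_local_max => //; exact: bmeas_indic.
  apply/funext => x; rewrite !indicE in_setU.
  case: (x \in V n); case: (x \in _) => /=; rewrite ?maxxx//.
    by rewrite max_r.
  by rewrite max_l.
Qed.

(** The sum is [y] rounded down to a multiple of [s], written with indicators of superlevel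
    events. *)
Lemma staircase_bounds (s y : R) n : 0 < s -> 0 <= y < n.+1%:R * s ->
  y - s <= \sum_(k < n) s * (k.+1%:R * s <= y)%R%:R <= y.
Proof.
move=> s0; elim: n => [|n IH] /andP[y0 yn].
  by rewrite big_ord0 y0 andbT; lra.
rewrite big_ord_recr/=; have [yn1|yn1] := ltP y (n.+1%:R * s).
  by rewrite mulr0 addr0; apply: IH; rewrite y0.
rewrite (eq_bigr (fun=> s)) => [|k _].
  rewrite sumr_const card_ord mulr1 -mulrSr -mulr_natl.
  by rewrite yn1 andbT; move: yn; rewrite -[n.+2]addn1 natrD mulrDl mul1r; lra.
rewrite (_ : (_ <= y)%R) ?mulr1//; apply: le_trans yn1.
by rewrite ler_pM2r// ler_nat ltnS ltnW.
Qed.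

Lemma L1_local_bmeas f : bmeas f -> L1_local f.
Proof.
move=> bf; apply: L1_local_lim => // e e0.
have [mf [C fC]] := bf.
(* Enough levels of height [e] to cover the range of [f + C], contained in [[0, 2 * C]]. *)
pose n := Num.bound (2 * C / e).
pose V k := [set x | k.+1%:R * e <= f x + C].
have mV k : measurable (V k).
  rewrite -[V k]setTI; apply: measurable_fun_le => //.
  exact: measurable_funD.
exists (fun x => (\sum_(k < n) e * \1_(V k) x) + - C); split.
- by apply: bmeasD (bmeas_cst _); apply: bmeas_sum => k; exact/bmeasZ/bmeas_indic.
- apply: L1_localD.
  + by apply: bmeas_sum => k; exact/bmeasZ/bmeas_indic.
  + exact: bmeas_cst.
  + elim: n => [|n IH].
      by apply: (@L1_local_depends fset0) => eta xi _; rewrite !big_ord0.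
    under eq_fun do rewrite big_ord_recr/=.
    apply: L1_localD => //.
    * by apply: bmeas_sum => k; exact/bmeasZ/bmeas_indic.
    * exact/bmeasZ/bmeas_indic.
    * by apply: L1_localZ; [exact: bmeas_indic|exact: L1_local_indic].
  + by apply: (@L1_local_depends fset0) => eta xi _.
- move=> i; apply: bmeas_int_le => [|x].
    apply/bmeas_norm/bmeasB => //; apply: bmeasD (bmeas_cst _).
    by apply: bmeas_sum => k; exact/bmeasZ/bmeas_indic.
  have := fC x; rewrite ler_norml => /andP[Cf fCx].
  have /(staircase_bounds e0) : 0 <= f x + C < n.+1%:R * e.
    rewrite -lerBlDr sub0r Cf/=.
    have : 2 * C / e < n%:R.
      by apply: archi_boundP; rewrite divr_ge0 ?(ltW e0)//; lra.
    by rewrite ltr_pdivrMr// -natr1 mulrDl mul1r; lra.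
  rewrite (eq_bigr (fun k : 'I_n => e * \1_(V k) x)) => [/andP[h1 h2]|k _].
    by rewrite ger0_norm; lra.
  by rewrite indicE /V; congr (_ * (nat_of_bool _)%:R); apply/idP/idP; rewrite inE.
Qed.

End density_of_local_functions.

(** * Oscillations and the semigroup *)

Section oscillations.
Context {R : realType} {d : nat}.
Implicit Types (f g h : config d -> R) (i j x y : site d) (eta xi : config d).

Lemma flipK i : involutive (@flip d i).
Proof.
move=> eta; apply/funext => z; rewrite /flip; case: eqP => [->|//].
by rewrite eqxx negbK.
Qed.

Lemma flipC i j eta : flip i (flip j eta) = flip j (flip i eta).
Proof.
apply/funext => z; rewrite /flip.
have [->|ij] := eqVneq i j; first by [].
case: (eqVneq z i) => [->|//]; by rewrite (negbTE ij).
Qed.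

Lemma agree_flip (A : {fset site d}) i eta xi :
  agree A eta xi -> agree A (flip i eta) (flip i xi).
Proof. by move=> h x xA; rewrite /flip; case: eqP => [<-|_]; rewrite h. Qed.

Definition bounded f := exists C, forall eta, `|f eta| <= C.

Lemma bmeas_bounded f : bmeas f -> bounded f.
Proof. by case. Qed.

Lemma osc_ub f i eta : bounded f -> f (flip i eta) - f eta <= oscillation f i.
Proof.
move=> [C fC]; apply: sup_ubound; last by exists eta.
exists (C + C) => _ [xi _ <-].
by rewrite (le_trans (ler_norm _))// (le_trans (ler_normB _ _))// lerD.
Qed.

Lemma osc_le f i (r : R) : (forall eta, f (flip i eta) - f eta <= r) ->
  oscillation f i <= r.
Proof.
move=> fr; apply: ge_sup => [|_ [eta _ <-]]; last exact: fr.
by exists (f (flip i point) - f point), point.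
Qed.

Lemma osc_ge0 f i : bounded f -> 0 <= oscillation f i.
Proof.
move=> bf; have := osc_ub i point bf; have := osc_ub i (flip i point) bf.
by rewrite flipK; lra.
Qed.

(** Passing from [eta] to its flip changes the sign of the difference, so the one-sided supremum
    also controls absolute values. *)
Lemma osc_norm_ub f i eta : bounded f ->
  `|f (flip i eta) - f eta| <= oscillation f i.
Proof.
move=> bf; rewrite ler_norml; have := osc_ub i eta bf.
by have := osc_ub i (flip i eta) bf; rewrite flipK; lra.
Qed.

Lemma osc_le_bound f i (C : R) : (forall eta, `|f eta| <= C) ->
  oscillation f i <= 2 * C.
Proof.
move=> fC; apply: osc_le => eta; rewrite (le_trans (ler_norm _))//.
by rewrite (le_trans (ler_normB _ _))// mulr_natl mulr2n lerD.
Qed.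

Lemma osc_notin (A : {fset site d}) f i : depends_on A f -> i \notin A ->
  oscillation f i = 0.
Proof.
move=> fA iA; have bf := bmeas_bounded (local_bmeas fA).
apply/eqP; rewrite eq_le osc_ge0// andbT; apply: osc_le => eta.
rewrite (fA (flip i eta) eta) ?subrr// => x xA; rewrite /flip.
by case: eqP xA iA => // -> ->.
Qed.

(** For [0 <= D], if the two values on a pair [eta], [flip j eta] differ by more than [D], the
    larger is lowered to the smaller plus [D]. *)
Definition osc_truncate j (D : R) h eta := Num.min (h eta) (h (flip j eta) + D).

Lemma osc_truncate_le j (D : R) h : 0 <= D -> oscillation (osc_truncate j D h) j <= D.
Proof.
move=> D0; apply: osc_le => eta; rewrite /osc_truncate flipK.
by rewrite !minElt; do 2! case: ltP => ?; lra.
Qed.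

(** Flips commute, so flipping [i] raises each argument of the minimum by at most
    [oscillation h i]. *)
Lemma osc_truncate_other i j (D : R) h : bounded h ->
  oscillation (osc_truncate j D h) i <= oscillation h i.
Proof.
move=> bh; apply: osc_le => eta; rewrite /osc_truncate flipC.
have := osc_ub i eta bh; have := osc_ub i (flip j eta) bh.
by rewrite !minElt; do 2! case: ltP => ?; lra.
Qed.

(** Truncation at level [oscillation f j] leaves [f] itself unchanged, and the minimum is Lipschitz
    in its two arguments. *)
Lemma osc_truncate_dist j h f eta : bounded f ->
  `|f eta - osc_truncate j (oscillation f j) h eta| <=
  `|f eta - h eta| + `|f (flip j eta) - h (flip j eta)|.
Proof.
move=> bf; rewrite /osc_truncate.
have := osc_ub j (flip j eta) bf; rewrite flipK.
have := ler_norm (f eta - h eta); have := ler_norm (f (flip j eta) - h (flip j eta)).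
have := ler_norm (h eta - f eta); have := ler_norm (h (flip j eta) - f (flip j eta)).
rewrite (distrC (h eta)) (distrC (h (flip j eta))).
move: (normr_ge0 (f eta - h eta)) (normr_ge0 (f (flip j eta) - h (flip j eta))).
by rewrite ler_norml minElt; case: ltP => ?; lra.
Qed.

(* Truncating at [j] is a contraction for the L1 norm of the measure plus its
   image under the flip at [j], so the induction has to range over all finite
   families of measures. *)
Lemma L1_local_osc (s : seq (site d)) f (C : R) : bmeas f ->
  (forall eta, `|f eta| <= C) ->
  forall (I : finType) (m : I -> probability (config d) R) (e : R), 0 < e ->
  exists (A : {fset site d}) g, [/\ depends_on A g,
    forall eta, `|g eta| <= C,
    forall j, j \in s -> oscillation g j <= oscillation f j &
    forall k, \int[m k]_eta `|f eta - g eta| <= e].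
Proof.
move=> bf fC; elim: s => [|j s IH] I m e e0.
  have [A [h [hA fh]]] := L1_local_bmeas m bf e0.
  pose g eta := Num.max (- C) (Num.min C (h eta)).
  have gA : depends_on A g by move=> eta xi /hA; rewrite /g => ->.
  exists A, g; split=> // [eta|k].
    have := fC eta; rewrite ler_norml /g maxElt minElt ler_norml.
    by case: (ltP C (h eta)) => ?; case: ltP => ?; lra.
  apply: le_trans (fh k); apply: bmeas_le_int => [||eta].
  - exact/bmeas_norm/bmeasB/(local_bmeas gA).
  - exact/bmeas_norm/bmeasB/(local_bmeas hA).
  - have := ler_norm (f eta - h eta); have := ler_norm (h eta - f eta).
    rewrite (distrC (h eta)); move: (normr_ge0 (f eta - h eta)) (fC eta).
    rewrite ler_norml (ler_norml (f eta - g eta)) /g maxElt minElt.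
    by case: (ltP C (h eta)) => ?; case: ltP => ?; lra.
pose m' (k : I + I) := match k with
  | inl k => m k
  | inr k => distribution (m k) (@flip d j : {mfun config d >-> config d})
            : probability (config d) R end.
have [|A [h [hA hC hs fh]]] := IH _ m' (e / 2); first by rewrite divr_gt0.
have bh := local_bmeas hA; have bbf := bmeas_bounded bf.
have bbh := bmeas_bounded bh.
pose g := osc_truncate j (oscillation f j) h.
have gA : depends_on A g.
  move=> eta xi ab; rewrite /g /osc_truncate (hA eta xi)//.
  by rewrite (hA (flip j eta) (flip j xi))//; exact: agree_flip.
exists A, g; split=> // [eta|k|a].
- have := hC eta; have := hC (flip j eta); rewrite !ler_norml /g /osc_truncate.
  have := osc_ge0 j bbf.
  by rewrite minElt; case: ltP => ?; lra.
- rewrite inE => /orP[/eqP ->|ks]; first exact/osc_truncate_le/osc_ge0.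
  by rewrite (le_trans _ (hs _ ks))// osc_truncate_other.
- have bfh : bmeas (fun eta => `|f eta - h eta|) by exact/bmeas_norm/bmeasB.
  rewrite [leRHS]splitr; apply: le_trans (lerD (fh (inl a)) (fh (inr a))) => /=.
  rewrite int_distribution// -bmeas_intD//; last first.
    exact: bmeas_comp (flip_measurable j) bfh.
  apply: bmeas_le_int => [||eta].
  + exact/bmeas_norm/bmeasB/(local_bmeas gA).
  + by apply: bmeasD => //; exact: bmeas_comp (flip_measurable j) bfh.
  + exact: osc_truncate_dist.
Qed.

End oscillations.

(** * The semigroup on bounded measurable functions *)

Section markov_semigroup.
Context {R : realType} {d : nat} (P : R -> R.-pker config d ~> config d).
Implicit Types (f g h : config d -> R) (t s : R) (eta xi : config d).

(** A name for [P t eta] that can carry the structure of a probability measure. *)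
Definition law t eta (A : set (config d)) : \bar R := P t eta A.

HB.instance Definition _ t eta := Measure.on (law t eta).
HB.instance Definition _ t eta := Measure_isProbability.Build _ _ _ (law t eta)
  (@prob_kernel _ _ _ _ _ (P t) eta).

Local Notation S := (semigroup P).

Lemma semigroupE t f eta : S t f eta = \int[law t eta]_xi f xi.
Proof. by []. Qed.

Lemma semigroupD t f g eta : bmeas f -> bmeas g ->
  S t (fun x => f x + g x) eta = S t f eta + S t g eta.
Proof. exact: (bmeas_intD (law t eta)). Qed.

Lemma semigroupB t f g eta : bmeas f -> bmeas g ->
  S t (fun x => f x - g x) eta = S t f eta - S t g eta.
Proof. exact: (bmeas_intB (law t eta)). Qed.

Lemma semigroupZ t (r : R) f eta : bmeas f ->
  S t (fun x => r * f x) eta = r * S t f eta.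
Proof. exact: (bmeas_intZ (law t eta)). Qed.

Lemma semigroup_cst t (r : R) eta : S t (fun=> r) eta = r.
Proof. exact: (int_cst (law t eta)). Qed.

Lemma semigroup_norm_le t f eta (C : R) : bmeas f -> (forall xi, `|f xi| <= C) ->
  `|S t f eta| <= C.
Proof. exact: (bmeas_norm_int_le (law t eta)). Qed.

Lemma semigroup_sum t (I : Type) (r : seq I) (F : I -> config d -> R) eta :
  (forall i, bmeas (F i)) ->
  S t (fun x => \sum_(i <- r) F i x) eta = \sum_(i <- r) S t (F i) eta.
Proof. exact: (bmeas_int_sum (law t eta)). Qed.

Lemma semigroup_bmeas t f : bmeas f -> bmeas (S t f).
Proof.
move=> bf; have [mf [C fC]] := bf; split; last first.
  by exists C => eta; exact: semigroup_norm_le.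
have mpos g : measurable_fun setT g -> (forall x, 0 <= g x) ->
    measurable_fun setT (fun eta => (\int[P t eta]_xi (g xi)%:E)%E).
  move=> mg g0; apply: (measurable_fun_integral_kernel (l := P t) _ (k := EFin \o g)).
  - exact: measurable_kernel.
  - by move=> z; rewrite lee_fin.
  - exact/measurable_EFinP.
(* Shifting by [C] reduces to a nonnegative function, the case treated by [mpos]. *)
have bC : bmeas (fun x => f x + C) by exact: bmeasD bf (bmeas_cst _).
rewrite (_ : S t f = fun eta => S t (fun x => f x + C) eta - C).
  apply: measurable_funB => //; apply: measurableT_comp => //.
  apply: mpos; first by case: bC.
  by move=> x; have := fC x; rewrite ler_norml; lra.
by apply/funext => eta; rewrite semigroupD ?semigroup_cst ?addrK//; exact: bmeas_cst.
Qed.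

Section feller.
Hypothesis FP : feller P.

Lemma semigroup0 f eta : bmeas f -> S 0 f eta = f eta.
Proof.
move=> bf; rewrite /semigroup.
have mf : measurable_fun setT (EFin \o f) by apply/measurable_EFinP; case: bf.
rewrite (eq_measure_integral \d_eta) => [|A mA _]; last exact: (feller0 FP).
by rewrite integral_dirac// diracE in_setT mul1e.
Qed.

Lemma ge0_int_lawD s t eta f : 0 <= s -> 0 <= t -> measurable_fun setT f ->
  (forall x, 0 <= f x) ->
  (\int[law (s + t) eta]_xi (f xi)%:E =
   \int[law s eta]_zeta \int[law t zeta]_xi (f xi)%:E)%E.
Proof.
move=> s0 t0 mf f0.
rewrite (eq_measure_integral (kcomp (P s) (kernel.kernel_snd (T0 := config d) (P t)) eta)).
  by rewrite integral_kcomp//; exact/measurable_EFinP.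
by move=> A mA _; rewrite [LHS](fellerD FP).
Qed.

Lemma semigroup_add s t f eta : 0 <= s -> 0 <= t -> bmeas f ->
  S (s + t) f eta = S s (S t f) eta.
Proof.
move=> s0 t0 bf; have [mf [C fC]] := bf.
have bC : bmeas (fun x => f x + C) by exact: bmeasD bf (bmeas_cst _).
have bS : bmeas (S t (fun x => f x + C)) by exact: semigroup_bmeas.
suff : S (s + t) (fun x => f x + C) eta = S s (S t (fun x => f x + C)) eta.
  rewrite semigroupD ?semigroup_cst//; last exact: bmeas_cst.
  rewrite (_ : S t (fun x => f x + C) = fun xi => S t f xi + C); last first.
    apply/funext => xi.
    by rewrite semigroupD ?semigroup_cst//; exact: bmeas_cst.
  rewrite semigroupD ?semigroup_cst; [exact: addIr|exact: semigroup_bmeas|exact: bmeas_cst].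
rewrite !semigroupE; congr fine; rewrite ge0_int_lawD//.
- apply: eq_integral => xi _; rewrite semigroupE EFin_bmeas_int//.
- by case: bC.
- by move=> x; have := fC x; rewrite ler_norml; lra.
Qed.

End feller.

End markov_semigroup.

(** * The heat kernel *)

Section extended_sums.
Context {R : realType}.
Local Open Scope ereal_scope.

Lemma le_sum_esum (I : choiceType) (r : seq I) (a : I -> \bar R) :
  uniq r -> (forall i, 0 <= a i) ->
  \sum_(i <- r) a i <= \esum_(i in [set: I]) a i.
Proof.
move=> ur a0; apply: esum_ge; exists [set` r]; first by split.
by rewrite fsbig_seq.
Qed.

Lemma esum_le (I : choiceType) (a : I -> \bar R) (M : \bar R) :
  (forall r : seq I, uniq r -> \sum_(i <- r) a i <= M) ->
  \esum_(i in [set: I]) a i <= M.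
Proof.
move=> aM; apply: ge_ereal_sup => _ [F [finF _] <-].
by rewrite fsbig_finite//=; apply: aM; exact: fset_uniq.
Qed.

Lemma esumZ (I : choiceType) (c : R) (a : I -> \bar R) :
  (0 <= c)%R -> (forall i, 0 <= a i) ->
  \esum_(i in [set: I]) (c%:E * a i) = c%:E * \esum_(i in [set: I]) a i.
Proof.
move=> c0 a0.
(* One inequality holds for every factor; the converse is this inequality for [c^-1]. *)
have le_ (e : R) (b : I -> \bar R) : (0 <= e)%R -> (forall i, 0 <= b i) ->
    \esum_(i in [set: I]) (e%:E * b i) <= e%:E * \esum_(i in [set: I]) b i.
  move=> e0 b0; apply: esum_le => r ur.
  by rewrite -ge0_sume_distrr// lee_wpmul2l// le_sum_esum.
apply/eqP; rewrite eq_le le_//=; have [->|cn0] := eqVneq c 0%R.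
  by rewrite mul0e; apply: esum_ge0 => i _; rewrite mul0e.
have {cn0}c0 : (0 < c)%R by rewrite lt_neqAle eq_sym cn0.
have := le_ c^-1%R (fun i => c%:E * a i); rewrite invr_ge0 ltW// => /(_ isT).
under eq_esum do rewrite muleA -EFinM mulVf ?gt_eqF// mul1e.
by move=> h; rewrite -lee_pdivlMl//; apply: h => i; rewrite mule_ge0// lee_fin ltW.
Qed.

Lemma exchange_esum (I J : choiceType) (a : I -> J -> \bar R) :
  (forall i j, 0 <= a i j) ->
  \esum_(i in [set: I]) \esum_(j in [set: J]) a i j =
  \esum_(j in [set: J]) \esum_(i in [set: I]) a i j.
Proof.
move=> a0; rewrite !esum_esum//.
rewrite (reindex_esum ([set: J] `*`` (fun=> [set: I])) _ (fun k => (k.2, k.1)))//.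
split=> //; first by move=> [i j] [j' i'] _ _ /= [-> ->].
by move=> [i j] _; exists (j, i).
Qed.

Lemma esum_single (I : choiceType) (j : I) (a : I -> \bar R) :
  0 <= a j -> (forall i, i != j -> a i = 0) ->
  \esum_(i in [set: I]) a i = a j.
Proof.
move=> aj a0; rewrite -[RHS](@esum_set1 R I j a)// [RHS]esum_mkcond.
apply: eq_esum => i _; case: ifPn => // ij.
by apply: a0; apply: contra ij => /eqP ->; rewrite inE.
Qed.

Lemma fin_num_esum (I : choiceType) (a : I -> \bar R) (M : R) :
  (forall i, 0 <= a i) -> \esum_(i in [set: I]) a i <= M%:E ->
  \esum_(i in [set: I]) a i \is a fin_num.
Proof.
move=> a0 aM; rewrite ge0_fin_numE; first by rewrite (le_lt_trans aM)// ltry.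
by apply: esum_ge0.
Qed.

(** Cauchy product: the double sum is regrouped along the antidiagonals [m + n = k]. *)
Lemma esum_convolution (a : nat -> nat -> \bar R) : (forall m n, 0 <= a m n) ->
  \esum_(m in [set: nat]) \esum_(n in [set: nat]) a m n =
  \esum_(k in [set: nat]) \sum_(m < k.+1) a m (k - m)%N.
Proof.
move=> a0.
transitivity (\esum_(m in [set: nat]) \esum_(k in [set: nat])
    if (m <= k)%N then a m (k - m)%N else 0).
  apply: eq_esum => m _.
  transitivity (\esum_(k in [set k | (m <= k)%N]) a m (k - m)%N).
    rewrite (reindex_esum [set: nat] [set k | (m <= k)%N] (addn m)).
      by apply: eq_esum => n _; rewrite addKn.
    split=> [n _|n k _ _ /addnI//|k /= mk]; first by rewrite /= leq_addr.
    by exists (k - m)%N => //; rewrite subnKC.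
  by rewrite esum_mkcond; apply: eq_esum => k _; rewrite mem_setE.
rewrite exchange_esum; last by move=> m k; case: ifP.
apply: eq_esum => k _.
rewrite -(big_mkord xpredT (fun m => a m (k - m)%N)) fsbig_seq ?iota_uniq//.
rewrite -esum_fset// [RHS]esum_mkcond; apply: eq_esum => m _.
suff -> : (m \in [set` index_iota 0 k.+1]) = (m <= k)%N by [].
by rewrite mem_setE mem_index_iota.
Qed.

End extended_sums.

Section heat_kernel_theory.
Context {R : realType} {d : nat} (p : site d -> site d -> R).
Hypothesis kp : exclusion_kernel p.
Implicit Types (x y z : site d) (t : R).

Let p_ge0 x y : 0 <= p x y. Proof. exact: (exclusion_kernel_ge0 kp). Qed.

Lemma nstep_bounds n x y : 0 <= nstep p n x y <= 1.
Proof.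
elim: n x y => [|n IH] x y /=; first by rewrite ler0n lern1 leq_b1.
have h0 z : (0 <= (p x z * nstep p n z y)%:E)%E.
  by rewrite lee_fin mulr_ge0//; case/andP: (IH z y).
have h1 : (\esum_(z in [set: site d]) (p x z * nstep p n z y)%:E <= 1)%E.
  rewrite -(exclusion_kernel_sum1 kp x); apply: le_esum => z _.
  by rewrite lee_fin ler_piMr//; case/andP: (IH z y).
rewrite -!lee_fin fineK; last exact: fin_num_esum h1.
by rewrite h1 andbT esum_ge0.
Qed.

Lemma nstep_ge0 n x y : 0 <= nstep p n x y.
Proof. by case/andP: (nstep_bounds n x y). Qed.

Lemma nstep_le1 n x y : nstep p n x y <= 1.
Proof. by case/andP: (nstep_bounds n x y). Qed.

Lemma EFin_nstepS n x y : ((nstep p n.+1 x y)%:E =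
  \esum_(z in [set: site d]) (p x z)%:E * (nstep p n z y)%:E)%E.
Proof.
rewrite /= fineK; first by apply: eq_esum => z _; rewrite EFinM.
apply: (@fin_num_esum _ _ _ 1) => [z|].
  by rewrite lee_fin mulr_ge0// ?nstep_ge0//.
rewrite -(exclusion_kernel_sum1 kp x); apply: le_esum => z _.
by rewrite lee_fin ler_piMr// nstep_le1.
Qed.

Lemma EFin_nstepD m n x y : ((nstep p (m + n) x y)%:E =
  \esum_(z in [set: site d]) (nstep p m x z)%:E * (nstep p n z y)%:E)%E.
Proof.
elim: m x => [|m IH] x.
  rewrite add0n (esum_single (j := x))/= ?eqxx ?mul1e ?lee_fin ?nstep_ge0//.
  by move=> z /negbTE; rewrite eq_sym => ->; rewrite mul0e.
rewrite addSn EFin_nstepS.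
transitivity (\esum_(z in [set: site d]) \esum_(w in [set: site d])
    ((p x z)%:E * ((nstep p m z w)%:E * (nstep p n w y)%:E)))%E.
  apply: eq_esum => z _; rewrite IH esumZ// => w.
  by rewrite mule_ge0// ?lee_fin ?nstep_ge0//.
rewrite exchange_esum => [|z w]; last by rewrite !mule_ge0// ?lee_fin ?nstep_ge0//.
apply: eq_esum => w _; rewrite EFin_nstepS muleC -esumZ ?nstep_ge0// => [|z].
  by apply: eq_esum => z _; rewrite [RHS]muleC muleA.
by rewrite mule_ge0// ?lee_fin ?nstep_ge0//.
Qed.

Lemma nstep1 x y : nstep p 1 x y = p x y.
Proof.
apply: EFin_inj; rewrite EFin_nstepS (esum_single (j := y)).
- by rewrite /= eqxx mule1.
- by rewrite mule_ge0// ?lee_fin ?nstep_ge0.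
- by move=> w /negbTE /= ->; rewrite mule0.
Qed.

Lemma nstep_sym n x y : nstep p n x y = nstep p n y x.
Proof.
elim: n x y => [|n IH] x y; first by rewrite /= eq_sym.
(* From [x] the first step is split off, from [y] the last one. *)
apply: EFin_inj; rewrite EFin_nstepS -(addn1 n) EFin_nstepD.
by apply: eq_esum => z _; rewrite muleC IH nstep1 (exclusion_kernel_sym kp).
Qed.

Lemma nstep_translation n x y a : nstep p n (x + a) (y + a) = nstep p n x y.
Proof.
elim: n x y => [|n IH] x y; first by rewrite /= (inj_eq (addIr a)).
apply: EFin_inj; rewrite !EFin_nstepS.
rewrite (reindex_esum [set: site d] [set: site d] (fun z => z + a)); last first.
  split=> //; first by move=> z z' _ _ /addIr.
  by move=> z _; exists (z - a) => //; rewrite subrK.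
apply: eq_esum => z _; rewrite IH; congr (_%:E * _)%E.
rewrite (exclusion_kernel_translation kp) [RHS](exclusion_kernel_translation kp).
by congr p; rewrite opprD addrACA subrr addr0.
Qed.

Lemma nstep_row n x : (\esum_(y in [set: site d]) (nstep p n x y)%:E = 1)%E.
Proof.
elim: n x => [|n IH] x.
  rewrite (esum_single (j := x))/= ?eqxx ?lee_fin//.
  by move=> z /negbTE; rewrite eq_sym => ->.
under eq_esum do rewrite EFin_nstepS.
rewrite exchange_esum => [|y z]; last by rewrite mule_ge0// ?lee_fin ?nstep_ge0//.
rewrite -(exclusion_kernel_sum1 kp x); apply: eq_esum => z _.
rewrite esumZ ?IH ?mule1// => y; by rewrite lee_fin nstep_ge0.
Qed.

Definition poisson_weight t n : R := expR (- t) * t ^+ n / n`!%:R.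

Lemma poisson_weight_ge0 t n : 0 <= t -> 0 <= poisson_weight t n.
Proof. by move=> t0; rewrite !mulr_ge0 ?expR_ge0 ?exprn_ge0 ?invr_ge0. Qed.

Lemma poisson_weight_sum t : 0 <= t ->
  (\esum_(n in [set: nat]) (poisson_weight t n)%:E = 1)%E.
Proof.
rewrite le_eqVlt => /predU1P[<-|t0].
  rewrite (esum_single (j := 0%N)).
  - by rewrite /poisson_weight oppr0 expR0 expr0 fact0 invr1 !mulr1.
  - by rewrite lee_fin poisson_weight_ge0.
  - by move=> n n0; rewrite /poisson_weight expr0n (negbTE n0) mulr0 mul0r.
transitivity (\esum_(n in [set: nat]) (poisson_pmf t n)%:E)%E; last first.
  have -> : (\esum_(n in [set: nat]) (poisson_pmf t n)%:E)%E = poisson_prob t 0 setT.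
    by rewrite /poisson_prob t0.
  exact: probability_setT.
apply: eq_esum => n _; rewrite /poisson_pmf t0 /poisson_weight.
by rewrite -mulrA mulrC.
Qed.

(** Convolution of Poisson weights: the binomial theorem divided by a factorial. *)
Lemma poisson_weightD s t n :
  \sum_(m < n.+1) poisson_weight s m * poisson_weight t (n - m) =
  poisson_weight (s + t) n.
Proof.
rewrite /poisson_weight opprD expRD addrC exprDn mulr_sumr mulr_suml.
apply: eq_bigr => m _.
have mn : (m <= n)%N by rewrite -ltnS.
rewrite -(bin_fact mn) !natrM -mulr_natr.
have f0 k : k`!%:R != 0 :> R by rewrite pnatr_eq0 -lt0n fact_gt0.
have c0 : 'C(n, m)%:R != 0 :> R by rewrite pnatr_eq0 -lt0n bin_gt0.
by field; rewrite !f0 c0.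
Qed.

Local Notation H := (heat_kernel p).

Lemma EFin_heat t x y : 0 <= t -> ((H t x y)%:E =
  \esum_(n in [set: nat]) (poisson_weight t n)%:E * (nstep p n x y)%:E)%E.
Proof.
move=> t0; rewrite /heat_kernel fineK.
  by apply: eq_esum => n _; rewrite -EFinM.
apply: (@fin_num_esum _ _ _ 1) => [n|].
  by rewrite lee_fin mulr_ge0 ?nstep_ge0 ?poisson_weight_ge0.
rewrite -(poisson_weight_sum t0); apply: le_esum => n _.
by rewrite lee_fin ler_piMr ?nstep_le1 ?poisson_weight_ge0.
Qed.

Lemma heat_ge0 t x y : 0 <= t -> 0 <= H t x y.
Proof.
move=> t0; rewrite -lee_fin EFin_heat//; apply: esum_ge0 => n _.
by rewrite mule_ge0// lee_fin ?nstep_ge0 ?poisson_weight_ge0.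
Qed.

Lemma heat_sym t x y : H t x y = H t y x.
Proof. by congr fine; apply: eq_esum => n _; rewrite nstep_sym. Qed.

Lemma heat_translation t x y a : H t (x + a) (y + a) = H t x y.
Proof. by congr fine; apply: eq_esum => n _; rewrite nstep_translation. Qed.

Lemma heat_diag t x : H t x x = H t 0 0.
Proof. by rewrite -(heat_translation t 0 0 x) add0r. Qed.

Lemma heat_row t x : 0 <= t -> (\esum_(y in [set: site d]) (H t x y)%:E = 1)%E.
Proof.
move=> t0; under eq_esum do rewrite EFin_heat//.
rewrite exchange_esum => [|y n]; last first.
  by rewrite mule_ge0// lee_fin ?nstep_ge0 ?poisson_weight_ge0.
rewrite -(poisson_weight_sum t0); apply: eq_esum => n _.
rewrite esumZ ?nstep_row ?mule1 ?poisson_weight_ge0// => y.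
by rewrite lee_fin nstep_ge0.
Qed.

Lemma heat_gt0 t : 0 <= t -> 0 < H t 0 0.
Proof.
move=> t0; rewrite -lte_fin EFin_heat//.
apply: (@lt_le_trans _ _ (poisson_weight t 0)%:E).
  by rewrite lte_fin /poisson_weight expr0 fact0 divr1 mulr1 expR_gt0.
apply: le_trans (le_sum_esum (r := [:: 0%N]) _ _) => //.
  by rewrite big_seq1 /= eqxx mule1.
by move=> n; rewrite mule_ge0// lee_fin ?nstep_ge0 ?poisson_weight_ge0.
Qed.

(** Chapman-Kolmogorov. With [m] and [n] steps in the two time intervals, the walk only sees
    [m + n], and the Poisson weights of a given total convolve to those of [s + t]. *)
Lemma EFin_heatD s t x y : 0 <= s -> 0 <= t ->
  ((H (s + t) x y)%:E =
   \esum_(z in [set: site d]) (H s x z)%:E * (H t z y)%:E)%E.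
Proof.
move=> s0 t0; have st0 : 0 <= s + t by rewrite addr_ge0.
pose w (m n : nat) := (poisson_weight s m * poisson_weight t n)%R.
have wr0 m n : 0 <= w m n by rewrite mulr_ge0 ?poisson_weight_ge0.
have w0 m n : (0 <= (w m n)%:E)%E by rewrite lee_fin.
have n0 n u v : (0 <= (nstep p n u v)%:E)%E by rewrite lee_fin nstep_ge0.
have pw0 u n : 0 <= u -> (0 <= (poisson_weight u n)%:E)%E.
  by move=> u0; rewrite lee_fin poisson_weight_ge0.
transitivity (\esum_(z in [set: site d]) \esum_(m in [set: nat]) \esum_(n in [set: nat])
   ((w m n)%:E * ((nstep p m x z)%:E * (nstep p n z y)%:E)))%E; last first.
  apply: eq_esum => z _; rewrite (EFin_heat x z s0) muleC -esumZ; first last.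
  - by move=> m; rewrite mule_ge0 ?pw0.
  - exact: heat_ge0.
  apply: eq_esum => m _; rewrite (EFin_heat z y t0) muleC.
  rewrite -EFinM -esumZ; first last.
  - by move=> n; rewrite mule_ge0 ?pw0.
  - by rewrite mulr_ge0 ?nstep_ge0 ?poisson_weight_ge0.
  by apply: eq_esum => n _; rewrite -!EFinM; congr EFin; rewrite /w; ring.
rewrite exchange_esum => [|z m]; last by apply: esum_ge0 => n _; rewrite !mule_ge0.
transitivity (\esum_(m in [set: nat]) \esum_(n in [set: nat])
   ((w m n)%:E * (nstep p (m + n) x y)%:E))%E; last first.
  apply: eq_esum => m _; rewrite [RHS]exchange_esum => [|z n]; last first.
    by rewrite !mule_ge0.
  by apply: eq_esum => n _; rewrite EFin_nstepD esumZ// => z; rewrite mule_ge0.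
pose a m n := ((w m n)%:E * (nstep p (m + n) x y)%:E)%E.
transitivity (\esum_(k in [set: nat]) \sum_(m < k.+1) a m (k - m)%N)%E; last first.
  by apply: esym; apply: esum_convolution => m n; rewrite mule_ge0.
rewrite EFin_heat//; apply: eq_esum => k _.
rewrite -poisson_weightD -sumEFin ge0_sume_distrl; last by move=> m _; exact: w0.
by apply: eq_bigr => m _; rewrite /a subnKC// -ltnS.
Qed.

(* Chapman-Kolmogorov at time [t / 2] followed by [a b <= (a^2 + b^2) / 2]. *)
Lemma heat_le_diag t x y : 0 <= t -> H t x y <= H t 0 0.
Proof.
move=> t0; have h0 : 0 <= t / 2 by rewrite divr_ge0.
suff : 2 * H t x y <= H t x x + H t y y.
  by rewrite !heat_diag; lra.
have E u v : ((H t u v)%:E =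
    \esum_(z in [set: site d]) (H (t / 2) u z)%:E * (H (t / 2) z v)%:E)%E.
  by rewrite -EFin_heatD// -splitr.
rewrite -lee_fin EFinM [leRHS]EFinD (E x y) (E x x) (E y y).
rewrite -esumZ// => [|z]; last by rewrite mule_ge0// lee_fin heat_ge0.
rewrite -esumD => [|z _|z _]; try by rewrite mule_ge0// lee_fin heat_ge0.
apply: le_esum => z _; rewrite -!EFinM -EFinD lee_fin.
rewrite (heat_sym _ z x) (heat_sym _ y z).
by have := sqr_ge0 (H (t / 2) x z - H (t / 2) z y); rewrite !expr2; lra.
Qed.

Lemma heat_sum_ge t x y n : 0 <= t ->
  \sum_(k < n) poisson_weight t k * nstep p k x y <= H t x y.
Proof.
move=> t0; rewrite -lee_fin EFin_heat// -sumEFin.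
rewrite -(big_mkord xpredT (fun k => (poisson_weight t k * nstep p k x y)%:E)).
apply: (le_sum_esum (a := fun k => ((poisson_weight t k)%:E * (nstep p k x y)%:E)%E)).
  exact: iota_uniq.
by move=> k; rewrite mule_ge0// lee_fin ?nstep_ge0 ?poisson_weight_ge0.
Qed.

Lemma nstep_sum_le (A : {fset site d}) n x y :
  \sum_(z <- A) p x z * nstep p n z y <= nstep p n.+1 x y.
Proof.
rewrite -lee_fin EFin_nstepS -sumEFin.
apply: (le_sum_esum (a := fun z => ((p x z)%:E * (nstep p n z y)%:E)%E)).
  exact: fset_uniq.
by move=> z; rewrite mule_ge0// ?lee_fin ?nstep_ge0//.
Qed.

Lemma kernel_sum_le1 (A : {fset site d}) x : \sum_(z <- A) p x z <= 1.
Proof.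
rewrite -lee_fin -(exclusion_kernel_sum1 kp x) -sumEFin.
apply: (le_sum_esum (a := fun z => (p x z)%:E)); first exact: fset_uniq.
by move=> z; rewrite lee_fin.
Qed.

End heat_kernel_theory.

(** * Finite-volume approximation of the semigroup *)

Section signed_sums.
Context {R : realType} {I : choiceType}.
Implicit Types (a b : I -> R) (r F : seq I).

Definition abs_summable a := exists K : R, forall r, uniq r -> \sum_(i <- r) `|a i| <= K.

Lemma abs_summableD a b : abs_summable a -> abs_summable b ->
  abs_summable (fun i => a i + b i).
Proof.
move=> [K aK] [L bL]; exists (K + L) => r ur.
rewrite (le_trans _ (lerD (aK r ur) (bL r ur)))// -big_split/=.
by apply: ler_sum => i _; exact: ler_normD.
Qed.

Lemma abs_summableZ (c : R) a : abs_summable a -> abs_summable (fun i => c * a i).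
Proof.
move=> [K aK]; exists (`|c| * K) => r ur.
by under eq_bigr do rewrite normrM; rewrite -mulr_sumr ler_wpM2l// aK.
Qed.

Lemma sum_split_sub a F r : uniq F -> uniq r -> {subset F <= r} ->
  \sum_(i <- r) a i = \sum_(i <- F) a i + \sum_(i <- r | i \notin F) a i.
Proof.
move=> uF ur Fr; rewrite (bigID (mem F))/=; congr (_ + _).
rewrite -big_filter; apply: perm_big; apply: uniq_perm => //.
  exact: filter_uniq.
move=> i; rewrite mem_filter; apply/andP/idP => [[]//|iF]; split=> //.
exact: Fr.
Qed.

Lemma sum_dist_le a b F r : uniq F -> uniq r -> {subset F <= r} ->
  (forall i, `|a i| <= b i) ->
  `|\sum_(i <- r) a i - \sum_(i <- F) a i| <= \sum_(i <- r) b i - \sum_(i <- F) b i.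
Proof.
move=> uF ur Fr ab; rewrite !(sum_split_sub _ uF ur Fr) !(addrC (\sum_(i <- F) _)) !addrK.
by rewrite (le_trans (ler_norm_sum _ _ _))// ler_sum.
Qed.

Lemma esum_approx a : (forall i, 0 <= a i) -> abs_summable a ->
  forall e : R, 0 < e -> exists r0 : seq I, forall r, uniq r -> {subset r0 <= r} ->
    `|fine (\esum_(i in [set: I]) (a i)%:E) - \sum_(i <- r) a i| <= e.
Proof.
move=> a0 [K aK] e e0; set E := (\esum_(i in _) _)%E.
have fE : E \is a fin_num.
  apply: (@fin_num_esum _ _ _ K) => [i|]; first by rewrite lee_fin.
  apply: esum_le => r ur; rewrite sumEFin lee_fin (le_trans _ (aK r ur))//.
  by apply: ler_sum => i _; exact: ler_norm.
have [_ [F [finF _] <-] EF] := @ub_ereal_sup_adherent R _ e e0 fE.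
exists (fset_set F) => r ur Fr.
have h1 : \sum_(i <- r) a i <= fine E.
  rewrite -lee_fin fineK// -sumEFin.
  by apply: (le_sum_esum (a := fun i => (a i)%:E)) => // i; rewrite lee_fin.
have h2 : fine E - e < \sum_(i <- fset_set F) a i.
  move: EF; rewrite fsbig_finite//= sumEFin -[ereal_sup _]/E.
  by rewrite -[in X in X -> _](fineK fE) -EFinB lte_fin.
have h3 : \sum_(i <- fset_set F) a i <= \sum_(i <- r) a i.
  by rewrite (sum_split_sub a _ ur Fr) ?fset_uniq// lerDl sumr_ge0.
by rewrite ger0_norm; lra.
Qed.

(** Convergence of the partial sums along the directed family of finite index sets; it yields the
    linearity that the splitting into positive and negative parts hides. *)
Lemma rsum_approx a : abs_summable a -> forall e : R, 0 < e ->
  exists r0 : seq I, forall r, uniq r -> {subset r0 <= r} ->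
    `|rsum a - \sum_(i <- r) a i| <= e.
Proof.
move=> [K aK] e e0; have e20 : 0 < e / 2 by rewrite divr_gt0.
have [||r1 h1] := @esum_approx (fun i => Num.max (a i) 0) _ _ _ e20.
- by move=> i; rewrite le_max lexx orbT.
- exists K => r ur; rewrite (le_trans _ (aK r ur))//; apply: ler_sum => i _.
  by rewrite maxElt; case: ltP => ?; rewrite ?normr0.
have [||r2 h2] := @esum_approx (fun i => Num.max (- a i) 0) _ _ _ e20.
- by move=> i; rewrite le_max lexx orbT.
- exists K => r ur; rewrite (le_trans _ (aK r ur))//; apply: ler_sum => i _.
  by rewrite maxElt; case: ltP => ?; rewrite ?normr0 ?normrN.
exists (r1 ++ r2) => r ur r12; rewrite /rsum.
have {}h1 := h1 r ur (fun i i1 => r12 i (etrans (mem_cat _ _ _) (introT orP (or_introl i1)))).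
have {}h2 := h2 r ur (fun i i2 => r12 i (etrans (mem_cat _ _ _) (introT orP (or_intror i2)))).
have -> : \sum_(i <- r) a i =
    \sum_(i <- r) Num.max (a i) 0 - \sum_(i <- r) Num.max (- a i) 0.
  rewrite -sumrB; apply: eq_bigr => i _.
  by rewrite !maxElt; do 2! case: ltP => ?; lra.
move: h1 h2; set P := fine _; set N := fine _.
set P' := \sum_(i <- r) Num.max (a i) 0; set N' := \sum_(i <- r) _ => h1 h2.
rewrite (_ : P - N - (P' - N') = (P - P') - (N - N')); last by ring.
by rewrite (splitr e); apply: le_trans (ler_normB _ _) (lerD h1 h2).
Qed.

(** A cofinal family of finite index sets suffices, such as squares for sums over pairs of sites. *)
Lemma rsum_dist a (c K : R) : abs_summable a ->
  (forall r0 : seq I, exists r, [/\ uniq r, {subset r0 <= r} &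
     `|\sum_(i <- r) a i - c| <= K]) -> `|rsum a - c| <= K.
Proof.
move=> sa aK; apply/ler_addgt0Pl => e e0.
have [r0 hr0] := rsum_approx sa e0; have [r [ur r0r hr]] := aK r0.
exact: le_trans (ler_distD _ _ _) (lerD (hr0 r ur r0r) hr).
Qed.

Lemma rsumD a b : abs_summable a -> abs_summable b ->
  rsum (fun i => a i + b i) = rsum a + rsum b.
Proof.
move=> sa sb; apply/eqP; rewrite -subr_eq0 -normr_le0; apply/ler_addgt0Pl => e e0.
rewrite addr0; have e20 : 0 < e / 2 by rewrite divr_gt0.
have [r1 h1] := rsum_approx sa e20; have [r2 h2] := rsum_approx sb e20.
apply: rsum_dist => [|r0]; first exact: abs_summableD.
exists (undup (r0 ++ r1 ++ r2)); split; first exact: undup_uniq.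
  by move=> i i0; rewrite mem_undup mem_cat i0.
rewrite big_split/= distrC opprD addrACA (splitr e).
apply: le_trans (ler_normD _ _) (lerD _ _).
  by rewrite h1 ?undup_uniq// => i i1; rewrite mem_undup !mem_cat i1 orbT.
by rewrite h2 ?undup_uniq// => i i2; rewrite mem_undup !mem_cat i2 !orbT.
Qed.

Lemma rsumZ (c : R) a : abs_summable a -> rsum (fun i => c * a i) = c * rsum a.
Proof.
move=> sa; apply/eqP; rewrite -subr_eq0 -normr_le0; apply/ler_addgt0Pl => e e0.
rewrite addr0; have c0 : 0 < `|c| + 1 by rewrite ltr_wpDl.
have [|r1 h1] := rsum_approx sa (e := e / (`|c| + 1)); first by rewrite divr_gt0.
apply: rsum_dist => [|r0]; first exact: abs_summableZ.
exists (undup (r0 ++ r1)); split; first exact: undup_uniq.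
  by move=> i i0; rewrite mem_undup mem_cat i0.
rewrite -mulr_sumr -mulrBr normrM distrC.
have := h1 (undup (r0 ++ r1)) (undup_uniq _).
move=> /(_ _)/le_trans h; apply: (@le_trans _ _ (`|c| * (e / (`|c| + 1)))).
  by rewrite ler_wpM2l// h// => i i1; rewrite mem_undup mem_cat i1 orbT.
by rewrite mulrCA ler_piMr ?(ltW e0)// ler_pdivrMr// mul1r lerDl.
Qed.

End signed_sums.

(** * Exclusion in a finite box with killing at the boundary *)

Section killed_dynamics.
Context {R : realType} {d : nat} (p : site d -> site d -> R).
Hypothesis kp : exclusion_kernel p.
Implicit Types (x y z i j : site d) (eta xi : config d) (g : config d -> R)
  (A B L : {fset site d}).

Let p_ge0 x y : 0 <= p x y. Proof. exact: (exclusion_kernel_ge0 kp). Qed.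

Definition swap x y z := if z == x then y else if z == y then x else z.

Lemma swapK x y : involutive (swap x y).
Proof.
move=> z; rewrite /swap; case: (eqVneq z x) => [->|zx].
  by rewrite eqxx; case: eqP.
by case: (eqVneq z y) => [->|zy]; rewrite ?eqxx// (negbTE zx) (negbTE zy).
Qed.

Lemma exchangeE x y eta z : exchange x y eta z = eta (swap x y z).
Proof. by rewrite /exchange /swap; case: (z == x) => //; case: (z == y). Qed.

Lemma exchange_flip x y i eta :
  exchange x y (flip i eta) = flip (swap x y i) (exchange x y eta).
Proof.
apply/funext => z; rewrite exchangeE /flip !exchangeE swapK.
by rewrite -(inj_eq (can_inj (swapK x y)) (swap x y z)) swapK.
Qed.

Lemma set_at_flip x b i eta : set_at x b (flip i eta) =
  if x == i then set_at x b eta else flip i (set_at x b eta).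
Proof.
apply/funext => z; rewrite /set_at /flip (fun_if (@^~ z)).
have [->|xi] := eqVneq x i; first by case: (z == i).
have [->|//] := eqVneq z x.
by rewrite (negbTE xi).
Qed.

Lemma exchange_cases x y eta :
  exchange x y eta = eta \/ exchange x y eta = flip x (flip y eta).
Proof.
have [e|ne] := eqVneq (eta x) (eta y); [left|right]; apply/funext => z.
  rewrite /exchange; have [->|_] := eqVneq z x; first by rewrite e.
  by have [->|//] := eqVneq z y.
rewrite /exchange /flip; have [_|_] := eqVneq z x.
  have [xy|_] := eqVneq x y; first by move: ne; rewrite xy eqxx.
  by case: (eta x) ne; case: (eta y).
by have [_|//] := eqVneq z y; case: (eta x) ne; case: (eta y).
Qed.

Lemma set_at_cases x b eta : set_at x b eta = eta \/ set_at x b eta = flip x eta.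
Proof.
have [e|ne] := eqVneq (eta x) b; [left|right]; apply/funext => z;
  rewrite /set_at.
  by have [->|//] := eqVneq z x; rewrite e.
by rewrite /flip; have [_|//] := eqVneq z x; case: b ne; case: (eta x).
Qed.

Lemma exchange_diff_le g x y eta : bounded g ->
  `|g (exchange x y eta) - g eta| <= oscillation g x + oscillation g y.
Proof.
move=> bg; have [->|->] := exchange_cases x y eta.
  by rewrite subrr normr0 addr_ge0// osc_ge0.
by rewrite (le_trans (ler_distD (g (flip y eta)) _ _))// lerD// osc_norm_ub.
Qed.

Lemma set_at_diff_le g x b eta : bounded g ->
  `|g (set_at x b eta) - g eta| <= oscillation g x.
Proof.
move=> bg; have [->|->] := set_at_cases x b eta; last exact: osc_norm_ub.
by rewrite subrr normr0 osc_ge0.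
Qed.

Lemma agree_exchange A x y eta xi : x \in A -> y \in A ->
  agree A eta xi -> agree A (exchange x y eta) (exchange x y xi).
Proof.
move=> xA yA h z zA; rewrite !exchangeE h// /swap.
by case: ifP => // _; case: ifP.
Qed.

Lemma agree_set_at A x b eta xi : agree A eta xi ->
  agree A (set_at x b eta) (set_at x b xi).
Proof. by move=> h z zA; rewrite /set_at; case: ifP => // _; exact: h. Qed.

(** As [p x] has total mass one, this is the rate of jumps from [x] to sites outside [L]. *)
Definition kill_rate L x := 1 - \sum_(y <- L) p x y.

Lemma kill_rate_ge0 L x : 0 <= kill_rate L x.
Proof. by rewrite subr_ge0 kernel_sum_le1. Qed.

(* The exclusion dynamics in the finite box [L] where a particle trying to
   leave [L] is removed: unlike the dynamics obtained by dropping these jumps,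
   the oscillations of a function evolve by the restriction of [p] to [L],
   which is dominated by [p]. *)
Definition killed_gen L g eta :=
  \sum_(x <- L) \sum_(y <- L) p x y * (g (exchange x y eta) - g eta) +
  2 * \sum_(x <- L) kill_rate L x * (g (set_at x false eta) - g eta).

(** The factor 2 stems from ordered pairs: by symmetry a bond leaving [L] counts once in each
    direction. The condition [h * killed_rate L <= 1] will make the Euler step a positive
    operator. *)
Definition killed_rate L :=
  \sum_(x <- L) \sum_(y <- L) p x y + 2 * \sum_(x <- L) kill_rate L x.

Lemma killed_rate_ge0 L : 0 <= killed_rate L.
Proof.
rewrite addr_ge0 ?mulr_ge0 ?sumr_ge0// => x _; last exact: kill_rate_ge0.
exact: sumr_ge0.
Qed.

Lemma killed_gen_depends L g : depends_on L g -> depends_on L (killed_gen L g).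
Proof.
move=> gL eta xi h; congr (_ + 2 * _); rewrite !big_seq.
  apply: eq_bigr => x xL; rewrite !big_seq; apply: eq_bigr => y yL.
  by rewrite (gL _ _ h) (gL _ _ (agree_exchange xL yL h)).
by apply: eq_bigr => x xL; rewrite (gL _ _ h) (gL _ _ (agree_set_at x false h)).
Qed.

Lemma sum_pick L i (F : site d -> R) : i \in L ->
  \sum_(x <- L) (x == i)%:R * F x = F i.
Proof.
move=> iL; rewrite (bigD1_seq i iL (fset_uniq _))/= eqxx mul1r big1 ?addr0// => x /negbTE ->.
by rewrite mul0r.
Qed.

(** The flip creates a discrepancy at [i]. An event away from [i] leaves it in place and contributes
    at most [oscillation g i] minus the present difference, an exchange with [y] moves it to [y], a
    killing at [i] erases it. At [i], exchanges inside [L] and killing have total rate one for each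
    order of the pair, whence the last term. Events at [i] also enter the first term, harmlessly
    since it is nonnegative. *)
Lemma killed_gen_flip L g i eta : depends_on L g -> i \in L ->
  killed_gen L g (flip i eta) - killed_gen L g eta <=
  killed_rate L * (oscillation g i - (g (flip i eta) - g eta)) +
  2 * (\sum_(y <- L) p i y * oscillation g y) - 2 * (g (flip i eta) - g eta).
Proof.
move=> gL iL; set D := g (flip i eta) - g eta; set o := oscillation g.
have bg := bmeas_bounded (local_bmeas gL).
have Do : 0 <= o i - D by rewrite subr_ge0 osc_ub.
have o0 x : 0 <= o x by exact: osc_ge0.
have h1 x y : p x y * (g (exchange x y (flip i eta)) - g (flip i eta)) -
    p x y * (g (exchange x y eta) - g eta) <=
    p x y * (o i - D) + (x == i)%:R * (p x y * (o y - D)) +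
    (y == i)%:R * (p x y * (o x - D)).
  rewrite -mulrBr [_%:R * (p x y * _)]mulrCA [_%:R * (p x y * (o x - D))]mulrCA.
  rewrite -!mulrDr ler_wpM2l// exchange_flip.
  have := osc_ub (swap x y i) (exchange x y eta) bg; rewrite -/(o _).
  rewrite /swap (eq_sym x) (eq_sym y).
  move: Do; rewrite /D.
  have [<-|xi] := eqVneq i x.
    by have [<-|yi] := eqVneq i y; rewrite ?mul1r ?mul0r; lra.
  by have [<-|yi] := eqVneq i y; rewrite ?mul1r ?mul0r; lra.
have h2 x : kill_rate L x * (g (set_at x false (flip i eta)) - g (flip i eta)) -
    kill_rate L x * (g (set_at x false eta) - g eta) <=
    kill_rate L x * (o i - D) + (x == i)%:R * (kill_rate L x * - D).
  rewrite -mulrBr mulrCA -mulrDr ler_wpM2l ?kill_rate_ge0// set_at_flip.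
  case: (eqVneq x i) => [->|xi]; first by move: Do; rewrite mul1r /D; lra.
  have := osc_ub i (set_at x false eta) bg; rewrite -/(o _).
  by move: Do; rewrite mul0r /D; lra.
have H1 : \sum_(x <- L) \sum_(y <- L)
      p x y * (g (exchange x y (flip i eta)) - g (flip i eta)) -
    \sum_(x <- L) \sum_(y <- L) p x y * (g (exchange x y eta) - g eta) <=
    (\sum_(x <- L) \sum_(y <- L) p x y) * (o i - D) +
    2 * \sum_(y <- L) p i y * (o y - D).
  (* Pairs with first entry [i] and pairs with second entry [i] both contribute [T], by symmetry of
     [p]. *)
  set T := \sum_(y <- L) p i y * (o y - D).
  have E1 : T = \sum_(x <- L) (x == i)%:R * \sum_(y <- L) p x y * (o y - D).
    by rewrite (sum_pick (fun x => \sum_(y <- L) p x y * (o y - D)) iL).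
  have E2 : T = \sum_(x <- L) \sum_(y <- L) (y == i)%:R * (p x y * (o x - D)).
    apply: eq_bigr => x _; rewrite (sum_pick (fun y => p x y * (o x - D)) iL).
    by rewrite (exclusion_kernel_sym kp).
  rewrite (_ : 2 * T = T + T); last by rewrite mulr_natl.
  rewrite {1}E1 E2 -sumrB mulr_suml addrA -!big_split/=; apply: ler_sum => x _.
  rewrite -sumrB mulr_suml mulr_sumr -!big_split/=; apply: ler_sum => y _.
  exact: h1.
have H2 : \sum_(x <- L) kill_rate L x *
      (g (set_at x false (flip i eta)) - g (flip i eta)) -
    \sum_(x <- L) kill_rate L x * (g (set_at x false eta) - g eta) <=
    (\sum_(x <- L) kill_rate L x) * (o i - D) + kill_rate L i * - D.
  rewrite -sumrB -(sum_pick (fun x => kill_rate L x * - D) iL) mulr_suml.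
  by rewrite -big_split/=; apply: ler_sum => x _; exact: h2.
have H3 : \sum_(y <- L) p i y * (o y - D) =
    \sum_(y <- L) p i y * o y - (\sum_(y <- L) p i y) * D.
  by rewrite mulr_suml -sumrB; apply: eq_bigr => y _; rewrite mulrBr.
rewrite /killed_gen /killed_rate; move: H1 H2; rewrite H3 -[kill_rate L i]/(1 - \sum_(y <- L) p i y).
lra.
Qed.

End killed_dynamics.

(** * One Euler step: oscillations, sup norm, consistency *)

Section euler_step.
Context {R : realType} {d : nat} (p : site d -> site d -> R).
Hypothesis kp : exclusion_kernel p.
Implicit Types (x y z i j : site d) (eta xi : config d) (g : config d -> R)
  (A B L : {fset site d}) (h : R).

Let p_ge0 x y : 0 <= p x y. Proof. exact: (exclusion_kernel_ge0 kp). Qed.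

Lemma killed_gen_norm_le L g (C : R) eta : (forall xi, `|g xi| <= C) ->
  `|killed_gen p L g eta| <= 2 * killed_rate p L * C.
Proof.
move=> gC; have gB xi : `|g xi - g eta| <= 2 * C.
  by rewrite mulr_natl mulr2n (le_trans (ler_normB _ _))// lerD.
rewrite /killed_gen (_ : 2 * killed_rate p L * C =
  (\sum_(x <- L) \sum_(y <- L) p x y) * (2 * C) +
  2 * ((\sum_(x <- L) kill_rate p L x) * (2 * C))); last by rewrite /killed_rate; ring.
rewrite (le_trans (ler_normD _ _))// lerD//.
  rewrite mulr_suml (le_trans (ler_norm_sum _ _ _))// ler_sum// => x _.
  rewrite mulr_suml (le_trans (ler_norm_sum _ _ _))// ler_sum// => y _.
  by rewrite normrM ger0_norm// ler_wpM2l.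
rewrite normrM ger0_norm// ler_wpM2l// mulr_suml.
rewrite (le_trans (ler_norm_sum _ _ _))// ler_sum// => x _.
by rewrite normrM ger0_norm ?kill_rate_ge0// ler_wpM2l ?kill_rate_ge0.
Qed.

(* The factor [expR (- (2 * h))], instead of [1 - 2 * h], makes the binomial
   weights of the iterated steps smaller than Poisson weights. *)
Definition killed_step L h g eta :=
  expR (- (2 * h)) * ((1 + 2 * h) * g eta + h * killed_gen p L g eta).

Lemma killed_step_depends L h g : depends_on L g -> depends_on L (killed_step L h g).
Proof.
move=> gL eta xi ab.
by rewrite /killed_step (gL _ _ ab) (killed_gen_depends p gL ab).
Qed.

(** With [D] the difference of [g] under the flip, the restriction on [h] bounds [h * killed_rate p
    L * (oscillation g i - D)] by [oscillation g i - D], and the loss [2 * h * D] cancels the extra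
    [2 * h] of the step. *)
Lemma osc_killed_step L h g i : depends_on L g -> 0 <= h ->
  h * killed_rate p L <= 1 ->
  oscillation (killed_step L h g) i <= expR (- (2 * h)) *
    (oscillation g i + 2 * h * \sum_(y <- L) p i y * oscillation g y).
Proof.
move=> gL h0 hL; have bg := bmeas_bounded (local_bmeas gL).
have [iL|iL] := boolP (i \in L); last first.
  rewrite (osc_notin (killed_step_depends h gL) iL) mulr_ge0 ?expR_ge0//.
  rewrite addr_ge0 ?osc_ge0// !mulr_ge0 ?sumr_ge0// => y _.
  by rewrite mulr_ge0// osc_ge0.
apply: osc_le => eta; rewrite /killed_step -mulrBr ler_wpM2l ?expR_ge0//.
have := killed_gen_flip kp eta gL iL.
have := osc_ub i eta bg; set D := g (flip i eta) - g eta => Do.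
set S := \sum_(y <- L) _; set G := killed_gen _ _ _ _; set G' := killed_gen _ _ _ _.
move=> /(ler_wpM2l h0).
have : h * killed_rate p L * (oscillation g i - D) <= oscillation g i - D.
  by rewrite ler_piMl// subr_ge0.
by rewrite /D; lra.
Qed.

Lemma expRN2_le1 h : 0 <= h -> expR (- (2 * h)) * (1 + 2 * h) <= 1.
Proof.
by move=> h0; rewrite expRN mulrC ler_pdivrMr ?expR_gt0// mul1r expR_ge1Dx.
Qed.

(** The bracket of the step combines values of [g] with nonnegative weights of total [1 + 2 * h];
    the exponential factor brings the total down to at most one. *)
Lemma killed_step_norm_le L h g (C : R) : (forall xi, `|g xi| <= C) -> 0 <= h ->
  h * killed_rate p L <= 1 -> forall xi, `|killed_step L h g xi| <= C.
Proof.
move=> gC h0 hL eta.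
have C0 : 0 <= C := le_trans (normr_ge0 _) (gC eta).
rewrite /killed_step normrM ger0_norm ?expR_ge0//.
suff : `|(1 + 2 * h) * g eta + h * killed_gen p L g eta| <= (1 + 2 * h) * C.
  move=> /(ler_wpM2l (expR_ge0 (- (2 * h))))/le_trans; apply.
  by rewrite mulrA ler_piMl// expRN2_le1.
pose G := \sum_(x <- L) \sum_(y <- L) p x y * g (exchange x y eta) +
  2 * \sum_(x <- L) kill_rate p L x * g (set_at x false eta).
have -> : killed_gen p L g eta = G - killed_rate p L * g eta.
  rewrite /killed_gen /killed_rate /G [X in _ = _ - X]mulrDl opprD addrACA; congr (_ + _).
    rewrite mulr_suml -sumrB; apply: eq_bigr => x _.
    by rewrite mulr_suml -sumrB; apply: eq_bigr => y _; rewrite mulrBr.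
  rewrite -mulrA -mulrBr mulr_suml -sumrB; congr (_ * _).
  by apply: eq_bigr => x _; rewrite mulrBr.
have GC : `|G| <= killed_rate p L * C.
  rewrite /G /killed_rate [leRHS]mulrDl (le_trans (ler_normD _ _))// lerD//.
    rewrite mulr_suml (le_trans (ler_norm_sum _ _ _))// ler_sum// => x _.
    rewrite mulr_suml (le_trans (ler_norm_sum _ _ _))// ler_sum// => y _.
    by rewrite normrM ger0_norm// ler_wpM2l.
  rewrite normrM ger0_norm// -mulrA ler_wpM2l// mulr_suml.
  rewrite (le_trans (ler_norm_sum _ _ _))// ler_sum// => x _.
  by rewrite normrM ger0_norm ?kill_rate_ge0// ler_wpM2l ?kill_rate_ge0.
rewrite (_ : _ + _ = (1 + 2 * h - h * killed_rate p L) * g eta + h * G); last by ring.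
rewrite (le_trans (ler_normD _ _))// !normrM (ger0_norm h0) ger0_norm; last by lra.
have := ler_wpM2l h0 GC.
have : (1 + 2 * h - h * killed_rate p L) * `|g eta| <= (1 + 2 * h - h * killed_rate p L) * C.
  by rewrite ler_wpM2l//; lra.
by lra.
Qed.

(** The constant collects [4 * C] from [1 - (1 - 2 * h) * (1 + 2 * h) = 4 * h ^+ 2], and
    [4 * killed_rate p L * C] from [1 - expR (- (2 * h)) <= 2 * h] combined with
    [killed_gen_norm_le]. *)
Lemma killed_step_consistent L h g (C : R) eta : (forall xi, `|g xi| <= C) ->
  0 <= h -> h <= 1 ->
  `|killed_step L h g eta - g eta - h * killed_gen p L g eta| <=
  h * (h * (4 * (1 + killed_rate p L) * C)).
Proof.
move=> gC h0 h1; have := killed_gen_norm_le L eta gC.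
have := gC eta; rewrite /killed_step.
set G := killed_gen p L g eta; set E := expR _ => gCe GC.
have E1 : E <= 1 by rewrite /E -[leRHS]expR0 ler_expR; lra.
have E2 : 1 - 2 * h <= E by rewrite -[1 - _]/(1 + - (2 * h)); exact: expR_ge1Dx.
have E3 : 1 - E * (1 + 2 * h) <= 4 * (h * h).
  have : (1 - 2 * h) * (1 + 2 * h) <= E * (1 + 2 * h) by rewrite ler_wpM2r//; lra.
  by lra.
have E4 := expRN2_le1 h0; rewrite -/E in E4.
have C0 : 0 <= C := le_trans (normr_ge0 _) gCe.
rewrite (_ : _ - _ = - ((1 - E * (1 + 2 * h)) * g eta + h * ((1 - E) * G))); last by ring.
rewrite normrN (le_trans (ler_normD _ _))// !normrM (ger0_norm h0).
rewrite (ger0_norm (_ : 0 <= 1 - E * _)) ?subr_ge0// (ger0_norm (_ : 0 <= 1 - E)) ?subr_ge0//.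
have : (1 - E * (1 + 2 * h)) * `|g eta| <= 4 * (h * h) * C.
  by apply: ler_pM => //; rewrite subr_ge0.
have : h * ((1 - E) * `|G|) <= h * (2 * h * (2 * killed_rate p L * C)).
  rewrite ler_wpM2l//; apply: ler_pM => //; first by rewrite subr_ge0.
  by lra.
by lra.
Qed.

(** Terms are dominated by [p x y * (oscillation g x + oscillation g y)], summable because
    oscillations vanish off [L] and rows of [p] have mass one. By symmetry of [p], the dominating
    mass outside the square of [A] is exactly the error bound. *)
Lemma exclusion_term_summable (L : {fset site d}) g eta : depends_on L g ->
  abs_summable (fun xy : site d * site d =>
    p xy.1 xy.2 * (g (exchange xy.1 xy.2 eta) - g eta)) /\
  (forall A, {subset L <= A} ->
    `|exclusion_gen p g eta - \sum_(x <- A) \sum_(y <- A)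
        p x y * (g (exchange x y eta) - g eta)| <=
     2 * \sum_(x <- A) kill_rate p A x * oscillation g x).
Proof.
move=> gL; have bg := bmeas_bounded (local_bmeas gL).
pose a (xy : site d * site d) := p xy.1 xy.2 * (g (exchange xy.1 xy.2 eta) - g eta).
pose M (xy : site d * site d) := p xy.1 xy.2 * (oscillation g xy.1 + oscillation g xy.2).
have aM xy : `|a xy| <= M xy.
  by rewrite normrM ger0_norm// ler_wpM2l// exchange_diff_le.
have M0 xy : 0 <= M xy by rewrite mulr_ge0// addr_ge0// osc_ge0.
pose sq (B : {fset site d}) := [seq (x, y) | x <- B, y <- B].
have usq B : uniq (sq B) by apply: allpairs_uniq (fset_uniq B) (fset_uniq B) _ => -[? ?] [? ?].
have msq B x y : ((x, y) \in sq B) = (x \in B) && (y \in B).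
  apply/allpairsP/andP => [[[u v] /= [uB vB [-> ->]]]//|[xB yB]].
  by exists (x, y).
have SM A B : {subset L <= A} -> {subset A <= B} -> \sum_(xy <- sq B) M xy =
    2 * \sum_(x <- A) (\sum_(y <- B) p x y) * oscillation g x.
  move=> LA AB.
  have E : \sum_(x <- B) \sum_(y <- B) p x y * oscillation g x =
      \sum_(x <- A) (\sum_(y <- B) p x y) * oscillation g x.
    rewrite (eq_bigr (fun x => (\sum_(y <- B) p x y) * oscillation g x)); last first.
      by move=> x _; rewrite mulr_suml.
    rewrite (sum_split_sub _ (fset_uniq A) (fset_uniq B) AB) [X in _ + X]big1 ?addr0//.
    move=> x xA; rewrite (osc_notin gL) ?mulr0//.
    by apply: contra xA; exact: LA.
  rewrite big_allpairs_dep/= mulr_natl mulr2n -{1}E -E.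
  rewrite [X in _ = _ + X]exchange_big/= -big_split/=; apply: eq_bigr => x _.
  rewrite -big_split/=; apply: eq_bigr => y _.
  by rewrite /M/= mulrDr (exclusion_kernel_sym kp y x).
have cof (r : seq (site d * site d)) A : exists B, {subset A <= B} /\ {subset r <= sq B}.
  exists (A `|` [fset x in unzip1 r] `|` [fset x in unzip2 r])%fset; split.
    by move=> x xA; rewrite !inE xA.
  move=> [x y] xyr; rewrite msq !inE.
  by rewrite (map_f fst xyr) (map_f snd xyr) !orbT.
have SMK A B : {subset L <= A} -> {subset A <= B} ->
    \sum_(xy <- sq B) M xy <= 2 * \sum_(x <- A) oscillation g x.
  move=> LA AB; rewrite (SM A)// ler_wpM2l// ler_sum// => x _.
  by rewrite ler_piMl ?osc_ge0// kernel_sum_le1.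
have sa : abs_summable a.
  exists (2 * \sum_(x <- L) oscillation g x) => r ur.
  have [B [LB rB]] := cof r L.
  rewrite (le_trans _ (SMK L B _ LB))//.
  apply: (@le_trans _ _ (\sum_(xy <- r) M xy)); first by rewrite ler_sum.
  by rewrite (sum_split_sub M ur (usq B) rB) lerDl sumr_ge0.
split=> // A LA; apply: rsum_dist => // r0.
have [B [AB rB]] := cof r0 A.
exists (sq B); split=> //.
have sAB : {subset sq A <= sq B}.
  by move=> [x y]; rewrite !msq => /andP[/AB -> /AB ->].
have := sum_dist_le (usq A) (usq B) sAB aM.
rewrite [X in `|_ - X|]big_allpairs_dep/= => /le_trans; apply.
rewrite (SM A B)// (SM A A)// -mulrBr ler_wpM2l// -sumrB ler_sum// => x _.
by rewrite -mulrBl ler_wpM2r ?osc_ge0// lerB// kernel_sum_le1.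
Qed.

End euler_step.

(** * The generator on functions of a fixed box *)

Section uniform_generator.
Context {R : realType} {d : nat} (p : site d -> site d -> R).
Hypothesis kp : exclusion_kernel p.
Implicit Types (x y : site d) (eta xi : config d) (g : config d -> R)
  (A B L : {fset site d}) (h : R).

Let p_ge0 x y : 0 <= p x y. Proof. exact: (exclusion_kernel_ge0 kp). Qed.

Lemma rsum_lin (I : choiceType) (J : Type) (s : seq J) (c : J -> R) (a : J -> I -> R) :
  (forall j, abs_summable (a j)) ->
  abs_summable (fun i => \sum_(j <- s) c j * a j i) /\
  rsum (fun i => \sum_(j <- s) c j * a j i) = \sum_(j <- s) c j * rsum (a j).
Proof.
move=> sa; elim: s => [|j s [IH1 IH2]].
  under [fun i : I => _]eq_fun do rewrite big_nil.
  have s0 : @abs_summable R I (fun=> 0).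
    by exists 0 => r _; rewrite big1// => i _; rewrite normr0.
  split=> //; rewrite big_nil.
  rewrite -[RHS](mul0r (@rsum R I (fun=> 0))) -[RHS]rsumZ//.
  by congr rsum; apply/funext => i; rewrite mul0r.
under [fun i : I => _]eq_fun do rewrite big_cons.
have sj := abs_summableZ (c j) (sa j).
by split; [exact: abs_summableD|rewrite rsumD// IH2 rsumZ// big_cons].
Qed.

Definition cylinder_indicator L (a : {ffun L -> bool}) eta : R :=
  (restr L eta == a)%:R.

Lemma cylinder_indicator_depends L (a : {ffun L -> bool}) :
  depends_on L (cylinder_indicator a).
Proof. by move=> eta xi /restr_agree e; rewrite /cylinder_indicator e. Qed.

Lemma exclusion_gen_expansion L g eta : depends_on L g ->
  exclusion_gen p g eta = \sum_(a : {ffun L -> bool})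
    g (extend a) * exclusion_gen p (cylinder_indicator a) eta.
Proof.
move=> gL; rewrite /exclusion_gen.
rewrite -(rsum_lin _ (fun a : {ffun L -> bool} => g (extend a))
  (fun a => (exclusion_term_summable kp eta (@cylinder_indicator_depends _ a)).1)).2.
congr rsum; apply/funext => -[x y] /=.
rewrite (local_expansion (exchange x y eta) gL) (local_expansion eta gL) -sumrB mulr_sumr.
by apply: eq_bigr => a _; rewrite -mulrBr mulrCA.
Qed.

Variable P : R -> R.-pker config d ~> config d.
Hypothesis sep : symmetric_exclusion p P.

Let FP : feller P. Proof. by case: sep. Qed.

(* Functions of the sites of [L] form a finite-dimensional space, so the
   derivative of the semigroup at 0 is uniform on its bounded subsets. *)
Lemma generates_uniform L (C e : R) : 0 < e -> exists2 h0 : R, 0 < h0 &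
  forall h, 0 <= h -> h < h0 -> forall g, depends_on L g ->
    (forall eta, `|g eta| <= C) -> forall eta,
    `|semigroup P h g eta - g eta - h * exclusion_gen p g eta| <= h * e.
Proof.
move=> e0; pose N : R := #|{ffun L -> bool}|%:R.
have N0 : 0 < N by rewrite ltr0n card_ffun card_bool expn_gt0.
have C0 : 0 < `|C| + 1 by rewrite ltr_wpDl.
pose e' := e / (N * (`|C| + 1)).
have e'0 : 0 < e' by rewrite divr_gt0// mulr_gt0.
have : \forall h \near (0 : R)^'+, forall a : {ffun L -> bool}, forall eta,
   `|(semigroup P h (cylinder_indicator a) eta - cylinder_indicator a eta) / h -
      exclusion_gen p (cylinder_indicator a) eta| <= e'.
  apply: filter_forall => a; case: sep => _; apply => //.
  by exists L => eta xi; exact: cylinder_indicator_depends.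
rewrite /at_right /within/= => /nbhs_ballP[h0 h00 hh0].
exists h0 => // h hge0 hlt g gL gC eta.
have bc (a : {ffun L -> bool}) := local_bmeas (@cylinder_indicator_depends _ a).
have -> : semigroup P h g eta = \sum_(a : {ffun L -> bool})
    g (extend a) * semigroup P h (cylinder_indicator a) eta.
  rewrite (_ : g = fun xi => \sum_(a : {ffun L -> bool}) g (extend a) * cylinder_indicator a xi); last first.
    by apply/funext => xi; exact: local_expansion.
  rewrite semigroup_sum => [|a]; last exact: bmeasZ.
  apply: eq_bigr => a _; rewrite semigroupZ//; congr (_ * _).
  by rewrite -local_expansion.
(* The derivative at 0 only concerns [h > 0]; at [h = 0] both sides vanish. *)
move: hge0; rewrite le_eqVlt => /predU1P[<-|hgt0].
  under eq_bigr do rewrite semigroup0//.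
  by rewrite -(local_expansion eta gL) !mul0r subrr subr0 normr0.
rewrite (exclusion_gen_expansion eta gL) (local_expansion eta gL).
rewrite mulr_sumr -!sumrB.
have -> : h * e = \sum_(a : {ffun L -> bool}) (`|C| + 1) * (h * e').
  rewrite sumr_const -[LHS]mulr1 -[X in _ = X *+ _]mulr1 -mulr_natr -/N /e'.
  by field; rewrite !gt_eqF.
rewrite (le_trans (ler_norm_sum _ _ _))// ler_sum// => a _.
rewrite [h * (_ * _)]mulrCA -!mulrBr normrM ler_pM//.
  by rewrite (le_trans (gC _))// (le_trans (ler_norm _))// lerDl.
set s1 := semigroup _ _ _ _; set s2 := _%:R; set s3 := exclusion_gen _ _ _.
rewrite (_ : s1 - s2 - h * s3 = h * ((s1 - s2) / h - s3)); last first.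
  by field; rewrite gt_eqF.
rewrite normrM gtr0_norm// ler_wpM2l ?(ltW hgt0)//.
have hb : ball 0 h0 h by rewrite /ball/= sub0r normrN gtr0_norm.
exact: (hh0 h hb hgt0 a eta).
Qed.

End uniform_generator.

(** * Boxes with small leakage *)

Section box_choice.
Context {R : realType} {d : nat} (p : site d -> site d -> R).
Hypothesis kp : exclusion_kernel p.
Implicit Types (x y : site d) (A B L : {fset site d}).

Lemma kill_rate_le1 L x : kill_rate p L x <= 1.
Proof.
rewrite gerBl sumr_ge0// => y _; exact: (exclusion_kernel_ge0 kp).
Qed.

Lemma kill_rate_sub A L x : {subset A <= L} -> kill_rate p L x <= kill_rate p A x.
Proof.
move=> AL; rewrite lerB// (sum_split_sub (p x) (fset_uniq A) (fset_uniq L) AL).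
by rewrite lerDl sumr_ge0// => y _; exact: (exclusion_kernel_ge0 kp).
Qed.

Lemma kill_rate_small x (e : R) : 0 < e -> exists A, kill_rate p A x <= e.
Proof.
move=> e0.
have fE : (\esum_(y in [set: site d]) (p x y)%:E)%E \is a fin_num.
  by rewrite (exclusion_kernel_sum1 kp).
have [_ [F [finF _] <-]] := ub_ereal_sup_adherent e0 fE.
rewrite -/(esum _ _) (exclusion_kernel_sum1 kp) fsbig_finite//= sumEFin -EFinB lte_fin => h.
by exists (fset_set F); rewrite /kill_rate; lra.
Qed.

Lemma kill_rate_small_on B (e : R) : 0 < e ->
  exists A, {subset B <= A} /\ forall x, x \in B -> kill_rate p A x <= e.
Proof.
move=> e0; have /choice[F hF] x : exists A, kill_rate p A x <= e.
  exact: kill_rate_small.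
exists (B `|` \bigcup_(x <- B) F x)%fset; split=> x xB; first by rewrite inE xB.
apply: le_trans (hF x); apply: kill_rate_sub => y yF; rewrite inE.
by apply/orP; right; apply/bigfcupP; exists x => //; rewrite xB.
Qed.

(** A finite [F] carries all of [Psi] but a small tail, and [L] is then so large that kill rates are
    small on [F]; on the tail, kill rates at most one are enough. *)
Lemma box_exists B (Psi : site d -> R) (e : R) : (forall x, 0 <= Psi x) ->
  abs_summable Psi -> 0 < e -> exists L, {subset B <= L} /\
    \sum_(x <- L) kill_rate p L x * Psi x <= e.
Proof.
move=> Psi0 sP e0; have [K PK] := sP.
have K0 : 0 <= K by have := PK [::] isT; rewrite big_nil.
have e20 : 0 < e / 2 by rewrite divr_gt0.
(* The sums over [F] and over [L] are both within [e / 4] of the full sum, so the part in between is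
   at most [e / 2]. *)
have [r0 hr0] := esum_approx Psi0 sP (e := e / 4) (divr_gt0 e0 (ltr0n _ 4)).
pose F := (B `|` [fset x in r0])%fset.
have e3 : 0 < e / 2 / (K + 1) by rewrite divr_gt0// ltr_wpDl.
have [L [FL hL]] := kill_rate_small_on F e3.
exists L; split; first by move=> x xB; apply: FL; rewrite inE xB.
rewrite (sum_split_sub _ (fset_uniq F) (fset_uniq L) FL) (splitr e); apply: lerD.
  apply: (@le_trans _ _ (\sum_(x <- F) e / 2 / (K + 1) * Psi x)).
    by rewrite !big_seq ler_sum// => x xF; rewrite ler_wpM2r// hL.
  rewrite -mulr_sumr mulrAC ler_pdivrMr ?ltr_wpDl// ler_wpM2l ?(ltW e20)//.
  rewrite (le_trans _ (_ : K <= K + 1)) ?lerDl//.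
  apply: le_trans (PK F (fset_uniq F)); apply: ler_sum => x _; exact: ler_norm.
apply: (@le_trans _ _ (\sum_(x <- L | x \notin F) Psi x)).
  by apply: ler_sum => x _; rewrite ler_piMl// kill_rate_le1.
have rF : {subset r0 <= F} by move=> x xr; rewrite !inE xr orbT.
have rL : {subset r0 <= L} by move=> x /rF /FL.
have := hr0 _ (fset_uniq F) rF; have := hr0 _ (fset_uniq L) rL.
rewrite (sum_split_sub _ (fset_uniq F) (fset_uniq L) FL) !ler_norml.
by lra.
Qed.

End box_choice.

(** * Oscillations along the iterated scheme *)

Section euler_scheme.
Context {R : realType} {d : nat} (p : site d -> site d -> R).
Hypothesis kp : exclusion_kernel p.
Variable P : R -> R.-pker config d ~> config d.
Hypothesis sep : symmetric_exclusion p P.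
Implicit Types (x y : site d) (eta xi : config d) (g : config d -> R)
  (A B L : {fset site d}) (h t : R).

Let p_ge0 x y : 0 <= p x y. Proof. exact: (exclusion_kernel_ge0 kp). Qed.
Let FP : feller P. Proof. by case: sep. Qed.

(** Pascal's rule, read as one more factor [1 + u * shift] acting on the sequence [q]. *)
Lemma sum_binS (q : nat -> R) (u : R) k :
  \sum_(m < k.+2) 'C(k.+1, m)%:R * u ^+ m * q m =
  \sum_(m < k.+1) 'C(k, m)%:R * u ^+ m * q m +
  u * \sum_(m < k.+1) 'C(k, m)%:R * u ^+ m * q m.+1.
Proof.
rewrite big_ord_recl bin0 /=.
under eq_bigr => m _ do rewrite /bump add1n binS natrD !mulrDl.
rewrite big_split/= addrA mulr_sumr; congr (_ + _); last first.
  by apply: eq_bigr => m _; rewrite exprS; ring.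
transitivity (\sum_(m < k.+2) 'C(k, m)%:R * u ^+ m * q m).
  by rewrite [RHS]big_ord_recl bin0.
by rewrite big_ord_recr/= bin_small// !mul0r addr0.
Qed.

Lemma bin_fact_le_expn k m : ('C(k, m) * m`! <= k ^ m)%N.
Proof.
rewrite bin_ffact; elim: m => [|m IH]; first by rewrite ffactn0.
by rewrite ffactnSr expnSr leq_mul// leq_subr.
Qed.

(** The exponentials agree exactly; the rest is that a falling factorial of [k] is at most
    [k ^ m]. *)
Lemma binomial_le_poisson k m h : 0 <= h ->
  expR (- (2 * h)) ^+ k * ('C(k, m)%:R * (2 * h) ^+ m) <=
  poisson_weight (2 * (h * k%:R)) m.
Proof.
move=> h0; rewrite /poisson_weight -mulrA -expRM_natl.
rewrite (_ : k%:R * - (2 * h) = - (2 * (h * k%:R))); last by ring.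
rewrite ler_wpM2l ?expR_ge0// ler_pdivlMr ?ltr0n ?fact_gt0//.
rewrite mulrAC -natrM (_ : 2 * (h * k%:R) = k%:R * (2 * h)); last by ring.
rewrite [leRHS]exprMn ler_wpM2r ?exprn_ge0 ?mulr_ge0// -natrX ler_nat.
exact: bin_fact_le_expn.
Qed.

(** Exchanges across the boundary, dropped from the box, and killings, added to it, have the same
    bound. *)
Lemma exclusion_gen_killed_dist L g eta : depends_on L g ->
  `|exclusion_gen p g eta - killed_gen p L g eta| <=
  4 * \sum_(x <- L) kill_rate p L x * oscillation g x.
Proof.
move=> gL; have bg := bmeas_bounded (local_bmeas gL).
have [_ /(_ L (fun x xL => xL))] := exclusion_term_summable kp eta gL.
set S := \sum_(x <- L) \sum_(y <- L) _ => h1.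
have h2 : `|2 * \sum_(x <- L) kill_rate p L x * (g (set_at x false eta) - g eta)| <=
    2 * \sum_(x <- L) kill_rate p L x * oscillation g x.
  rewrite normrM ger0_norm// ler_wpM2l//.
  rewrite (le_trans (ler_norm_sum _ _ _))// ler_sum// => x _.
  rewrite normrM ger0_norm ?kill_rate_ge0// ler_wpM2l ?kill_rate_ge0//.
  exact: set_at_diff_le.
rewrite /killed_gen -/S opprD addrA (le_trans (ler_normB _ _))//.
by have := lerD h1 h2; lra.
Qed.

Lemma heat_sum_le1 t (r : seq (site d)) y : 0 <= t -> uniq r ->
  \sum_(x <- r) heat_kernel p t x y <= 1.
Proof.
move=> t0 ur; under eq_bigr do rewrite (heat_sym kp).
rewrite -lee_fin -(heat_row kp y t0) -sumEFin.
apply: (le_sum_esum (a := fun x => (heat_kernel p t y x)%:E)) => // x.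
by rewrite lee_fin (heat_ge0 kp).
Qed.

Section scheme.
Variables (B L : {fset site d}) (g : config d -> R) (h : R).
Hypotheses (BL : {subset B <= L}) (gB : depends_on B g).
Hypotheses (h0 : 0 <= h) (hL : h * killed_rate p L <= 1).

Definition scheme k := iter k (killed_step p L h) g.

Lemma scheme_depends k : depends_on L (scheme k).
Proof.
elim: k => [|k IH]; first exact: depends_onW BL gB.
exact: killed_step_depends.
Qed.

Lemma scheme_norm_le k (C : R) : (forall eta, `|g eta| <= C) ->
  forall eta, `|scheme k eta| <= C.
Proof.
move=> gC; elim: k => // k IH eta.
exact: (killed_step_norm_le kp IH h0 hL).
Qed.

(** The [m]-th power of [p] applied to the oscillations of [g], which vanish outside [B]. *)
Definition nstep_sum m x := \sum_(j <- B) nstep p m x j * oscillation g j.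

Let bg : bounded g. Proof. exact/bmeas_bounded/(local_bmeas gB). Qed.

Lemma nstep_sum0 x : oscillation g x <= nstep_sum 0 x.
Proof.
have [xB|xB] := boolP (x \in B).
  rewrite /nstep_sum (bigD1_seq x xB (fset_uniq _))/= eqxx mul1r lerDl sumr_ge0//.
  by move=> j _; rewrite mulr_ge0// osc_ge0.
rewrite (osc_notin gB xB) sumr_ge0// => j _.
by rewrite mulr_ge0 ?osc_ge0// (nstep_ge0 kp).
Qed.

Lemma nstep_sumS m x :
  \sum_(y <- L) p x y * nstep_sum m y <= nstep_sum m.+1 x.
Proof.
under eq_bigr do rewrite mulr_sumr.
rewrite exchange_big/=; apply: ler_sum => j _.
under eq_bigr do rewrite mulrA.
by rewrite -mulr_suml ler_wpM2r ?osc_ge0// nstep_sum_le.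
Qed.

(** Iterating the one-step bound applies [expR (- (2 * h)) ^+ k * (1 + 2 * h * p) ^ k] to the
    oscillations of [g], expanded here by the binomial formula. *)
Lemma osc_scheme_binomial k x : oscillation (scheme k) x <=
  expR (- (2 * h)) ^+ k *
  \sum_(m < k.+1) 'C(k, m)%:R * (2 * h) ^+ m * nstep_sum m x.
Proof.
elim: k x => [|k IH] x.
  by rewrite big_ord1 bin0 !expr0 !mul1r nstep_sum0.
apply: le_trans (osc_killed_step kp x (scheme_depends k) h0 hL) _.
have /= -> := sum_binS (nstep_sum^~ x) (2 * h) k.
rewrite exprS -[leRHS]mulrA ler_wpM2l ?expR_ge0// mulrDr; apply: lerD => //.
rewrite mulrCA ler_wpM2l ?mulr_ge0//.
set E := expR _ ^+ k in IH *; have E0 : 0 <= E by rewrite exprn_ge0// expR_ge0.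
apply: (@le_trans _ _ (\sum_(y <- L) p x y * (E *
    \sum_(m < k.+1) 'C(k, m)%:R * (2 * h) ^+ m * nstep_sum m y))).
  by apply: ler_sum => y _; rewrite ler_wpM2l.
under [leLHS]eq_bigr do rewrite mulrCA mulr_sumr.
rewrite -mulr_sumr ler_wpM2l// exchange_big/=; apply: ler_sum => m _.
under [leLHS]eq_bigr do rewrite mulrCA.
by rewrite -mulr_sumr ler_wpM2l ?mulr_ge0 ?exprn_ge0 ?mulr_ge0// nstep_sumS.
Qed.

Lemma osc_scheme_poisson k x : oscillation (scheme k) x <=
  \sum_(m < k.+1) poisson_weight (2 * (h * k%:R)) m * nstep_sum m x.
Proof.
apply: le_trans (osc_scheme_binomial k x) _.
rewrite mulr_sumr; apply: ler_sum => m _; rewrite mulrA ler_wpM2r//.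
  by rewrite sumr_ge0// => j _; rewrite mulr_ge0 ?osc_ge0// (nstep_ge0 kp).
exact: binomial_le_poisson.
Qed.

Lemma poisson_nstep_sum_le t k x : 0 <= t ->
  \sum_(m < k.+1) poisson_weight t m * nstep_sum m x <=
  \sum_(j <- B) heat_kernel p t x j * oscillation g j.
Proof.
move=> t0; under eq_bigr do rewrite mulr_sumr.
rewrite exchange_big/=; apply: ler_sum => j _.
under eq_bigr do rewrite mulrA.
by rewrite -mulr_suml ler_wpM2r ?osc_ge0// heat_sum_ge.
Qed.

Lemma osc_scheme k x : oscillation (scheme k) x <=
  \sum_(j <- B) heat_kernel p (2 * (h * k%:R)) x j * oscillation g j.
Proof.
apply: le_trans (osc_scheme_poisson k x) _.
by apply: poisson_nstep_sum_le; rewrite !mulr_ge0.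
Qed.

(** The right-hand side is free of [L], [h] and [k], which allows [L] to be chosen before [h]. The
    price [expR (2 * t)] comes from comparing Poisson weights at an earlier time with those at
    [2 * t]. *)
Lemma osc_scheme_unif t k x : h * k%:R <= t -> oscillation (scheme k) x <=
  expR (2 * t) * \sum_(j <- B) heat_kernel p (2 * t) x j * oscillation g j.
Proof.
move=> hkt; have hk0 : 0 <= h * k%:R by rewrite mulr_ge0.
have t0 := le_trans hk0 hkt.
apply: le_trans (osc_scheme_poisson k x) _.
rewrite -ler_pdivrMl ?expR_gt0//.
apply: le_trans (poisson_nstep_sum_le k x (_ : 0 <= 2 * t)); last by rewrite mulr_ge0.
rewrite mulr_sumr; apply: ler_sum => m _; rewrite [leLHS]mulrA ler_wpM2r//.
  by rewrite sumr_ge0// => j _; rewrite mulr_ge0 ?osc_ge0// (nstep_ge0 kp).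
rewrite /poisson_weight -expRN [leLHS]mulrA ler_wpM2r ?invr_ge0// [leLHS]mulrA.
rewrite ler_pM ?exprn_ge0 ?mulr_ge0 ?expR_ge0//.
  by rewrite ler_piMr ?expR_ge0// -[leRHS]expR0 ler_expR; lra.
by rewrite lerXn2r ?nnegrE ?mulr_ge0// ler_wpM2l.
Qed.

End scheme.

End euler_scheme.

(** * Decay of oscillations *)

Section oscillation_decay.
Context {R : realType} {d : nat} (p : site d -> site d -> R).
Hypothesis kp : exclusion_kernel p.
Variable P : R -> R.-pker config d ~> config d.
Hypothesis sep : symmetric_exclusion p P.
Implicit Types (x y : site d) (eta xi : config d) (f g : config d -> R)
  (A B L : {fset site d}) (h t : R).

Let FP : feller P. Proof. by case: sep. Qed.
Local Notation H := (heat_kernel p).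

Lemma small_step (t a : R) : 0 <= t -> 0 < a ->
  exists n : nat, t / n.+1%:R < a.
Proof.
move=> t0 a0; exists (Num.bound (t / a)).
rewrite ltr_pdivrMr ?ltr0n// mulrC -ltr_pdivrMr//.
apply: lt_le_trans (archi_boundP _) _; first by rewrite divr_ge0// ltW.
by rewrite ler_nat.
Qed.

(** The witness [v] is the last iterate. Each step costs at most [h * e'] and old errors do not
    grow, so the total is at most [t * e']. The last conjunct is meant for product measures. *)
Lemma euler_approximation B g (C t e : R) : depends_on B g ->
  (forall eta, `|g eta| <= C) -> 0 <= t -> 0 < e ->
  exists A v, [/\ depends_on A v,
    forall eta, `|semigroup P t g eta - v eta| <= e,
    forall i, oscillation v i <= \sum_(j <- B) H (2 * t) i j * oscillation g j &
    forall nu : probability (config d) R,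
      (forall A' f x y, depends_on A' f ->
         \int[nu]_eta f (exchange x y eta) = \int[nu]_eta f eta) ->
      `|\int[nu]_eta v eta - \int[nu]_eta g eta| <= e].
Proof.
move=> gB gC t0 e0; have bg := bmeas_bounded (local_bmeas gB).
have C0 : 0 <= C := le_trans (normr_ge0 _) (gC point).
have t20 : 0 <= 2 * t by rewrite mulr_ge0.
(* Error allowed per unit of time; the [+ 1] covers [t = 0]. *)
pose e' := e / (t + 1); have e'0 : 0 < e' by rewrite divr_gt0// ltr_wpDl.
pose Psi x := expR (2 * t) * \sum_(j <- B) H (2 * t) x j * oscillation g j.
have Psi0 x : 0 <= Psi x.
  rewrite mulr_ge0 ?expR_ge0// sumr_ge0// => j _.
  by rewrite mulr_ge0 ?(heat_ge0 kp)// osc_ge0.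
have sPsi : abs_summable Psi.
  exists (expR (2 * t) * \sum_(j <- B) oscillation g j) => r ur.
  under eq_bigr do rewrite ger0_norm//.
  rewrite -mulr_sumr ler_wpM2l ?expR_ge0// exchange_big/=; apply: ler_sum => j _.
  by rewrite -mulr_suml ler_piMl ?osc_ge0// (heat_sum_le1 kp).
(* Sixteenths, because [exclusion_gen_killed_dist] has a factor 4 and its share of the error is
   [e' / 4]. *)
have [L [BL hPsi]] := box_exists kp B Psi0 sPsi (divr_gt0 e'0 (ltr0n _ 16)).
have [h0 h00 hgen] := generates_uniform kp sep L C (divr_gt0 e'0 (ltr0n _ 4)).
pose rho := killed_rate p L; have rho0 : 0 <= rho := killed_rate_ge0 kp L.
pose K := 4 * (1 + rho) * C.
have K0 : 0 <= K by rewrite !mulr_ge0// addr_ge0.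
(* The four constraints on the step: uniform differentiability on [L], [h <= 1], positivity, and
   consistency error at most [e' / 4] per unit of time. *)
pose a := Num.min (Num.min h0 1) (Num.min (rho + 1)^-1 (e' / 4 / (K + 1))).
have a0 : 0 < a.
  have r1 : 0 < rho + 1 by rewrite ltr_wpDl.
  have K1 : 0 < K + 1 by rewrite ltr_wpDl.
  by rewrite !lt_min h00 ltr01 invr_gt0 r1/= divr_gt0// divr_gt0.
have [n] := small_step t0 a0; set h := t / n.+1%:R.
rewrite !lt_min => /andP[/andP[hh0 h1] /andP[hrho hK]].
have hge0 : 0 <= h by rewrite divr_ge0.
have hL : h * rho <= 1.
  move: hrho; rewrite -[_^-1]mul1r ltr_pdivlMr ?ltr_wpDl// => /ltW.
  by apply: le_trans; rewrite ler_wpM2l// lerDl.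
have {}hK : h * K <= e' / 4.
  move: hK; rewrite ltr_pdivlMr ?ltr_wpDl// => /ltW.
  by apply: le_trans; rewrite ler_wpM2l// lerDl.
have hn : h * n.+1%:R = t by rewrite divfK// pnatr_eq0.
pose s k := scheme p L g h k.
have sL k : depends_on L (s k) by exact: (scheme_depends p h BL gB).
have sb k : bmeas (s k) := local_bmeas (sL k).
have sC k eta : `|s k eta| <= C by exact: (scheme_norm_le kp hge0 hL k gC).
have kill_small k : (k <= n.+1)%N ->
    \sum_(x <- L) kill_rate p L x * oscillation (s k) x <= e' / 16.
  move=> kn; have kt : h * k%:R <= t by rewrite -hn ler_wpM2l// ler_nat.
  apply: le_trans hPsi; apply: ler_sum => x _; rewrite ler_wpM2l ?kill_rate_ge0//.
  exact: (osc_scheme_unif kp BL gB hge0 hL x kt).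
have gen_step k eta : (k <= n.+1)%N ->
    `|s k.+1 eta - s k eta - h * exclusion_gen p (s k) eta| <= h * (e' / 2).
  move=> kn; have E1 := exclusion_gen_killed_dist kp eta (sL k).
  have E2 := killed_step_consistent kp L eta (sC k) hge0 (ltW h1).
  rewrite -/rho -/K in E2.
  have E3 := kill_small k kn.
  have E4 : `|exclusion_gen p (s k) eta - killed_gen p L (s k) eta| <= e' / 4 by lra.
  have E5 := ler_wpM2l hge0 E4; have E6 := ler_wpM2l hge0 hK.
  rewrite -/(s k) in E2; rewrite -[s k.+1 eta]/(killed_step p L h (s k) eta).
  set u := killed_step _ _ _ _ _ in E2 *; set w := s k eta in E2 *.
  set G := killed_gen _ _ _ _ in E2 E5 *; set G' := exclusion_gen _ _ _ in E5 *.
  rewrite (_ : u - w - h * G' = (u - w - h * G) - h * (G' - G)); last by ring.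
  rewrite (le_trans (ler_normB _ _))// normrM ger0_norm//.
  by lra.
have dist k eta : (k <= n.+1)%N ->
    `|semigroup P (h * k%:R) g eta - s k eta| <= h * k%:R * e'.
  elim: k eta => [|k IH] eta kn.
    by rewrite mulr0 mul0r semigroup0 ?subrr ?normr0//; exact: local_bmeas gB.
  have bS := semigroup_bmeas P (h * k%:R) (local_bmeas gB).
  have -> : h * k.+1%:R = h + h * k%:R by rewrite -natr1 mulrDr mulr1 addrC.
  rewrite semigroup_add ?mulr_ge0//; last exact: local_bmeas gB.
  (* The new step is outermost: the old error passes through the contraction [semigroup P h], and
     the generator meets only the local iterate [s k]. *)
  have E1 : `|semigroup P h (semigroup P (h * k%:R) g) eta - semigroup P h (s k) eta|
      <= h * k%:R * e'.
    rewrite -semigroupB//; apply: semigroup_norm_le; first exact: bmeasB.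
    by move=> xi; apply: IH; exact: ltnW.
  have E2 := hgen h hge0 hh0 (s k) (sL k) (sC k) eta.
  have E3 := gen_step k eta (ltnW kn).
  move: E1 E2 E3; set S1 := semigroup _ _ (semigroup _ _ _) _.
  set S2 := semigroup _ _ _ _; set G := h * exclusion_gen _ _ _.
  set w := s k eta; set u := s k.+1 eta => E1 E2 E3.
  rewrite (_ : S1 - u = (S1 - S2) + ((S2 - w - G) - (u - w - G))); last by ring.
  have := ler_normD (S1 - S2) ((S2 - w - G) - (u - w - G)).
  have := ler_normB (S2 - w - G) (u - w - G).
  have : 0 <= h * e' by rewrite mulr_ge0// ltW.
  by lra.
have te' : t * e' <= e.
  by rewrite mulrCA ler_piMr ?(ltW e0)// ler_pdivrMr ?ltr_wpDl// mul1r lerDl.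
exists L, (s n.+1); split=> // [eta|i|nu inv].
- by have := dist n.+1 eta (leqnn _); rewrite hn => /le_trans; apply.
- by have := osc_scheme kp BL gB hge0 hL n.+1 i; rewrite hn.
- suff dk k : (k <= n.+1)%N ->
      `|\int[nu]_eta s k eta - \int[nu]_eta g eta| <= h * k%:R * e'.
    by have := dk n.+1 (leqnn _); rewrite hn => /le_trans; apply.
  elim: k => [_|k IH kn]; first by rewrite subrr normr0 mulr0 mul0r.
  have bkg := local_bmeas (killed_gen_depends p (sL k)).
  (* Exchange terms integrate to zero by invariance; only the killing terms remain, of size at most
     [2 * (e' / 16)]. *)
  have K1 : \int[nu]_eta killed_gen p L (s k) eta =
      2 * \int[nu]_eta \sum_(x <- L) kill_rate p L x * (s k (set_at x false eta) - s k eta).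
    have bex x y : bmeas (fun eta => s k (exchange x y eta) - s k eta).
      exact: bmeasB (bmeas_comp (exchange_measurable x y) (sb k)) (sb k).
    have bset x : bmeas (fun eta => s k (set_at x false eta) - s k eta).
      exact: bmeasB (bmeas_comp (set_at_measurable x false) (sb k)) (sb k).
    rewrite bmeas_intD; first last.
    - by apply: bmeasZ; apply: bmeas_sum => x; exact: bmeasZ.
    - by apply: bmeas_sum => x; apply: bmeas_sum => y; exact: bmeasZ.
    rewrite bmeas_intZ; last by apply: bmeas_sum => x; exact: bmeasZ.
    rewrite bmeas_int_sum => [|x]; last by apply: bmeas_sum => y; exact: bmeasZ.
    rewrite big1 ?add0r// => x _.
    rewrite bmeas_int_sum => [|y]; last exact: bmeasZ.
    rewrite big1// => y _; rewrite bmeas_intZ// bmeas_intB//; last first.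
      exact: bmeas_comp (exchange_measurable x y) (sb k).
    by rewrite (inv L)// subrr mulr0.
  have K2 : `|\int[nu]_eta killed_gen p L (s k) eta| <= e' / 8.
    rewrite K1 normrM ger0_norm//.
    have : `|\int[nu]_eta \sum_(x <- L) kill_rate p L x *
        (s k (set_at x false eta) - s k eta)| <= e' / 16.
      apply: bmeas_norm_int_le => [|eta].
        apply: bmeas_sum => x; apply: bmeasZ.
        exact: bmeasB (bmeas_comp (set_at_measurable x false) (sb k)) (sb k).
      apply: le_trans (kill_small k (ltnW kn)).
      rewrite (le_trans (ler_norm_sum _ _ _))// ler_sum// => x _.
      rewrite normrM ger0_norm ?kill_rate_ge0// ler_wpM2l ?kill_rate_ge0//.
      by apply: set_at_diff_le; exact: bmeas_bounded.
    by lra.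
  have K3 : `|\int[nu]_eta (s k.+1 eta - s k eta - h * killed_gen p L (s k) eta)| <=
      h * (e' / 4).
    apply: bmeas_norm_int_le => [|eta].
      by apply: bmeasB; [exact: bmeasB|exact: bmeasZ].
    apply: le_trans (ler_wpM2l hge0 hK).
    exact: (killed_step_consistent kp L eta (sC k) hge0 (ltW h1)).
  rewrite bmeas_intB in K3; [|exact: bmeasB|exact: bmeasZ].
  rewrite bmeas_intB// bmeas_intZ// in K3.
  have := ler_wpM2l hge0 K2; rewrite -[X in X * `|_|](ger0_norm hge0) -normrM.
  have := IH (ltnW kn); move: K3; set G := h * _.
  set u := \int[nu]_eta s k.+1 eta; set w := \int[nu]_eta s k eta.
  set v := \int[nu]_eta g eta => K3 K4 K5.
  rewrite (_ : u - v = (u - w - G) + ((w - v) + G)); last by ring.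
  rewrite (le_trans (ler_normD _ _))// -natr1 mulrDr mulr1 mulrDl.
  have := ler_normD (w - v) G.
  have : h * (e' / 4) + h * (e' / 8) <= h * e' by rewrite -mulrDr ler_wpM2l//; lra.
  by lra.
Qed.

End oscillation_decay.

(** * Oscillation norms of the evolved function *)

Section oscillation_norms.
Context {R : realType} {d : nat}.
Implicit Types (f : config d -> R).

Lemma oscillation_norm1 f : bounded f ->
  (oscillation_norm 1 f = \esum_(i in [set: site d]) (oscillation f i)%:E)%E.
Proof.
move=> bf; rewrite /oscillation_norm invr1 poweRe1; last first.
  by apply: esum_ge0 => i _; rewrite lee_fin powR_ge0.
by apply: eq_esum => i _; rewrite powRr1// osc_ge0.
Qed.

Lemma oscillation_norm2_sqr f : bounded f ->
  (oscillation_norm 2 f ^+ 2 =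
   \esum_(i in [set: site d]) (oscillation f i ^+ 2)%:E)%E.
Proof.
move=> bf; rewrite /oscillation_norm.
under eq_esum do rewrite (powR_mulrn 2) ?osc_ge0//.
have : (0 <= \esum_(i in [set: site d]) (oscillation f i ^+ 2)%:E)%E.
  by apply: esum_ge0 => i _; rewrite lee_fin sqr_ge0.
case: (\esum_(i in _) _)%E => [r|_|//].
  rewrite lee_fin => r0; rewrite poweR_EFin -EFin_expe; congr EFin.
  by rewrite -powR_mulrn ?powR_ge0// -powRrM mulVf// powRr1.
by rewrite poweRyr ?invr_neq0// expe2.
Qed.

End oscillation_norms.

Section semigroup_oscillations.
Context {R : realType} {d : nat} (p : site d -> site d -> R).
Hypothesis kp : exclusion_kernel p.
Variable P : R -> R.-pker config d ~> config d.
Hypothesis sep : symmetric_exclusion p P.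
Implicit Types (eta xi : config d) (f g : config d -> R) (t : R).

Local Notation H := (heat_kernel p).

Lemma local_semigroup_flip (B : {fset site d}) g t i eta : depends_on B g -> 0 <= t ->
  semigroup P t g (flip i eta) - semigroup P t g eta <=
  \sum_(j <- B) H (2 * t) i j * oscillation g j.
Proof.
move=> gB t0; have [C gC] := bmeas_bounded (local_bmeas gB).
apply/ler_addgt0Pr => e e0.
have [A [v [vA Sv ov _]]] := euler_approximation kp sep gB gC t0 (divr_gt0 e0 (ltr0n _ 2)).
have := osc_ub i eta (bmeas_bounded (local_bmeas vA)).
have := ov i; have := Sv eta; have := Sv (flip i eta); rewrite !ler_norml.
by lra.
Qed.

(** A finite set [s] carries all but [e'] of the mass of [H (2 * t) i]. There the local approximant
    oscillates no more than [f]; elsewhere the crude bound [2 * C] costs at most [2 * C * e']. *)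
Lemma EFin_osc_semigroup_le f t i : bmeas f -> 0 <= t ->
  ((oscillation (semigroup P t f) i)%:E <=
   \esum_(j in [set: site d]) (H (2 * t) i j * oscillation f j)%:E)%E.
Proof.
move=> bf t0; have bbf := bmeas_bounded bf; have [C fC] := bbf.
have C0 : 0 <= C := le_trans (normr_ge0 _) (fC point).
have t20 : 0 <= 2 * t by rewrite mulr_ge0.
have H0 j : 0 <= H (2 * t) i j by exact: (heat_ge0 kp).
have h0 j : (0 <= (H (2 * t) i j * oscillation f j)%:E)%E.
  by rewrite lee_fin mulr_ge0// osc_ge0.
have sum1 r : uniq r -> \sum_(j <- r) H (2 * t) i j <= 1.
  by move=> ur; under eq_bigr do rewrite (heat_sym kp); exact: heat_sum_le1.
have fE : (\esum_(j in [set: site d]) (H (2 * t) i j * oscillation f j)%:E)%E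
    \is a fin_num.
  apply: (@fin_num_esum _ _ _ (2 * C)) => //; apply: esum_le => r ur.
  rewrite sumEFin lee_fin.
  apply: (@le_trans _ _ (\sum_(j <- r) H (2 * t) i j * (2 * C))).
    by apply: ler_sum => j _; rewrite ler_wpM2l// osc_le_bound.
  by rewrite -mulr_suml ler_piMl ?mulr_ge0// sum1.
rewrite -(fineK fE) lee_fin; apply: osc_le => eta; apply/ler_addgt0Pr => e e0.
(* Two L1 errors [e'], at [eta] and at [flip i eta], and [2 * C * e'] from the sites outside [s]. *)
pose e' := e / (2 * C + 2).
have C20 : 0 < 2 * C + 2 by rewrite ltr_wpDl// mulr_ge0.
have e'0 : 0 < e' by rewrite divr_gt0.
have sH : abs_summable (H (2 * t) i).
  by exists 1 => r ur; under eq_bigr do rewrite ger0_norm//; exact: sum1.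
have [s hs] := esum_approx H0 sH e'0.
have us := undup_uniq s.
have := hs _ us (fun j => etrans (mem_undup s j)).
rewrite (heat_row kp i t20) ler_norml => /andP[_] /= hs1.
pose m (b : bool) : probability (config d) R := law P t (if b then flip i eta else eta).
have [A [g [gA gC gs fg]]] := L1_local_osc (undup s) bf fC m e'0.
have bg := local_bmeas gA; have bbg := bmeas_bounded bg.
have D1 b : `|\int[m b]_xi f xi - \int[m b]_xi g xi| <= e'.
  exact: le_trans (bmeas_int_dist _ bf bg) (fg b).
have D2 := local_semigroup_flip i eta gA t0.
have D3 : \sum_(j <- A) H (2 * t) i j * oscillation g j <=
    fine (\esum_(j in [set: site d]) (H (2 * t) i j * oscillation f j)%:E) + 2 * C * e'.
  pose r := undup (undup s ++ A).
  have ur : uniq r := undup_uniq _.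
  have sr : {subset undup s <= r}.
    by move=> j js; rewrite mem_undup mem_cat js.
  have Ar : {subset A <= r} by move=> j jA; rewrite mem_undup mem_cat jA orbT.
  apply: (@le_trans _ _ (\sum_(j <- r) H (2 * t) i j * oscillation g j)).
    rewrite (sum_split_sub _ (fset_uniq A) ur Ar) lerDl sumr_ge0// => j _.
    by rewrite mulr_ge0// osc_ge0.
  rewrite (sum_split_sub _ us ur sr) lerD//.
    apply: (@le_trans _ _ (\sum_(j <- undup s) H (2 * t) i j * oscillation f j)).
      by rewrite !big_seq ler_sum// => j js; rewrite ler_wpM2l// gs.
    rewrite -lee_fin fineK// -sumEFin.
    exact: (le_sum_esum (a := fun j => (H (2 * t) i j * oscillation f j)%:E)).
  apply: (@le_trans _ _ (\sum_(j <- r | j \notin undup s) H (2 * t) i j * (2 * C))).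
    by apply: ler_sum => j _; rewrite ler_wpM2l// osc_le_bound.
  rewrite -mulr_suml mulrC ler_wpM2l ?mulr_ge0//.
  by have := sum1 r ur; rewrite (sum_split_sub _ us ur sr); lra.
have D1t : `|semigroup P t f (flip i eta) - semigroup P t g (flip i eta)| <= e'.
  exact: (D1 true).
have D1f : `|semigroup P t f eta - semigroup P t g eta| <= e' by exact: (D1 false).
move: D1t D1f; rewrite !ler_norml.
have : e' * (2 * C + 2) = e by rewrite divfK// gt_eqF.
by lra.
Qed.

Lemma oscillation_norm_semigroup f t : bmeas f -> 0 <= t ->
  (oscillation_norm 2 (semigroup P t f) ^+ 2 <=
   (H (2 * t) 0 0)%:E * oscillation_norm 1 f ^+ 2)%E.
Proof.
move=> bf t0; have bbf := bmeas_bounded bf.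
have bS := bmeas_bounded (semigroup_bmeas P t bf).
have t20 : 0 <= 2 * t by rewrite mulr_ge0.
rewrite oscillation_norm2_sqr// oscillation_norm1//.
have o0 i : (0 <= (oscillation f i)%:E)%E by rewrite lee_fin osc_ge0.
have H0 i j : (0 <= (H (2 * t) i j)%:E)%E by rewrite lee_fin (heat_ge0 kp).
have := esum_ge0 (fun i (_ : [set: site d] i) => o0 i).
case E : (\esum_(i in [set: site d]) (oscillation f i)%:E)%E => [K||] //; last first.
  by move=> _; rewrite expe2 mulyy gt0_muley ?leey// lte_fin heat_gt0.
rewrite lee_fin => K0; rewrite -EFin_expe -EFinM.
have vE i : (\esum_(j in [set: site d]) (H (2 * t) i j * oscillation f j)%:E <=
    (H (2 * t) 0 0 * K)%:E)%E.
  rewrite EFinM -E -esumZ ?heat_ge0//; apply: le_esum => j _.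
  by rewrite -EFinM lee_fin ler_wpM2r ?osc_ge0// heat_le_diag.
have HK0 : 0 <= H (2 * t) 0 0 * K by rewrite mulr_ge0// heat_ge0.
(* One factor of the square is bounded by its supremum; the other is summed over [i], where the
   columns of the heat kernel have mass one. *)
apply: (@le_trans _ _ (\esum_(i in [set: site d])
  ((H (2 * t) 0 0 * K)%:E *
   \esum_(j in [set: site d]) (H (2 * t) i j * oscillation f j)%:E))%E).
  apply: le_esum => i _; rewrite expr2 EFinM.
  have oS : (0 <= (oscillation (semigroup P t f) i)%:E)%E by rewrite lee_fin osc_ge0.
  have := EFin_osc_semigroup_le i bf t0 => h.
  by apply: lee_pmul => //; exact: le_trans h (vE i).
have Ho0 i j : (0 <= (H (2 * t) i j * oscillation f j)%:E)%E by rewrite EFinM mule_ge0.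
rewrite esumZ//; last by move=> i; exact: esum_ge0.
rewrite exchange_esum//.
rewrite (eq_esum (b := fun j => (oscillation f j)%:E)); last first.
  move=> j _; under eq_esum do rewrite EFinM muleC.
  rewrite esumZ ?osc_ge0//; under eq_esum do rewrite (heat_sym kp).
  by rewrite (heat_row kp)// mule1.
by rewrite E -EFinM -mulrA -expr2.
Qed.

End semigroup_oscillations.

(** * Concentration under GEMB *)

Section gamma_integral.
Context {R : realType}.
Local Notation leb := (@lebesgue_measure R).
Implicit Types (r y u : R).

Lemma powR_continuous_at r u : 0 < u -> {for u, continuous (fun x : R => x `^ r)}.
Proof.
move=> u0; apply: differentiable_continuous; apply/derivable1_diffP.
by apply: derivable_powR; rewrite in_itv/= u0.
Qed.

Lemma int_powR_away r a y : 0 < r -> 0 < a -> a < y ->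
  (\int[leb]_(u in `[a, y]) (r * u `^ (r - 1))%:E = (y `^ r - a `^ r)%:E)%E.
Proof.
move=> r0 a0 ay; have y0 := lt_trans a0 ay.
rewrite (@continuous_FTC2 _ _ (fun x => x `^ r))//.
- apply: continuous_in_subspaceT => u; rewrite inE/= in_itv/= => /andP[au _].
  apply: cvgM; first exact: cvg_cst.
  exact: powR_continuous_at (lt_le_trans a0 au).
- split.
  + move=> u; rewrite in_itv/= => /andP[au _]; apply: derivable_powR.
    by rewrite in_itv/= (lt_trans a0 au).
  + by apply: cvg_at_right_filter; exact: powR_continuous_at.
  + by apply: cvg_at_left_filter; exact: powR_continuous_at.
- move=> u; rewrite in_itv/= => /andP[au _].
  by rewrite powR_derive1// in_itv/= (lt_trans a0 au).
Qed.

Lemma measurable_gamma_powR r (D : set R) :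
  measurable_fun D (fun u => (r * u `^ (r - 1))%:E).
Proof.
apply/measurable_EFinP; apply: measurable_funM => //; apply: measurable_funTS.
exact: measurable_powR.
Qed.

(** For [r < 1] the integrand is unbounded at 0, so the fundamental theorem is used away from 0 and
    followed by monotone convergence. *)
Lemma int_powR r y : 0 < r -> 0 < y ->
  (\int[leb]_(u in `]0%R, y]) (r * u `^ (r - 1))%:E = (y `^ r)%:E)%E.
Proof.
(* With [n.+2] the left endpoint stays strictly below [y], also for [n = 0]. *)
move=> r0 y0; pose F n := `[y / n.+2%:R, y]%classic : set R.
have yn n : 0 < y / n.+2%:R by rewrite divr_gt0.
have yn1 n : y / n.+2%:R < y by rewrite ltr_pdivrMr// ltr_pMr// ltr1n.
have FE : `]0, y]%classic = \bigcup_n F n.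
  apply/seteqP; split=> u /=; rewrite in_itv/=.
    move=> /andP[u0 uy]; exists (Num.bound (y / u)) => //; rewrite /F/=.
    rewrite in_itv/= uy andbT ler_pdivrMr// mulrC -ler_pdivrMr//.
    apply: (@le_trans _ _ (Num.bound (y / u))%:R).
      by rewrite ltW// archi_boundP// divr_ge0// ltW.
    by rewrite ler_nat -addn2 leq_addr.
  by move=> [n _]; rewrite /F/= in_itv/= => /andP[nu ->]; rewrite (lt_le_trans _ nu).
have cv : (\int[leb]_(u in F n) (r * u `^ (r - 1))%:E)%E @[n --> \oo] -->
    (\int[leb]_(u in `]0%R, y]) (r * u `^ (r - 1))%:E)%E.
  rewrite FE; apply: ge0_nondecreasing_set_cvg_integral.
  - move=> n m nm; apply/subsetPset => u; rewrite /F/= !in_itv/= => /andP[nu ->].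
    rewrite andbT (le_trans _ nu)// ler_wpM2l ?(ltW y0)// lef_pV2 ?posrE//.
    by rewrite ler_nat !ltnS.
  - by move=> n; exact: measurable_itv.
  - by move=> n; exact: measurable_gamma_powR.
  - by move=> n u _; rewrite lee_fin mulr_ge0 ?powR_ge0// ltW.
apply: (cvg_unique _ cv) => //.
have -> : (fun n => \int[leb]_(u in F n) (r * u `^ (r - 1))%:E)%E =
    fun n => (y `^ r - (y / n.+2%:R) `^ r)%:E.
  by apply/funext => n; exact: int_powR_away.
apply: cvg_EFin; first by near=> n.
rewrite /comp/= -[X in _ --> X]subr0; apply: cvgB; first exact: cvg_cst.
have /cvg_at_rightP := powR_cvg0 r0; apply; split=> //.
rewrite -(mulr0 y); apply: cvgM; first exact: cvg_cst.
have := @cvg_harmonic R; rewrite -cvg_shiftS; exact.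
Unshelve. all: by end_near.
Qed.

End gamma_integral.

Section gamma_function.
Context {R : realType}.
Local Notation leb := (@lebesgue_measure R).
Implicit Types (r y u : R).

Lemma measurable_gamma_fun r (D : set R) :
  measurable_fun D (fun u => (u `^ (r - 1) * expR (- u))%:E).
Proof.
apply/measurable_EFinP; apply: measurable_funTS; apply: measurable_funM.
  exact: measurable_powR.
apply: measurableT_comp => //.
Qed.

Let gamma_ge0 r u : (0 <= (u `^ (r - 1) * expR (- u))%:E)%E.
Proof. by rewrite lee_fin mulr_ge0 ?powR_ge0 ?expR_ge0. Qed.

(** With [s = |r - 1| + 1], the inequality [ln x <= x] at [x = u / (2 * s)] gives
    [s * ln u <= u / 2 + s * ln (2 * s)], which leaves half of the exponential decay. The factor 2
    undoes the normalisation of the density. *)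
Lemma powR_le_expR r u : 1 <= u ->
  u `^ (r - 1) * expR (- u) <=
  2 * expR ((`|r - 1| + 1) * ln (2 * (`|r - 1| + 1))) * exponential_pdf (1 / 2) u.
Proof.
move=> u1; have u0 : 0 < u by exact: lt_le_trans u1.
set s := `|r - 1| + 1; have s0 : 0 < s by rewrite ltr_wpDl.
rewrite exponential_pdfE ?(ltW u0)//.
rewrite (_ : 2 * _ * _ = expR (s * ln (2 * s)) * expR (- (1 / 2) * u)); last first.
  by rewrite -mulNr; field.
rewrite -expRD; apply: (@le_trans _ _ (u `^ s * expR (- u))).
  rewrite ler_wpM2r ?expR_ge0// ler_powR//.
  by rewrite (le_trans (ler_norm _))// lerDl.
rewrite /powR gt_eqF// -expRD ler_expR.
have us : 0 < u / (2 * s) by rewrite divr_gt0// mulr_gt0.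
have := ln_sublinear us; rewrite ln_div ?posrE ?mulr_gt0// => /ltW.
move=> /(ler_wpM2l (ltW s0)).
rewrite (_ : s * (u / (2 * s)) = u / 2); last by field; rewrite gt_eqF.
by lra.
Qed.

Lemma gamma_split r : (\int[leb]_(u in `]0%R, +oo[) (u `^ (r - 1) * expR (- u))%:E =
  \int[leb]_(u in `]0%R, 1%R]) (u `^ (r - 1) * expR (- u))%:E +
  \int[leb]_(u in `]1%R, +oo[) (u `^ (r - 1) * expR (- u))%:E)%E.
Proof.
rewrite -ge0_integral_setU//=.
- congr integral; apply/seteqP; split=> u /=; rewrite !in_itv/= !andbT.
    by move=> u0; case: (leP u 1) => ?; [left; rewrite u0|right].
  by case=> [/andP[]//|]; exact: lt_trans.
- exact: measurable_gamma_fun.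
- rewrite disj_set2E; apply/eqP/seteqP; split=> // u [] /=.
  by rewrite !in_itv/= andbT => /andP[_ u1]; rewrite ltNge u1.
Qed.

(** [Gamma] is read through [fine], so finiteness makes it the true integral. The comparison is with
    a power near 0 and with an exponential density at infinity. *)
Lemma gamma_fin_num r : 0 < r ->
  (\int[leb]_(u in `]0%R, +oo[) (u `^ (r - 1) * expR (- u))%:E)%E \is a fin_num.
Proof.
move=> r0; rewrite ge0_fin_numE; last by apply: integral_ge0 => u _; exact: gamma_ge0.
rewrite gamma_split; apply: lte_add_pinfty.
  apply: (@le_lt_trans _ _ (r^-1%:E * (1 `^ r)%:E)%E); last by rewrite -EFinM ltry.
  rewrite -int_powR// -ge0_integralZl//=; last 3 first.
  - exact: measurable_gamma_powR.
  - by move=> u; rewrite in_itv/= => /andP[u0 _]; rewrite lee_fin mulr_ge0 ?powR_ge0// ltW.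
  - by rewrite lee_fin invr_ge0 ltW.
  apply: ge0_le_integral => //=.
  - exact: measurable_gamma_fun.
  - by apply: measurable_funeM; exact: measurable_gamma_powR.
  - move=> u; rewrite in_itv/= => /andP[u0 _].
    rewrite -EFinM lee_fin mulrA mulVf ?gt_eqF// mul1r ler_piMr ?powR_ge0//.
    by rewrite -[leRHS]expR0 ler_expR lerNl oppr0 ltW.
set C := 2 * expR ((`|r - 1| + 1) * ln (2 * (`|r - 1| + 1))).
have C0 : 0 <= C by rewrite mulr_ge0 ?expR_ge0.
have mpdf (D : set R) : measurable_fun D (fun u => (exponential_pdf (1 / 2) u)%:E).
  by apply/measurable_EFinP; apply: measurable_funTS; exact: measurable_exponential_pdf.
have pdf0 u : (0 <= (exponential_pdf (1 / 2) u)%:E)%E.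
  by rewrite lee_fin exponential_pdf_ge0.
apply: (@le_lt_trans _ _ (C%:E * 1)%E); last by rewrite mule1 ltry.
rewrite -(@integral_exponential_pdf R (1 / 2))//.
apply: (@le_trans _ _ (C%:E * \int[leb]_(u in `]1%R, +oo[) (exponential_pdf (1 / 2) u)%:E)%E).
  rewrite -ge0_integralZl//=; last exact: mpdf.
  apply: ge0_le_integral => //=.
  - exact: measurable_gamma_fun.
  - by apply: measurable_funeM; exact: mpdf.
  - move=> u; rewrite in_itv/= andbT => u1.
    by rewrite -EFinM lee_fin powR_le_expR// ltW.
apply: lee_wpmul2l; first by rewrite lee_fin.
by apply: ge0_subset_integral => //; exact: mpdf.
Qed.

(** On []0, 1]] the exponential is at least [expR (-1)], so [Gamma r] is at least
    [expR (-1) / r]. *)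
Lemma Gamma_gt0 r : 0 < r -> 0 < Gamma r.
Proof.
move=> r0; rewrite /Gamma -lte_fin fineK ?gamma_fin_num// gamma_split.
apply: (@lt_le_trans _ _ ((expR (-1) / r)%:E * (1 `^ r)%:E)%E).
  by rewrite -EFinM lte_fin powR1 mulr1 divr_gt0 ?expR_gt0.
apply: (@le_trans _ _ (\int[leb]_(u in `]0%R, 1%R]) (u `^ (r - 1) * expR (- u))%:E)%E); last first.
  by rewrite leeDl// integral_ge0// => u _; exact: gamma_ge0.
rewrite -int_powR// -ge0_integralZl//=; last 3 first.
- exact: measurable_gamma_powR.
- by move=> u; rewrite in_itv/= => /andP[u0 _]; rewrite lee_fin mulr_ge0 ?powR_ge0// ltW.
- by rewrite lee_fin divr_ge0 ?expR_ge0// ltW.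
apply: ge0_le_integral => //=.
- move=> u; rewrite in_itv/= => /andP[u0 _].
  by rewrite -EFinM lee_fin !mulr_ge0 ?powR_ge0 ?expR_ge0 ?invr_ge0// ltW.
- by apply: measurable_funeM; exact: measurable_gamma_powR.
- exact: measurable_gamma_fun.
- move=> u; rewrite in_itv/= => /andP[u0 u1].
  rewrite -EFinM lee_fin mulrA divfK ?gt_eqF// mulrC ler_wpM2l ?powR_ge0//.
  by rewrite ler_expR lerN2.
Qed.

End gamma_function.

(** * Moments from exponential and Gaussian tails *)

Section moments_from_tails.
Context {disp : measure_display} {T : measurableType disp} {R : realType}.
Variable mu : probability T R.
Local Notation leb := (@lebesgue_measure R).
Implicit Types (X Y : T -> R) (r s q a u : R).

(* Layer-cake formula [Y^r = int_0^Y r u^(r-1) du], then Tonelli. *)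
Lemma moment_le_Gamma Y r : measurable_fun [set: T] Y -> (forall x, 0 <= Y x) ->
  0 < r ->
  (forall u, 0 < u -> (mu [set x | (u <= Y x)%R] <= (2 * expR (- u))%:E)%E) ->
  (\int[mu]_x (Y x `^ r)%:E <= (2 * r * Gamma r)%:E)%E.
Proof.
move=> mY Y0 r0 tail.
pose A := [set z : T * R | 0 < z.2 /\ z.2 <= Y z.1].
have mA : measurable A.
  have -> : A = ~` (setT `&` [set z | z.2 <= 0]) `&` (setT `&` [set z | z.2 <= Y z.1]).
    rewrite !setTI; apply/seteqP; split=> z; rewrite /A/=.
      by move=> [z0 zY]; split=> //; apply/negP; rewrite -ltNge.
    by move=> [/negP z0 zY]; rewrite ltNge.
  apply: measurableI.
    apply: measurableC; apply: measurable_fun_le;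
      [exact: measurableT|exact: measurable_snd|exact: measurable_cst].
  apply: measurable_fun_le; [exact: measurableT|exact: measurable_snd|].
  exact: measurableT_comp mY measurable_fst.
pose w u : \bar R := (r * u `^ (r - 1))%:E.
have w0 u : (0 <= w u)%E by rewrite lee_fin mulr_ge0 ?powR_ge0// ltW.
pose G z : \bar R := (w z.2 * (\1_A z)%:E)%E.
have G0 z : (0 <= G z)%E by rewrite mule_ge0// lee_fin.
have mG : measurable_fun setT G.
  apply: emeasurable_funM.
    have mw : measurable_fun setT w by exact: measurable_gamma_powR.
    exact: (measurableT_comp mw measurable_snd).
  by apply/measurable_EFinP; exact: measurable_indic.
have inner x : (\int[leb]_u G (x, u) = (Y x `^ r)%:E)%E.
  rewrite (_ : (fun u => G (x, u)) = w \_ `]0, Y x]); last first.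
    apply/funext => u; rewrite /G /= patchE indicE.
    have -> : ((x, u) \in A) = (u \in `]0, Y x]%classic).
      by apply/idP/idP; rewrite !inE /A/= in_itv/= => /andP.
    by case: ifP => _; rewrite ?mule1 ?mule0.
  rewrite -integral_mkcond; have := Y0 x; rewrite le_eqVlt => /predU1P[<-|Yx0].
    by rewrite set_itv_ge ?bnd_simp// integral_set0 powR0// gt_eqF.
  exact: int_powR.
under eq_integral do rewrite -inner.
rewrite fubini_tonelli//=.
apply: (@le_trans _ _ (\int[leb]_(u in `]0%R, +oo[)
    ((2 * r)%:E * (u `^ (r - 1) * expR (- u))%:E))%E).
  rewrite [leRHS]integral_mkcond; apply: ge0_le_integral => //.
  - by move=> u _; apply: integral_ge0 => x _; exact: G0.
  - exact: measurable_fun_fubini_tonelli_G.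
  - apply/(measurable_restrictT _ _).1 => //.
    by apply: measurable_funeM; exact: measurable_gamma_fun.
  - move=> u _; rewrite patchE.
    have [u0|u0] := boolP (u \in `]0, +oo[%classic); last first.
      rewrite (_ : \int[mu]_x _ = 0)%E//; apply: integral0_eq => x _.
      rewrite /G indicE (_ : (_ \in A) = false) ?mule0//.
      apply/negbTE; apply: contra u0; rewrite !inE /A/= in_itv/= andbT.
      by case.
    have {}u0 : 0 < u by move: u0; rewrite inE/= in_itv/= andbT.
    rewrite (eq_integral (fun x => w u * (\1_[set x | (u <= Y x)%R] x)%:E)%E); last first.
      move=> x _; rewrite /G/= !indicE; congr (_ * _%:R%:E)%E.
      by congr nat_of_bool; apply/idP/idP; rewrite !inE /A/= ?u0// => -[].
    have mS : measurable [set x | (u <= Y x)%R].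
      rewrite -[X in measurable X]setTI.
      exact: (measurable_fun_le measurableT (measurable_cst u) mY).
    rewrite ge0_integralZl//=; last by apply/measurable_EFinP; exact: measurable_indic.
    rewrite integral_indic// setIT.
    apply: le_trans (lee_wpmul2l (w0 u) (tail u u0)) _.
    by rewrite /w -!EFinM lee_fin; lra.
rewrite ge0_integralZl//=; last 3 first.
- exact: measurable_gamma_fun.
- by move=> u _; rewrite lee_fin mulr_ge0 ?powR_ge0 ?expR_ge0.
- by rewrite lee_fin mulr_ge0// ltW.
by rewrite [in leRHS]EFinM /Gamma fineK// gamma_fin_num.
Qed.

(** The square [Y = (|X| / s) ^+ 2] has an exponential tail, and the moment of order [q] of [X] is
    one of order [r = q / 2] of [Y]; hence [2 * r * Gamma r = q * Gamma (q / 2)]. *)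
Lemma Lnorm_le_tail X s q : measurable_fun [set: T] X -> 0 < s -> 1 <= q ->
  (forall a, 0 <= a -> (mu [set x | (a <= `|X x|)%R] <=
     (2 * expR (- (a ^+ 2 / s ^+ 2)))%:E)%E) ->
  (Lnorm mu q%:E (fun x => (X x)%:E) <=
   (s * (q * Gamma (q / 2)) `^ q^-1)%:E)%E.
Proof.
move=> mX s0 q1 tail; have q0 : 0 < q by exact: lt_le_trans q1.
have q20 : 0 < q / 2 by rewrite divr_gt0.
pose Y x := (`|X x| / s) ^+ 2.
have mY : measurable_fun setT Y.
  apply: measurable_funX; apply: measurable_funM => //.
  exact: measurableT_comp (@normr_measurable R setT) mX.
have YE x : `|X x| `^ q = s `^ q * Y x `^ (q / 2).
  have h : 0 <= `|X x| / s by rewrite divr_ge0// ltW.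
  rewrite /Y -powR_mulrn// -powRrM mulrCA divff// mulr1.
  by rewrite -powRM ?(ltW s0)// mulrCA divff ?gt_eqF// mulr1.
have Y0 x : 0 <= Y x by exact: sqr_ge0.
have tailY u : 0 < u -> (mu [set x | (u <= Y x)%R] <= (2 * expR (- u))%:E)%E.
  move=> u0; have := tail _ (mulr_ge0 (sqrtr_ge0 u) (ltW s0)).
  rewrite exprMn sqr_sqrtr ?(ltW u0)// mulfK ?gt_eqF ?exprn_gt0//.
  suff -> : [set x | (u <= Y x)%R] = [set x | (Num.sqrt u * s <= `|X x|)%R] by [].
  apply/seteqP; split=> x /=; rewrite -ler_pdivlMr// /Y.
    by move=> h; rewrite -(@ler_sqrt _ u) ?sqr_ge0// sqrtr_sqr ger0_norm ?divr_ge0 ?(ltW s0)// in h.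
  move=> h; rewrite -(sqr_sqrtr (ltW u0)) lerXn2r ?nnegrE ?sqrtr_ge0//.
  by rewrite divr_ge0// ltW.
have := moment_le_Gamma mY Y0 q20 tailY.
rewrite (_ : 2 * (q / 2) = q); last by rewrite mulrCA divff// mulr1.
move=> h; rewrite unlock /=.
under eq_integral do rewrite YE EFinM.
rewrite ge0_integralZl//=; last 3 first.
- by apply/measurable_EFinP; exact: (measurableT_comp (measurable_powR (q / 2)) mY).
- by move=> x _; rewrite lee_fin powR_ge0.
- by rewrite lee_fin powR_ge0.
have G0 : 0 <= q * Gamma (q / 2) by rewrite mulr_ge0 ?(ltW q0)// ltW// Gamma_gt0.
apply: (@le_trans _ _ (((s `^ q * (q * Gamma (q / 2))) `^ q^-1)%:E)%E).
  rewrite -poweR_EFin; apply: gt0_ler_poweR => //.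
  - by rewrite invr_ge0 ltW.
  - rewrite in_itv/= leey andbT mule_ge0 ?lee_fin ?powR_ge0//.
    by rewrite integral_ge0// => x _; rewrite lee_fin powR_ge0.
  - by rewrite in_itv/= leey andbT lee_fin mulr_ge0// powR_ge0.
  - by rewrite EFinM lee_wpmul2l// lee_fin powR_ge0.
by rewrite powRM ?powR_ge0// -powRrM mulfV ?gt_eqF// powRr1// ltW.
Qed.

End moments_from_tails.

(** * Tails and moments under GEMB *)

Section gemb_concentration.
Context {R : realType} {d : nat}.
Variables (c : R) (mu : probability (config d) R).
Hypothesis gemb : GEMB c mu.
Implicit Types (F : config d -> R) (eta : config d) (l a K : R).

Let c_gt0 : 0 < c. Proof. by case: gemb. Qed.

Lemma osc_scale F l i : bounded F ->
  oscillation (fun eta => l * F eta) i <= `|l| * oscillation F i.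
Proof.
move=> bF; apply: osc_le => eta; rewrite -mulrBr.
by rewrite (le_trans (ler_norm _))// normrM ler_wpM2l// osc_norm_ub.
Qed.

Lemma gemb_mgf F l K : bmeas F -> (oscillation_norm 2 F ^+ 2 <= K%:E)%E ->
  \int[mu]_eta expR (l * (F eta - \int[mu]_xi F xi)) <= expR (c * l ^+ 2 * K).
Proof.
move=> bF oF; have bZ : bmeas (fun eta => l * F eta) by exact: bmeasZ.
have [mZ [C ZC]] := bZ; have bbF := bmeas_bounded bF.
have [_ /(_ _ mZ)] := gemb.
have bdd : bounded_fun (fun eta => l * F eta).
  exists C; split; first exact: num_real.
  by move=> D CD eta _; exact: le_trans (ZC eta) (ltW CD).
move=> /(_ bdd); rewrite expectationE unlock => h.
rewrite -lee_fin EFin_bmeas_int; last first.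
  by apply/bmeas_expR/bmeasZ/bmeasB => //; exact: bmeas_cst.
under eq_integral do rewrite mulrBr -bmeas_intZ//.
apply: le_trans h _; rewrite -[(expR _)%:E]/(expeR (_)%:E) lee_expeR -mulrA EFinM.
apply: lee_wpmul2l; first by rewrite lee_fin ltW.
rewrite oscillation_norm2_sqr; last exact: bmeas_bounded.
rewrite oscillation_norm2_sqr// in oF.
have l20 : 0 <= l ^+ 2 := sqr_ge0 l.
rewrite EFinM; apply: le_trans (lee_wpmul2l _ oF); last by rewrite lee_fin.
rewrite -esumZ// => [|i]; last by rewrite lee_fin sqr_ge0.
apply: le_esum => i _; rewrite -EFinM lee_fin -[l ^+ 2]real_normK ?num_real// -exprMn.
apply: lerXn2r; rewrite ?nnegrE; last exact: osc_scale.
  by apply: osc_ge0; exact: bmeas_bounded.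
by rewrite mulr_ge0// osc_ge0.
Qed.

(** Chernoff's bound for both signs at once, through the sum of the two exponentials. The parameter
    [l] stays free: it is optimised when [K > 0] and taken arbitrarily large when [K = 0]. *)
Lemma gemb_tail F l a K : bmeas F -> (oscillation_norm 2 F ^+ 2 <= K%:E)%E ->
  0 <= l ->
  (mu [set eta | (a <= `|F eta - \int[mu]_xi F xi|)%R] <=
   (2 * expR (c * l ^+ 2 * K - l * a))%:E)%E.
Proof.
move=> bF oF l0; set X := fun eta => F eta - \int[mu]_xi F xi.
have bX : bmeas X by exact: bmeasB bF (bmeas_cst _).
have mS : measurable [set eta | (a <= `|X eta|)%R].
  rewrite -[X in measurable X]setTI.
  apply: measurable_fun_le => //; by case: (bmeas_norm bX).
have bI : bmeas (\1_[set eta | (a <= `|X eta|)%R] : config d -> R) by exact: bmeas_indic.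
have bE (e : R) : bmeas (fun eta => expR (e * X eta)) by exact/bmeas_expR/bmeasZ.
have -> : mu [set eta | (a <= `|X eta|)%R] =
    (\int[mu]_eta \1_[set eta | (a <= `|X eta|)%R] eta)%:E.
  by rewrite EFin_bmeas_int// integral_indic// setIT.
rewrite lee_fin expRD expRN mulrA ler_pdivlMr ?expR_gt0// mulrC -bmeas_intZ//.
apply: (@le_trans _ _ (\int[mu]_eta (expR (l * X eta) + expR (- l * X eta)))).
  apply: bmeas_le_int => [||eta]; [exact: bmeasZ|exact: bmeasD|].
  rewrite indicE; have [|_] := boolP (eta \in _); last first.
    by rewrite mulr0 addr_ge0 ?expR_ge0.
  rewrite inE/= mulr1 => aX; have [X0|X0] := leP 0 (X eta).
    rewrite ger0_norm// in aX; rewrite ler_wpDr ?expR_ge0// ler_expR.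
    exact: ler_wpM2l.
  rewrite ltr0_norm// in aX; rewrite ler_wpDl ?expR_ge0// ler_expR mulNr -mulrN.
  exact: ler_wpM2l.
rewrite bmeas_intD//; have := gemb_mgf l bF oF; have := gemb_mgf (- l) bF oF.
by rewrite sqrrN /X; lra.
Qed.

Lemma gemb_gauss_tail F a K : bmeas F -> 0 < K ->
  (oscillation_norm 2 F ^+ 2 <= K%:E)%E -> 0 <= a ->
  (mu [set eta | (a <= `|F eta - \int[mu]_xi F xi|)%R] <=
   (2 * expR (- (a ^+ 2 / (4 * c * K))))%:E)%E.
Proof.
(* Minimiser of [c * l ^+ 2 * K - l * a]. *)
move=> bF K0 oF a0; have l0 : 0 <= a / (2 * c * K).
  by rewrite divr_ge0// !mulr_ge0// ltW.
apply: le_trans (gemb_tail a bF oF l0) _.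
rewrite (_ : c * _ * K - _ = - (a ^+ 2 / (4 * c * K)))//.
by field; rewrite !gt_eqF.
Qed.

Lemma gemb_null_tail F a : bmeas F -> (oscillation_norm 2 F ^+ 2 <= 0)%E -> 0 < a ->
  mu [set eta | (a <= `|F eta - \int[mu]_xi F xi|)%R] = 0%E.
Proof.
move=> bF oF a0; apply/eqP; rewrite eq_le measure_ge0 andbT.
apply/lee_addgt0Pr => e e0; rewrite add0e.
(* With this [l] the bound is [2 * expR (- (2 / e))], at most [e] since [expR x >= 1 + x]. *)
have l0 : 0 <= 2 / e / a by rewrite !divr_ge0// ltW.
apply: le_trans (gemb_tail a bF oF l0) _.
rewrite lee_fin mulr0 sub0r divfK ?gt_eqF// expRN.
rewrite ler_pdivrMr ?expR_gt0//.
have := expR_ge1Dx (2 / e).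
move=> /(ler_wpM2l (ltW e0)); rewrite mulrDr mulr1 mulrC divfK ?gt_eqF//.
by lra.
Qed.

(** The Gaussian scale may vanish with [K], so it is enlarged by [e / G] before the tail is
    integrated; this adds exactly [e] to the bound. *)
Lemma gemb_Lnorm F q K : bmeas F -> 0 <= K ->
  (oscillation_norm 2 F ^+ 2 <= K%:E)%E -> 1 <= q ->
  (Lnorm mu q%:E (fun eta => (F eta - \int[mu]_xi F xi)%:E) <=
   (2 * Num.sqrt c * (q * Gamma (q / 2)) `^ q^-1 * Num.sqrt K)%:E)%E.
Proof.
move=> bF K0 oF q1; have q0 : 0 < q by exact: lt_le_trans q1.
set G := (q * Gamma (q / 2)) `^ q^-1.
have G0 : 0 < G by rewrite powR_gt0// mulr_gt0// Gamma_gt0// divr_gt0.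
apply/lee_addgt0Pr => e e0; rewrite -EFinD.
pose s := 2 * Num.sqrt c * Num.sqrt K + e / G.
have h0 : 0 <= 2 * Num.sqrt c * Num.sqrt K by rewrite !mulr_ge0 ?sqrtr_ge0.
have s0 : 0 < s by rewrite ltr_wpDl// divr_gt0.
rewrite (_ : _ + e = s * G); last first.
  by rewrite /s; field; rewrite gt_eqF.
pose K' := s ^+ 2 / (4 * c).
have K'0 : 0 < K' by rewrite divr_gt0 ?exprn_gt0// mulr_gt0.
have KK' : K <= K'.
  rewrite ler_pdivlMr ?mulr_gt0//.
  rewrite (_ : K * (4 * c) = (2 * Num.sqrt c * Num.sqrt K) ^+ 2).
    by rewrite lerXn2r ?nnegrE ?(ltW s0)// lerDl divr_ge0// ltW.
  by rewrite !exprMn !sqr_sqrtr ?(ltW c_gt0)//; ring.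
have oF' : (oscillation_norm 2 F ^+ 2 <= K'%:E)%E by rewrite (le_trans oF)// lee_fin.
apply: Lnorm_le_tail => //.
  by case: (bmeasB bF (bmeas_cst (\int[mu]_xi F xi))).
move=> a a0; apply: le_trans (gemb_gauss_tail bF K'0 oF' a0) _.
by rewrite /K' [4 * c * _]mulrC divfK// gt_eqF// mulr_gt0.
Qed.

End gemb_concentration.

(** * Bernoulli measures *)

Section hoeffding.
Context {R : realType}.
Implicit Types (t u v x y rho : R).

Lemma le_at0_of_derive (f df : R -> R) t : 0 <= t ->
  (forall x, is_derive x (1 : R) f (df x)) ->
  (forall x, 0 <= x -> 0 <= df x) -> f 0 <= f t.
Proof.
move=> t0 fdf df0.
have cf : {within `[0, t], continuous f}.
  apply: continuous_subspaceT => x; apply: differentiable_continuous.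
  by apply/derivable1_diffP; case: (fdf x).
have [c] := MVT_segment t0 (fun x _ => fdf x) cf.
rewrite in_itv/= => /andP[c0 _] E.
by rewrite -subr_ge0 E mulr_ge0 ?df0// subr_ge0.
Qed.

(** This is [tanh (u / 2) <= u / 2]; differentiating leads to [1 - x <= expR (- x)]. *)
Lemma expR_sub1_le u : 0 <= u -> expR u - 1 <= u / 2 * (expR u + 1).
Proof.
move=> u0; rewrite -subr_ge0.
pose f x := x / 2 * (expR x + 1) - (expR x - 1).
have f0 : f 0 = 0 by rewrite /f expR0; lra.
rewrite -f0; apply: (@le_at0_of_derive f (fun x => (1 - expR x + x * expR x) / 2)) => // x.
  rewrite /f; apply: is_derive_eq; rewrite /GRing.scale/=; lra.
move=> x0; rewrite divr_ge0//.
have : (1 - x) * expR x <= expR (- x) * expR x.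
  by rewrite ler_wpM2r ?expR_ge0// -[1 - x]/(1 + - x) expR_ge1Dx.
by rewrite -expRD addNr expR0; lra.
Qed.

(** The moment generating function of the centred two-point law, divided by [expR (x ^+ 2 / 8)],
    equals 1 at 0 and is nonincreasing for [x >= 0]. *)
Lemma hoeffding_ge0 rho t : 0 <= rho <= 1 -> 0 <= t ->
  rho * expR ((1 - rho) * t) + (1 - rho) * expR (- rho * t) <= expR (t ^+ 2 / 8).
Proof.
move=> /andP[rho0 rho1] t0.
pose e a x := expR (a * x - x ^+ 2 / 8).
pose f x := - (rho * e (1 - rho) x + (1 - rho) * e (- rho) x).
have de a x : is_derive x (1 : R) (e a) ((a - x / 4) * e a x).
  rewrite /e; apply: is_derive_eq; rewrite /GRing.scale/=; lra.
pose df x := - (rho * ((1 - rho - x / 4) * e (1 - rho) x) +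
  (1 - rho) * ((- rho - x / 4) * e (- rho) x)).
have dfx x : is_derive x (1 : R) f (df x).
  by rewrite /f /df; apply: is_derive_eq; rewrite /GRing.scale/=; lra.
have df0 x : 0 <= x -> 0 <= df x.
  move=> x0; pose v := expR (x / 2).
  have E : e (1 - rho) x = v ^+ 2 * e (- rho) x.
    by rewrite /e /v -expRM_natl -expRD; congr expR; lra.
  rewrite /df E; set w := e (- rho) x; have w0 : 0 <= w := expR_ge0 _.
  have v0 : 0 < v := expR_gt0 _.
  have v1 : v - 1 <= x / 4 * (v + 1).
    by rewrite (_ : x / 4 = x / 2 / 2); [apply: expR_sub1_le; rewrite divr_ge0|lra].
  (* After multiplication by [v + 1], this follows from [v1] and the identity [rho * v ^+ 2 + (1 -
     rho) - rho * (1 - rho) * (v + 1) ^+ 2 = ((1 - rho) - rho * v) ^+ 2]. *)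
  suff : 0 <= x / 4 * (rho * v ^+ 2 + (1 - rho)) - rho * (1 - rho) * (v ^+ 2 - 1).
    by move=> /(mulr_ge0 w0); lra.
  have v10 : 0 < v + 1 by rewrite addr_gt0.
  rewrite -(pmulr_rge0 _ v10).
  have h1 : 0 <= (v - 1) * ((1 - rho) - rho * v) ^+ 2.
    by rewrite mulr_ge0 ?sqr_ge0// subr_ge0 /v -[leLHS]expR0 ler_expR divr_ge0.
  have p0 : 0 <= rho * v ^+ 2 + (1 - rho).
    by rewrite addr_ge0 ?subr_ge0// mulr_ge0// exprn_ge0// ltW.
  have := ler_wpM2r p0 v1; move: h1; rewrite !expr2; lra.
have := le_at0_of_derive t0 dfx df0.
rewrite /f lerN2 /e !mulr0 expr0n/= mul0r subr0 expR0 !mulr1.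
rewrite !expRD expRN !mulrA -mulrDl ler_pdivrMr ?expR_gt0//.
by lra.
Qed.

Lemma hoeffding_two_points_le rho x y : 0 <= rho <= 1 -> y <= x ->
  rho * expR x + (1 - rho) * expR y <=
  expR (rho * x + (1 - rho) * y) * expR ((x - y) ^+ 2 / 8).
Proof.
move=> rho01 yx; set m := rho * x + (1 - rho) * y.
have t0 : 0 <= x - y by rewrite subr_ge0.
have Ex : x = m + (1 - rho) * (x - y) by rewrite /m; ring.
have Ey : y = m + - rho * (x - y) by rewrite /m; ring.
have -> : expR x = expR m * expR ((1 - rho) * (x - y)) by rewrite -expRD -Ex.
have -> : expR y = expR m * expR (- rho * (x - y)) by rewrite -expRD -Ey.
rewrite mulrCA [X in _ + X]mulrCA -mulrDr.
by rewrite ler_wpM2l ?expR_ge0// hoeffding_ge0.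
Qed.

Lemma hoeffding_two_points rho x y : 0 <= rho <= 1 ->
  rho * expR x + (1 - rho) * expR y <=
  expR (rho * x + (1 - rho) * y) * expR ((x - y) ^+ 2 / 8).
Proof.
move=> rho01; have [yx|xy] := leP y x; first exact: hoeffding_two_points_le.
have rho01' : 0 <= 1 - rho <= 1 by lra.
have := hoeffding_two_points_le rho01' (ltW xy).
rewrite (_ : 1 - (1 - rho) = rho); last by ring.
by rewrite addrC (addrC ((1 - rho) * y)) -(sqrrN (y - x)) opprB.
Qed.

End hoeffding.

(** * Averaging over single sites *)

Section site_average.
Context {R : realType} {d : nat} (rho : R).
Hypothesis rho01 : 0 <= rho <= 1.
Implicit Types (i j x y : site d) (eta xi : config d) (f g h : config d -> R)
  (A B : {fset site d}) (s : seq (site d)).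

Let rho0 : 0 <= rho. Proof. by case/andP: rho01. Qed.
Let rho1 : 0 <= 1 - rho. Proof. by rewrite subr_ge0; case/andP: rho01. Qed.

(** Resampling of site [j]: under the product measure, the conditional expectation given the other
    sites. *)
Definition avg j f eta :=
  rho * f (set_at j true eta) + (1 - rho) * f (set_at j false eta).

Lemma flip_set_at x b eta : flip x (set_at x b eta) = set_at x (~~ b) eta.
Proof. by apply/funext => z; rewrite /flip /set_at eqxx; case: (z == x). Qed.

Lemma exchange_set_at x y b c eta : x != y ->
  exchange x y (set_at y c (set_at x b eta)) = set_at y b (set_at x c eta).
Proof.
move=> xy; apply/funext => z; rewrite /exchange /set_at !eqxx (negbTE xy).
have [->|zx] := eqVneq z x; first by rewrite (negbTE xy).
by case: (z == y).
Qed.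

Lemma avg_bmeas j f : bmeas f -> bmeas (avg j f).
Proof.
move=> bf; apply: bmeasD; apply: bmeasZ;
  exact: bmeas_comp (set_at_measurable _ _) bf.
Qed.

Lemma avg_dist j f g h eta : (forall xi, `|f xi - g xi| <= h xi) ->
  `|avg j f eta - avg j g eta| <= avg j h eta.
Proof.
move=> fgh; rewrite /avg opprD addrACA -!mulrBr (le_trans (ler_normD _ _))//.
by rewrite lerD// normrM ger0_norm// ler_wpM2l.
Qed.

Lemma avg_depends A j f : depends_on A f -> depends_on (A `\ j)%fset (avg j f).
Proof.
move=> fA eta xi h.
have E b : f (set_at j b eta) = f (set_at j b xi).
  apply: fA => z zA; rewrite /set_at; have [//|zj] := eqVneq z j.
  by apply: h; rewrite !inE zj.
by rewrite /avg !E.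
Qed.

Lemma osc_avg i j f : bounded f -> oscillation (avg j f) i <= oscillation f i.
Proof.
move=> bf; apply: osc_le => eta; rewrite /avg opprD addrACA -!mulrBr.
rewrite !set_at_flip; have [<-|ji] := eqVneq j i.
  by rewrite !subrr !mulr0 addr0 osc_ge0.
have h b := osc_ub i (set_at j b eta) bf.
by have := lerD (ler_wpM2l rho0 (h true)) (ler_wpM2l rho1 (h false)); lra.
Qed.

Lemma avg_expR_le j f eta : bounded f ->
  avg j (fun xi => expR (f xi)) eta <=
  expR (avg j f eta) * expR (oscillation f j ^+ 2 / 8).
Proof.
move=> bf; apply: le_trans (hoeffding_two_points _ _ rho01) _.
rewrite ler_wpM2l ?expR_ge0// ler_expR ler_wpM2r// -real_normK ?num_real//.
apply: lerXn2r; rewrite ?nnegrE ?osc_ge0//.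
have := osc_norm_ub j (set_at j false eta) bf; rewrite flip_set_at.
by [].
Qed.

(** Once both sites are resampled, the values [(b, c)] and [(c, b)] have the same weight. *)
Lemma avg_exchange x y f eta :
  avg x (avg y (fun xi => f (exchange x y xi))) eta = avg x (avg y f) eta.
Proof.
have [->|xy] := eqVneq x y.
  congr (avg y (avg y _) eta); apply/funext => xi; congr f.
  by have [//|->] := exchange_cases y y xi; rewrite flipK.
by rewrite /avg !exchange_set_at//; ring.
Qed.

Definition avgs s f := foldr avg f s.

Lemma avgs_bmeas s f : bmeas f -> bmeas (avgs s f).
Proof. by move=> bf; elim: s => //= j s; exact: avg_bmeas. Qed.

Lemma avgs_dist s f g h : (forall xi, `|f xi - g xi| <= h xi) ->
  forall eta, `|avgs s f eta - avgs s g eta| <= avgs s h eta.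
Proof. by move=> fgh; elim: s => //= j s IH eta; exact: avg_dist. Qed.

Lemma osc_avgs i s f : bmeas f -> oscillation (avgs s f) i <= oscillation f i.
Proof.
move=> bf; elim: s => //= j s; apply: le_trans.
by apply: osc_avg; exact/bmeas_bounded/avgs_bmeas.
Qed.

Lemma avgs_depends s A f : depends_on A f ->
  exists B, depends_on B (avgs s f) /\ (forall x, x \in B -> x \in A /\ x \notin s).
Proof.
move=> fA; elim: s => [|j s [B [fB hB]]] /=; first by exists A.
exists (B `\ j)%fset; split; first exact: avg_depends.
by move=> x; rewrite !inE => /andP[xj /hB[xA xs]]; rewrite negb_or xj.
Qed.

Lemma avgs_norm_le s f (C : R) : (forall xi, `|f xi| <= C) ->
  forall xi, `|avgs s f xi| <= C.
Proof.
move=> fC; elim: s => //= j s IH xi; rewrite /avg (le_trans (ler_normD _ _))//.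
rewrite !normrM (ger0_norm rho0) (ger0_norm rho1).
by have := lerD (ler_wpM2l rho0 (IH (set_at j true xi)))
  (ler_wpM2l rho1 (IH (set_at j false xi))); lra.
Qed.

End site_average.

(** * Product measures: preserved integrals and GEMB *)

Section bernoulli.
Context {R : realType} {d : nat} (rho : R) (nu : probability (config d) R).
Hypothesis rho01 : 0 <= rho <= 1.
Hypothesis nuB : bernoulli_product rho nu.
Implicit Types (i j x y : site d) (eta xi : config d) (f g h : config d -> R)
  (A B : {fset site d}) (s : seq (site d)).

Let cylinder A (zeta : config d) := [set eta : config d | agree A eta zeta].

Let measurable_cylinder A zeta : measurable (cylinder A zeta).
Proof.
apply: (@local_set_measurable d A) => eta xi h; apply/propext; split.
  exact: agree_trans (agree_sym h).
exact: agree_trans h.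
Qed.

Let int_cylinder A zeta : \int[nu]_eta \1_(cylinder A zeta) eta =
  \prod_(x <- A) (if zeta x then rho else 1 - rho).
Proof.
rewrite /Rintegral integral_indic// setIT.
transitivity (fine (nu [set eta | forall x, x \in A -> eta x = zeta x])) => //.
by rewrite nuB.
Qed.

(** On a cylinder indicator, averaging at [j] removes the constraint at [j] and multiplies by its
    weight, the factor of [j] in the product formula; [j] is added to the base so that this factor
    is present. *)
Lemma int_avg_local A j g : depends_on A g ->
  \int[nu]_eta avg rho j g eta = \int[nu]_eta g eta.
Proof.
move=> gA; pose L := (j |` A)%fset; have jL : j \in L by rewrite !inE eqxx.
have gL : depends_on L g.
  by apply: depends_onW gA => x xA; rewrite !inE xA orbT.
have bi (a : {ffun L -> bool}) : bmeas (\1_(cylinder L (extend a)) : config d -> R).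
  exact: bmeas_indic.
have gE eta : g eta =
    \sum_(a : {ffun L -> bool}) g (extend a) * \1_(cylinder L (extend a)) eta.
  rewrite (local_expansion eta gL); apply: eq_bigr => a _; rewrite indicE.
  congr (_ * (nat_of_bool _)%:R).
  apply/eqP/idP; rewrite inE.
    move=> <-; exact/agree_sym/extend_restr.
  move=> h; apply/ffunP => u; rewrite ffunE h ?(valP u)// /extend.
  by case: insubP => [v _ /val_inj -> //|]; rewrite (valP u).
have bav (a : {ffun L -> bool}) : bmeas (avg rho j (\1_(cylinder L (extend a)))).
  exact: avg_bmeas.
transitivity (\int[nu]_eta \sum_(a : {ffun L -> bool})
    g (extend a) * avg rho j (\1_(cylinder L (extend a))) eta).
  apply: eq_Rintegral => eta _; rewrite /avg !gE !mulr_sumr -big_split/=.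
  by apply: eq_bigr => a _; ring.
transitivity (\int[nu]_eta \sum_(a : {ffun L -> bool})
    g (extend a) * \1_(cylinder L (extend a)) eta); last first.
  by apply: eq_Rintegral => eta _; rewrite -gE.
rewrite !bmeas_int_sum; [|by move=> a; exact: bmeasZ..].
apply: eq_bigr => a _; rewrite !bmeas_intZ//; congr (_ * _).
pose b := extend a j; pose w : R := if b then rho else 1 - rho.
have E eta : avg rho j (\1_(cylinder L (extend a))) eta =
    w * \1_(cylinder (L `\ j)%fset (extend a)) eta.
  have F c : \1_(cylinder L (extend a)) (set_at j c eta) =
      (c == b)%:R * \1_(cylinder (L `\ j)%fset (extend a)) eta :> R.
    rewrite !indicE -natrM mulnb; congr (nat_of_bool _)%:R.
    apply/idP/andP; rewrite !inE.
      move=> h; split; first by rewrite -/(set_at j c eta) /b -(h j jL) /set_at eqxx.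
      move=> x; rewrite !inE => /andP[xj xL]; have := h x; rewrite !inE xL => /(_ isT).
      by rewrite /set_at (negbTE xj).
    move=> [/eqP -> h] x xL; rewrite /set_at; have [->//|xj] := eqVneq x j.
    by apply: h; rewrite !inE xj; move: xL; rewrite !inE.
  by rewrite /avg !F /w; case: (b); rewrite /= ?mul0r ?mulr0 ?addr0 ?add0r mul1r.
under eq_Rintegral do rewrite E.
rewrite bmeas_intZ; last exact: bmeas_indic.
by rewrite !int_cylinder (big_fsetD1 j jL).
Qed.

(** The approximation is in L1 of [nu] and of its images under [set_at j b], which controls the
    average of [|f - g|] before averaging is known to preserve its integral. *)
Lemma int_avg j f : bmeas f -> \int[nu]_eta avg rho j f eta = \int[nu]_eta f eta.
Proof.
move=> bf; apply/eqP; rewrite -subr_eq0 -normr_le0; apply/ler_addgt0Pr => e e0.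
rewrite add0r.
pose m (k : option bool) : probability (config d) R := match k with
  | Some b => distribution nu (set_at j b : {mfun config d >-> config d})
  | None => nu end.
have [A [g [gA fg]]] := L1_local_bmeas m bf (divr_gt0 e0 (ltr0n _ 2)).
have bg := local_bmeas gA.
have bfg : bmeas (fun eta => `|f eta - g eta|) by exact/bmeas_norm/bmeasB.
have D : \int[nu]_eta avg rho j (fun eta => `|f eta - g eta|) eta <= e / 2.
  have h b : \int[nu]_eta `|f (set_at j b eta) - g (set_at j b eta)| <= e / 2.
    by have := fg (Some b); rewrite /m int_distribution.
  have bs b : bmeas (fun eta => `|f (set_at j b eta) - g (set_at j b eta)|).
    exact: bmeas_comp (set_at_measurable j b) bfg.
  rewrite /avg bmeas_intD; [|exact: bmeasZ|exact: bmeasZ].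
  rewrite !bmeas_intZ//.
  have [r0 r1] := andP rho01; have r1' : 0 <= 1 - rho by rewrite subr_ge0.
  have := lerD (ler_wpM2l r0 (h true)) (ler_wpM2l r1' (h false)).
  by lra.
have D1 : `|\int[nu]_eta avg rho j f eta - \int[nu]_eta avg rho j g eta| <= e / 2.
  apply: le_trans D; apply: le_trans (bmeas_int_dist _ _ _) _; try exact: avg_bmeas.
  apply: bmeas_le_int; [exact/bmeas_norm/bmeasB/avg_bmeas/bg/avg_bmeas|exact: avg_bmeas|].
  by move=> eta; apply: avg_dist.
have D2 : `|\int[nu]_eta f eta - \int[nu]_eta g eta| <= e / 2.
  exact: le_trans (bmeas_int_dist _ bf bg) (fg None).
rewrite (int_avg_local j gA) in D1.
by move: D1 D2; rewrite !ler_norml; lra.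
Qed.

Lemma int_avgs s f : bmeas f -> \int[nu]_eta avgs rho s f eta = \int[nu]_eta f eta.
Proof.
by move=> bf; elim: s => //= j s IH; rewrite int_avg//; exact: avgs_bmeas.
Qed.

Lemma int_exchange x y f : bmeas f ->
  \int[nu]_eta f (exchange x y eta) = \int[nu]_eta f eta.
Proof.
move=> bf; have be : bmeas (fun eta => f (exchange x y eta)).
  exact: bmeas_comp (exchange_measurable x y) bf.
rewrite -(int_avg y be) -(int_avg x (avg_bmeas rho y be)).
rewrite -(int_avg y bf) -(int_avg x (avg_bmeas rho y bf)).
by apply: eq_Rintegral => eta _; rewrite avg_exchange.
Qed.

(** One Hoeffding factor per site, as in the martingale method; averaging does not increase
    oscillations, so the constants are those of [f]. *)
Lemma int_expR_avgs s f : bmeas f ->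
  \int[nu]_eta expR (f eta) <=
  expR (\sum_(j <- s) oscillation f j ^+ 2 / 8) *
  \int[nu]_eta expR (avgs rho s f eta).
Proof.
move=> bf; elim: s => [|j s IH]; first by rewrite big_nil expR0 mul1r.
apply: le_trans IH _; rewrite big_cons [oscillation _ _ ^+ _ / _ + _]addrC expRD -mulrA.
rewrite ler_wpM2l ?expR_ge0//.
have bs : bmeas (avgs rho s f) by exact: avgs_bmeas.
have be := bmeas_expR bs.
rewrite -(int_avg j be) -bmeas_intZ; last exact/bmeas_expR/avg_bmeas.
apply: bmeas_le_int => [||eta].
- exact: avg_bmeas.
- exact/bmeasZ/bmeas_expR/avg_bmeas.
- apply: le_trans (avg_expR_le rho01 j eta (bmeas_bounded bs)) _.
  rewrite mulrC ler_wpM2r ?expR_ge0// ler_expR ler_wpM2r//.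
  apply: lerXn2r; rewrite ?nnegrE ?osc_ge0//; try exact: bmeas_bounded.
  exact: osc_avgs.
Qed.

(** For local [g], averaging over its sites leaves the constant [\int[nu]_xi g xi]; averaging
    contracts L1 distances, so [f] inherits this approximately. *)
Lemma avgs_L1 f (e : R) : bmeas f -> 0 < e -> exists A,
  \int[nu]_eta `|avgs rho A f eta - \int[nu]_xi f xi| <= e.
Proof.
move=> bf e0.
have [A [g [gA fg]]] := L1_local_bmeas (fun _ : unit => nu) bf (divr_gt0 e0 (ltr0n _ 2)).
exists A; have bg := local_bmeas gA.
have bfg : bmeas (fun eta => `|f eta - g eta|) by exact/bmeas_norm/bmeasB.
have gc eta : avgs rho A g eta = \int[nu]_xi g xi.
  have [B [gB hB]] := avgs_depends rho A gA.
  rewrite -(int_avgs A bg) -[LHS](int_cst nu); apply: eq_Rintegral => xi _.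
  by apply: gB => x /hB[xA]; rewrite xA.
have D : `|\int[nu]_eta f eta - \int[nu]_eta g eta| <= e / 2.
  exact: le_trans (bmeas_int_dist _ bf bg) (fg tt).
have bd : bmeas (fun eta => avgs rho A (fun xi => `|f xi - g xi|) eta + e / 2).
  by apply: bmeasD (bmeas_cst _); exact: avgs_bmeas.
apply: (@le_trans _ _ (\int[nu]_eta (avgs rho A (fun xi => `|f xi - g xi|) eta + e / 2))).
  apply: bmeas_le_int => // [|eta].
    by apply/bmeas_norm/bmeasB; [exact: avgs_bmeas|exact: bmeas_cst].
  rewrite (le_trans (ler_distD (avgs rho A g eta) _ _))// lerD//.
    exact: avgs_dist.
  by rewrite gc distrC.
rewrite bmeas_intD; [|exact: avgs_bmeas|exact: bmeas_cst].
by rewrite int_cst int_avgs// [leRHS]splitr lerD2r; exact: fg tt.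
Qed.

Lemma bernoulli_GEMB : GEMB (1 / 8) nu.
Proof.
split=> // f mf bdf.
have bf := bmeas_bounded_fun mf bdf.
have [C fC] := bmeas_bounded bf; have bbf := bmeas_bounded bf.
rewrite expectationE unlock.
pose E := \int[nu]_xi f xi.
have be : bmeas (fun eta => expR (f eta - E)).
  by apply/bmeas_expR/bmeasB => //; exact: bmeas_cst.
rewrite -EFin_bmeas_int// oscillation_norm2_sqr//.
have o2 i : (0 <= (oscillation f i ^+ 2)%:E)%E by rewrite lee_fin sqr_ge0.
have := esum_ge0 (fun i (_ : [set: site d] i) => o2 i).
case EV : (\esum_(i in [set: site d]) (oscillation f i ^+ 2)%:E)%E => [V||] //; last first.
  by move=> _; rewrite gt0_muley ?lte_fin// leey.
move=> _; rewrite -EFinM /= lee_fin.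
apply/ler_addgt0Pr => e e0.
(* The factor that multiplies the L1 error of the averages in the final estimate. *)
pose K := expR (V / 8) * expR (- E) * expR C.
have K0 : 0 < K by rewrite !mulr_gt0 ?expR_gt0.
have [A hA] := avgs_L1 bf (divr_gt0 e0 K0).
have ba : bmeas (avgs rho A f) by exact: avgs_bmeas.
have EC : `|E| <= C by exact: bmeas_norm_int_le.
have h1 : \int[nu]_eta expR (avgs rho A f eta) <= expR E + expR C * (e / K).
  have bae : bmeas (fun eta => `|avgs rho A f eta - E|).
    by apply/bmeas_norm/bmeasB => //; exact: bmeas_cst.
  apply: (@le_trans _ _ (\int[nu]_eta (expR E + expR C * `|avgs rho A f eta - E|))).
    apply: bmeas_le_int => [||eta].
    - exact: bmeas_expR.
    - by apply: bmeasD; [exact: bmeas_cst|exact: bmeasZ].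
    - set a := avgs _ _ _ _.
      have aC : a <= C by rewrite (le_trans (ler_norm _))// avgs_norm_le.
      (* The tangent at [a] gives [expR a <= expR E + expR C * |a - E|], so L1 convergence of the
         averages is enough for their exponentials. *)
      have : expR a * (1 + (E - a)) <= expR a * expR (E - a).
        by rewrite ler_wpM2l ?expR_ge0// expR_ge1Dx.
      rewrite -expRD [a + _]addrC subrK => h.
      have : expR a * (a - E) <= expR C * `|a - E|.
        apply: (@le_trans _ _ (expR a * `|a - E|)).
          by rewrite ler_wpM2l ?expR_ge0// ler_norm.
        by rewrite ler_wpM2r// ler_expR.
      by lra.
  rewrite bmeas_intD; [|exact: bmeas_cst|exact: bmeasZ].
  by rewrite int_cst bmeas_intZ// lerD2l ler_wpM2l ?expR_ge0.
have h2 := int_expR_avgs A bf.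
have h3 : \sum_(j <- A) oscillation f j ^+ 2 / 8 <= V / 8.
  rewrite -mulr_suml ler_wpM2r// -lee_fin -EV -sumEFin.
  by apply: (le_sum_esum (a := fun j => (oscillation f j ^+ 2)%:E)) => //; exact: fset_uniq.
have h4 : \int[nu]_eta expR (f eta) <= expR (V / 8) * (expR E + expR C * (e / K)).
  apply: le_trans h2 _; apply: ler_pM; rewrite ?expR_ge0 ?ler_expR//.
  by rewrite Rintegral_ge0// => eta _; exact: expR_ge0.
under eq_Rintegral do rewrite expRD mulrC.
rewrite bmeas_intZ; last exact: bmeas_expR.
have h5 : expR (- E) * (expR (V / 8) * (expR E + expR C * (e / K))) =
    expR (V / 8) + e.
  rewrite (_ : _ * _ = expR (V / 8) * (expR (- E) * expR E) + e / K * K).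
    by rewrite -expRD addNr expR0 mulr1 divfK ?gt_eqF.
  by rewrite /K; ring.
have := ler_wpM2l (expR_ge0 (- E)) h4; rewrite h5.
by rewrite (_ : 1 / 8 * V = V / 8)// mul1r mulrC.
Qed.

End bernoulli.

(** * Invariance of product measures under the semigroup *)

Section evolved_law.
Context {R : realType} {d : nat} (P : R -> R.-pker config d ~> config d).
Variables (nu : probability (config d) R) (t : R).
Implicit Types (f g : config d -> R) (eta xi : config d).

(** The law at time [t] from initial law [nu]: the constant kernel [nu] on a one-point space
    followed by [P t]. As a probability measure it can enter the families used for L1
    approximation. *)
Definition evolved_law : set (config d) -> \bar R :=
  kcomp (kprobability
      (@measurable_cst _ _ unit _ setT (nu : pprobability (config d) R)))
    (kernel.kernel_snd (T0 := unit) (P t)) tt.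

HB.instance Definition _ := Measure.on evolved_law.

Let evolved_law_setT : evolved_law setT = 1%E.
Proof.
rewrite /evolved_law /kcomp /=.
under eq_integral do rewrite (@prob_kernel _ _ _ _ _ (P t)).
by rewrite integral_cst//= mul1e; exact: probability_setT.
Qed.

HB.instance Definition _ :=
  Measure_isProbability.Build _ _ _ evolved_law evolved_law_setT.

Lemma int_evolved_law f : bmeas f ->
  \int[evolved_law]_xi f xi = \int[nu]_eta semigroup P t f eta.
Proof.
move=> bf; have [mf [C fC]] := bf.
have bC : bmeas (fun x => f x + C) by exact: bmeasD bf (bmeas_cst _).
suff : \int[evolved_law]_xi (f xi + C) =
    \int[nu]_eta semigroup P t (fun x => f x + C) eta.
  rewrite bmeas_intD ?int_cst//; last exact: bmeas_cst.
  rewrite (_ : semigroup P t (fun x => f x + C) = fun xi => semigroup P t f xi + C).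
    rewrite bmeas_intD ?int_cst; [exact: addIr|exact: semigroup_bmeas|exact: bmeas_cst].
  apply/funext => xi.
  by rewrite semigroupD ?semigroup_cst//; exact: bmeas_cst.
congr fine; rewrite integral_kcomp; last 2 first.
- by move=> x; rewrite lee_fin; have := fC x; rewrite ler_norml; lra.
- by apply/measurable_EFinP; case: bC.
by apply: eq_integral => xi _; rewrite semigroupE EFin_bmeas_int.
Qed.

End evolved_law.

Section bernoulli_invariance.
Context {R : realType} {d : nat} (p : site d -> site d -> R).
Hypothesis kp : exclusion_kernel p.
Variable P : R -> R.-pker config d ~> config d.
Hypothesis sep : symmetric_exclusion p P.
Variables (rho : R) (nu : probability (config d) R).
Hypothesis rho01 : 0 <= rho <= 1.
Hypothesis nuB : bernoulli_product rho nu.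
Implicit Types (f g : config d -> R) (eta xi : config d).

Lemma int_semigroup_local B g t : depends_on B g -> 0 <= t ->
  \int[nu]_eta semigroup P t g eta = \int[nu]_eta g eta.
Proof.
move=> gB t0; have bg := local_bmeas gB; have [C gC] := bmeas_bounded bg.
apply/eqP; rewrite -subr_eq0 -normr_le0; apply/ler_addgt0Pr => e e0; rewrite add0r.
have [A [v [vA Sv _ inv]]] :=
  euler_approximation kp sep gB gC t0 (divr_gt0 e0 (ltr0n _ 2)).
have bS : bmeas (semigroup P t g) by exact: semigroup_bmeas.
have bv := local_bmeas vA.
have h1 : `|\int[nu]_eta semigroup P t g eta - \int[nu]_eta v eta| <= e / 2.
  apply: le_trans (bmeas_int_dist _ bS bv) _.
  by apply: bmeas_int_le; first exact/bmeas_norm/bmeasB.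
have h2 : `|\int[nu]_eta v eta - \int[nu]_eta g eta| <= e / 2.
  by apply: inv => A' f x y fA'; apply: (int_exchange rho01 nuB); exact: local_bmeas fA'.
by rewrite (le_trans (ler_distD (\int[nu]_eta v eta) _ _))// [leRHS]splitr lerD.
Qed.

(** Local functions give invariance; one approximant of [f] in L1 of both [nu] and its evolved law
    transfers it. *)
Lemma int_semigroup f t : bmeas f -> 0 <= t ->
  \int[nu]_eta semigroup P t f eta = \int[nu]_eta f eta.
Proof.
move=> bf t0; apply/eqP; rewrite -subr_eq0 -normr_le0.
apply/ler_addgt0Pr => e e0; rewrite add0r.
pose m (k : bool) : probability (config d) R :=
  if k then (evolved_law P nu t : probability _ _) else nu.
have [A [g [gA fg]]] := L1_local_bmeas m bf (divr_gt0 e0 (ltr0n _ 2)).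
have bg := local_bmeas gA.
rewrite -(int_evolved_law P nu t bf).
have h1 : `|\int[evolved_law P nu t]_eta f eta - \int[nu]_eta g eta| <= e / 2.
  rewrite -(int_semigroup_local gA t0) -(int_evolved_law P nu t bg).
  exact: le_trans (bmeas_int_dist _ bf bg) (fg true).
have h2 : `|\int[nu]_eta g eta - \int[nu]_eta f eta| <= e / 2.
  by rewrite distrC; exact: le_trans (bmeas_int_dist _ bf bg) (fg false).
by rewrite (le_trans (ler_distD (\int[nu]_eta g eta) _ _))// [leRHS]splitr lerD.
Qed.

End bernoulli_invariance.

(** * Concentration of the evolved function *)

Section semigroup_concentration.
Context {R : realType} {d : nat} (p : site d -> site d -> R).
Hypothesis kp : exclusion_kernel p.
Variable P : R -> R.-pker config d ~> config d.
Hypothesis sep : symmetric_exclusion p P.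
Variables (c : R) (mu : probability (config d) R).
Hypothesis gemb : GEMB c mu.
Implicit Types (f : config d -> R) (t q a : R).

Local Notation H := (heat_kernel p).

Let c0 : 0 < c. Proof. by case: gemb. Qed.

Let oscillation_norm1_cases f : bmeas f ->
  oscillation_norm 1 f = +oo%E \/
  exists N, [/\ 0 <= N, oscillation_norm 1 f = N%:E & forall t, 0 <= t ->
    (oscillation_norm 2 (semigroup P t f) ^+ 2 <= (H (2 * t) 0 0 * N ^+ 2)%:E)%E].
Proof.
move=> bf; have := oscillation_norm1 (bmeas_bounded bf).
have : (0 <= \esum_(i in [set: site d]) (oscillation f i)%:E)%E.
  by apply: esum_ge0 => i _; rewrite lee_fin osc_ge0//; exact: bmeas_bounded.
case: (\esum_(i in _) _)%E => [N||//] + E; last by move=> _; left.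
rewrite lee_fin => N0; right; exists N; split=> // t t0.
by apply: le_trans (oscillation_norm_semigroup kp sep bf t0) _; rewrite E EFinM.
Qed.

Lemma semigroup_Lnorm_le f t q : bmeas f -> 0 <= t -> 1 <= q ->
  (Lnorm mu q%:E (fun eta =>
      (semigroup P t f eta - \int[mu]_xi semigroup P t f xi)%:E)
   <= (2 * Num.sqrt c * (q * Gamma (q / 2)) `^ q^-1
       * Num.sqrt (H (2 * t) 0 0))%:E * oscillation_norm 1 f)%E.
Proof.
move=> bf t0 q1; have bS : bmeas (semigroup P t f) by exact: semigroup_bmeas.
have t20 : 0 <= 2 * t by rewrite mulr_ge0.
have q0 : 0 < q by exact: lt_le_trans q1.
have H0 : 0 < H (2 * t) 0 0 by exact: heat_gt0.
have [->|[N [N0 -> oN]]] := oscillation_norm1_cases bf.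
  rewrite gt0_muley ?leey// lte_fin !mulr_gt0// ?sqrtr_gt0// powR_gt0//.
  by rewrite mulr_gt0// Gamma_gt0// divr_gt0.
have K0 : 0 <= H (2 * t) 0 0 * N ^+ 2 by rewrite mulr_ge0 ?sqr_ge0// ltW.
apply: le_trans (gemb_Lnorm gemb bS K0 (oN t t0) q1) _.
by rewrite (sqrtrM _ (ltW H0)) sqrtr_sqr (ger0_norm N0) mulrA.
Qed.

Lemma semigroup_tail_le f t a : bmeas f -> 0 <= t -> 0 <= a ->
  (mu [set eta |
      (a <= `|semigroup P t f eta - \int[mu]_xi semigroup P t f xi|)%R]
   <= 2%:E * expeR (- ((a ^+ 2)%:E /
        ((4 * c * H (2 * t) 0 0)%:E * oscillation_norm 1 f ^+ 2))))%E.
Proof.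
move=> bf t0 a0; have bS : bmeas (semigroup P t f) by exact: semigroup_bmeas.
have t20 : 0 <= 2 * t by rewrite mulr_ge0.
have H0 : 0 < H (2 * t) 0 0 by exact: heat_gt0.
have cH0 : 0 < 4 * c * H (2 * t) 0 0 by rewrite !mulr_gt0.
set D := [set eta | _].
have mD : measurable D.
  have : bmeas (fun eta => `|semigroup P t f eta - \int[mu]_xi semigroup P t f xi|).
    by apply/bmeas_norm/bmeasB => //; exact: bmeas_cst.
  move=> [/(_ measurableT `[a, +oo[%classic)]; rewrite setTI => /(_ (measurable_itv _)).
  rewrite (_ : _ @^-1` _ = D)//.
  by apply/seteqP; split=> eta /=; rewrite in_itv/= andbT.
(* The exponent is 0 when the norm is infinite, the inverse of [+oo] being 0, and when the norm and
   [a] both vanish, the numerator being 0. *)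
have triv : (mu D <= 2%:E * expeR 0)%E.
  by rewrite expeR0 mule1 (le_trans (probability_le1 _ mD))// lee_fin ler1n.
have [->|[N [N0 -> oN]]] := oscillation_norm1_cases bf.
  by rewrite expe2 mulyy gt0_muley ?lte_fin// invey mule0 oppe0.
rewrite -EFin_expe -EFinM.
have [N1|Nn0] := eqVneq N 0.
  have [->|an0] := eqVneq a 0.
    by rewrite expr0n/= mul0e oppe0.
  (* Null norm and [a > 0]: the event itself has measure zero. *)
  rewrite {}N1 in oN *.
  rewrite (gemb_null_tail gemb bS) ?mule_ge0 ?expeR_ge0//.
    by rewrite (le_trans (oN _ t0))// expr0n/= mulr0.
  by rewrite lt_neqAle eq_sym an0.
have K0 : 0 < H (2 * t) 0 0 * N ^+ 2.
  by rewrite mulr_gt0// exprn_gt0// lt_neqAle eq_sym Nn0.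
apply: le_trans (gemb_gauss_tail gemb bS K0 (oN t t0) a0) _.
rewrite inver mulf_eq0 gt_eqF//= expf_eq0/= (negbTE Nn0).
by rewrite -EFinM mulrA.
Qed.

End semigroup_concentration.

Theorem theorem3p2 (R : realType) (d : nat) (d_gt0 : (0 < d)%N)
    (p : site d -> site d -> R) (kernel_p : exclusion_kernel p)
    (P : R -> R.-pker config d ~> config d) (sep_P : symmetric_exclusion p P) :
  (forall (c : R) (mu : probability (config d) R), GEMB c mu ->
   forall t q a : R, 0 <= t -> 1 <= q -> 0 <= a ->
   forall f : config d -> R,
     measurable_fun [set: config d] f -> bounded_fun f ->
     (Lnorm mu q%:E (fun eta =>
         (semigroup P t f eta - fine 'E_mu[semigroup P t f])%:E)
      <= (2 * Num.sqrt c * (q * Gamma (q / 2)) `^ q^-1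
          * Num.sqrt (heat_kernel p (2 * t) 0 0))%:E * oscillation_norm 1 f)%E
     /\
     (mu [set eta |
         (a <= `|semigroup P t f eta - fine 'E_mu[semigroup P t f]|)%R]
      <= 2%:E * expeR (- ((a ^+ 2)%:E /
           ((4 * c * heat_kernel p (2 * t) 0 0)%:E
            * oscillation_norm 1 f ^+ 2))))%E)
  /\
  (forall (rho : R) (nu : probability (config d) R),
   0 <= rho <= 1 -> bernoulli_product rho nu ->
   GEMB (1 / 8) nu /\
   forall t q : R, 0 <= t -> 1 <= q ->
   forall f : config d -> R,
     measurable_fun [set: config d] f -> bounded_fun f ->
     (Lnorm nu q%:E (fun eta =>
         (semigroup P t f eta - fine 'E_nu[f])%:E)
      <= (2 `^ (- 2^-1) * (q * Gamma (q / 2)) `^ q^-1)%:E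
         * oscillation_norm 1 f
         * (Num.sqrt (heat_kernel p (2 * t) 0 0))%:E)%E).
Proof.
split=> [c mu gemb t q a t0 q1 a0 f mf bdf|rho nu rho01 nuB].
  have bf := bmeas_bounded_fun mf bdf; rewrite expectationE.
  by split; [exact: semigroup_Lnorm_le|exact: semigroup_tail_le].
have gemb := bernoulli_GEMB rho01 nuB; split=> // t q t0 q1 f mf bdf.
have bf := bmeas_bounded_fun mf bdf.
(* Invariance identifies the two centrings. *)
rewrite expectationE -(int_semigroup kernel_p sep_P rho01 nuB bf t0).
apply: le_trans (semigroup_Lnorm_le kernel_p sep_P gemb bf t0 q1) _.
suff E : 2 * Num.sqrt (1 / 8) = 2 `^ (- 2^-1) :> R.
  by rewrite [leRHS]muleAC -EFinM E.
have s2 : 0 < Num.sqrt 2 :> R by rewrite sqrtr_gt0.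
have s22 : Num.sqrt 2 ^+ 2 = 2 :> R by rewrite sqr_sqrtr.
have -> : 1 / 8 = (Num.sqrt 2 / 4) ^+ 2 :> R by rewrite expr_div_n s22; field.
rewrite sqrtr_sqr ger0_norm ?divr_ge0 ?sqrtr_ge0// powRN powR12_sqrt//.
apply: (mulIf (lt0r_neq0 s2)); rewrite mulVf ?gt_eqF//.
have -> : 2 * (Num.sqrt 2 / 4) * Num.sqrt 2 = Num.sqrt 2 ^+ 2 / 2 :> R by field.
by rewrite s22 divff.
Qed.
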